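(* Let $S\subset\mathbb N_0$ be nonempty, $\theta\in(0,1)$, let $\phi\in C^\theta(X_S)$ be renewal-type with induced one-symbol potential $\psi:S\to\mathbb R$, let $P$ be the unique real solution of $\sum_{n\in S}e^{\psi(n)-P(n+1)}=1$, and assume $P>\phi(0^\infty)$. Let $\nu_\phi$ be the Bernoulli measure on $Y_S=S^{\mathbb N_0}$ with one-coordinate weights $p_n=e^{\psi(n)-P(n+1)}$, $n\in S$. Then the lifted measure $\mu_\phi=L(\nu_\phi)$ is the unique equilibrium state of $\phi$ on $X_S$, and $$P_{\mathrm{top}}(X_S,\sigma,\phi)=P.$$
   Context: $\mathbb N_0=\{0,1,2,\dots\}$. For nonempty $S\subset\mathbb N_0$, the one-sided $S$-gap shift $X_S\subset\{0,1\}^{\mathbb N_0}$ is the set of all $x=(x_k)_{k\ge0}$ such that whenever two consecutive (i.e. successive) symbols $1$ occur in $x$, the number of zeros between them belongs to $S$; it contains $0^\infty=000\cdots$, and $\sigma$ is the left shift. For $\theta\in(0,1)$ put $d_\theta(x,y)=\theta^{t(x,y)}$, $t(x,y)=\min\{k\ge0:x_k\ne y_k\}$, $d_\theta(x,x)=0$. $C^\theta(X_S)$ is the space of bounded real functions with $\|f\|_\theta=\|f\|_\infty+|f|_\theta<\infty$, where $|f|_\theta=\sup_{x\ne y}|f(x)-f(y)|/d_\theta(x,y)$. Let $Y_S=S^{\mathbb N_0}$ with its left shift (also denoted $\sigma$), $\pi(y)=10^{y_0}10^{y_1}10^{y_2}\cdots\in X_S$ and $\tau(y)=y_0+1$ for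 $y\in Y_S$. A potential $\phi\in C^\theta(X_S)$ is renewal-type, with induced one-symbol potential $\psi:S\to\mathbb R$, if $\sum_{j=0}^{\tau(y)-1}\phi(\sigma^j\pi(y))=\psi(y_0)$ for all $y\in Y_S$. The equation for $P$ has exactly one real solution. For a $\sigma$-invariant Borel probability measure $\nu$ on $Y_S$ with $m_\nu=\int\tau\,d\nu<\infty$, its lift $L(\nu)$ is the $\sigma$-invariant Borel probability measure on $X_S$ defined by $\int f\,dL(\nu)=\frac1{m_\nu}\int\sum_{j=0}^{\tau(y)-1}f(\sigma^j\pi(y))\,d\nu(y)$ for bounded measurable $f:X_S\to\mathbb R$. Under the hypotheses, $\int\tau\,d\nu_\phi=\sum_{n\in S}(n+1)p_n<\infty$, so $L(\nu_\phi)$ is defined. $P_{\mathrm{top}}$ is the topological pressure, equal by the variational principle to $\sup_\mu\{h_\mu(\sigma)+\int\phi\,d\mu\}$ over $\sigma$-invariant Borel probability measures; an equilibrium state is an invariant measure attaining this supremum. *)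

(* Defs.v *)
From HB Require Import structures.
From mathcomp Require Import all_boot all_order all_algebra.
From mathcomp Require Import all_classical all_reals all_analysis.

Set Implicit Arguments.
Unset Strict Implicit.
Unset Printing Implicit Defensive.

Import Order.TTheory GRing.Theory Num.Theory.
Import numFieldNormedType.Exports.

Local Open Scope classical_set_scope.
Local Open Scope ring_scope.

Definition invariant_measure (disp : measure_display) (T : measurableType disp)
    (R : realType) (f : T -> T) (mu : probability T R) : Prop :=
  forall A : set T, measurable A -> mu (f @^-1` A) = mu A.

Definition finite_partition (disp : measure_display) (T : measurableType disp)
    (k : nat) (xi : 'I_k -> set T) : Prop :=
  [/\ forall i, measurable (xi i), trivIset setT xi & \bigcup_i xi i = setT].

(* The cell of the join of xi, f^-1 xi, ..., f^-(n-1) xi with itinerary w. *)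
Definition join_cell (T : Type) (f : T -> T) (k : nat) (xi : 'I_k -> set T)
    (n : nat) (w : {ffun 'I_n -> 'I_k}) : set T :=
  \bigcap_(i in [set: 'I_n]) (iter i f @^-1` xi (w i)).

(* Empty cells contribute 0, as 0 * ln 0 = 0. *)
Definition join_entropy (disp : measure_display) (T : measurableType disp)
    (R : realType) (f : T -> T) (mu : probability T R)
    (k : nat) (xi : 'I_k -> set T) (n : nat) : R :=
  - \sum_(w : {ffun 'I_n -> 'I_k})
      fine (mu (join_cell f xi w)) * ln (fine (mu (join_cell f xi w))).

(* For an invariant mu the limit exists, by subadditivity. *)
Definition partition_entropy (disp : measure_display) (T : measurableType disp)
    (R : realType) (f : T -> T) (mu : probability T R)
    (k : nat) (xi : 'I_k -> set T) : R :=
  limn (fun n : nat => join_entropy f mu xi n / n%:R).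

Definition kolmogorov_sinai_entropy (disp : measure_display) (T : measurableType disp)
    (R : realType) (f : T -> T) (mu : probability T R) : \bar R :=
  ereal_sup [set h | exists (k : nat) (xi : 'I_k -> set T),
    finite_partition xi /\ h = (partition_entropy f mu xi)%:E].

Definition free_energy (disp : measure_display) (T : measurableType disp)
    (R : realType) (f : T -> T) (phi : T -> R) (mu : probability T R) : \bar R :=
  (kolmogorov_sinai_entropy f mu + \int[mu]_x (phi x)%:E)%E.

Definition equilibrium_state (disp : measure_display) (T : measurableType disp)
    (R : realType) (f : T -> T) (phi : T -> R) (mu : probability T R) : Prop :=
  invariant_measure f mu /\
  free_energy f phi mu = ereal_sup
    [set free_energy f phi nu | nu in
      [set nu : probability T R | invariant_measure f nu]].

Definition birkhoff_sum (T : Type) (R : realType) (f : T -> T) (phi : T -> R)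
    (n : nat) (x : T) : R :=
  \sum_(j < n) phi (iter j f x).

Definition bowen_dist (T : Type) (R : realType) (d : T -> T -> R) (f : T -> T)
    (n : nat) (x y : T) : R :=
  \big[Num.max/0]_(j < n) d (iter j f x) (iter j f y).

Definition separated (T : Type) (R : realType) (d : T -> T -> R) (f : T -> T)
    (n : nat) (eps : R) (E : set T) : Prop :=
  forall x y, E x -> E y -> x <> y -> eps < bowen_dist d f n x y.

Definition separated_sum (T : choiceType) (R : realType) (d : T -> T -> R)
    (f : T -> T) (phi : T -> R) (n : nat) (eps : R) : \bar R :=
  ereal_sup [set (\sum_(x \in E) expR (birkhoff_sum f phi n x))%:E |
    E in [set E : set T | finite_set E /\ separated d f n eps E]].

Definition topological_pressure (T : choiceType) (R : realType)
    (d : T -> T -> R) (f : T -> T) (phi : T -> R) : \bar R :=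
  lim (limn_esup (fun n : nat =>
         ((n%:R^-1)%:E * lne (separated_sum d f phi n eps))%E)
       @[eps --> 0^'+]).

(* The symbols 0 and 1 are [false] and [true]. *)
Definition gap_shift_set (S : set nat) : set {ptws nat -> bool} :=
  [set x : {ptws nat -> bool} | forall i n : nat, x i -> x (i + n).+1 ->
     (forall j, (i < j < (i + n).+1)%N -> ~~ x j) -> S n].

Definition gap_shift (S : set nat) : Type := set_type (gap_shift_set S).

HB.instance Definition _ (S : set nat) := Topological.on (gap_shift S).

Lemma zero_seq_subproof (S : set nat) :
  ((fun _ => false) : {ptws nat -> bool}) \in gap_shift_set S.
Proof. by rewrite inE. Qed.

Definition zero_seq (S : set nat) : gap_shift S :=
  exist (fun x => x \in gap_shift_set S) _ (zero_seq_subproof S).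

HB.instance Definition _ (S : set nat) :=
  isPointed.Build (gap_shift S) (zero_seq S).

(* Borel sigma-algebra of the topology inherited from {0,1}^N *)
HB.instance Definition _ (S : set nat) :=
  Measurable.copy (gap_shift S) (g_sigma_algebraType (@open (gap_shift S))).

Lemma gap_shift_map_subproof (S : set nat) (x : gap_shift S) :
  ((fun k => val x k.+1) : {ptws nat -> bool}) \in gap_shift_set S.
Proof.
rewrite inE => i n xi xn x0; have := valP x; rewrite inE => /(_ i.+1 n).
rewrite addSn; apply => // -[//|j] /andP[ij jn].
by apply: x0; rewrite -ltnS ij.
Qed.

Definition gap_shift_map (S : set nat) (x : gap_shift S) : gap_shift S :=
  exist (fun x => x \in gap_shift_set S) _ (gap_shift_map_subproof x).

Definition dtheta (R : realType) (theta : R) (S : set nat)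
    (x y : gap_shift S) : R :=
  if pselect (exists k, val x k != val y k) is left xy
  then theta ^+ ex_minn xy else 0.
Arguments dtheta {R} theta S x y.

Definition sup_norm (T : Type) (R : realType) (f : T -> R) : \bar R :=
  ereal_sup [set (`|f x|)%:E | x in setT].

Definition holder_seminorm (T : Type) (R : realType) (d : T -> T -> R)
    (f : T -> R) : \bar R :=
  ereal_sup [set (`|f p.1 - f p.2| / d p.1 p.2)%:E |
    p in [set p : T * T | p.1 <> p.2]].

Definition holder_space (T : Type) (R : realType) (d : T -> T -> R)
    : set (T -> R) :=
  [set f | (sup_norm f + holder_seminorm d f < +oo)%E].

(* Measurable types are pointed, hence the parameter hS. *)
Definition renewal_base (S : set nat) (hS : S !=set0) : Type :=
  {ptws nat -> S}.

HB.instance Definition _ (S : set nat) (hS : S !=set0) :=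
  Topological.copy (renewal_base hS) {ptws nat -> S}.

Lemma renewal_base_point_subproof (S : set nat) (hS : S !=set0) :
  projT1 (cid hS) \in S.
Proof. by rewrite inE; exact: (projT2 (cid hS)). Qed.

HB.instance Definition _ (S : set nat) (hS : S !=set0) :=
  isPointed.Build (renewal_base hS)
    (fun _ => exist (fun n => n \in S) _ (renewal_base_point_subproof hS)).

(* Borel sigma-algebra of the product topology, S being discrete *)
HB.instance Definition _ (S : set nat) (hS : S !=set0) :=
  Measurable.copy (renewal_base hS)
    (g_sigma_algebraType (@open (renewal_base hS))).

Definition base_shift_map (S : set nat) (hS : S !=set0)
    (y : renewal_base hS) : renewal_base hS := fun k => y k.+1.

Definition return_time (S : set nat) (hS : S !=set0)
    (y : renewal_base hS) : nat := (val (y 0%N)).+1.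

(* In 1 0^(y 0) 1 0^(y 1) 1 0^(y 2) ... the m-th symbol 1 is at this position. *)
Definition one_position (S : set nat) (hS : S !=set0)
    (y : renewal_base hS) (m : nat) : nat :=
  (\sum_(i < m) (val (y i)).+1)%N.

Definition renewal_seq (S : set nat) (hS : S !=set0)
    (y : renewal_base hS) : {ptws nat -> bool} :=
  fun k => `[< exists m, k = one_position y m >].

Lemma one_positionS (S : set nat) (hS : S !=set0) (y : renewal_base hS) m :
  one_position y m.+1 = (one_position y m + val (y m)).+1.
Proof. by rewrite /one_position big_ord_recr /= addnS. Qed.

Lemma one_position_homo (S : set nat) (hS : S !=set0) (y : renewal_base hS) :
  {homo one_position y : m n / (m < n)%N}.
Proof.
apply: homo_ltn => [? ? ?|m]; first exact: ltn_trans.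
by rewrite one_positionS ltnS leq_addr.
Qed.

Lemma renewal_seq_subproof (S : set nat) (hS : S !=set0)
  (y : renewal_base hS) : renewal_seq y \in gap_shift_set S.
Proof.
rewrite inE => i n /asboolP[a ->{i}] /asboolP[b eb] no1.
have lt_pos : {mono one_position y : m n / (m < n)%N}.
  by apply: leqW_mono; apply: leq_mono => ? ?; exact: one_position_homo.
have ab : (a < b)%N by rewrite -lt_pos -eb ltnS leq_addr.
have {ab} eab : b = a.+1.
  apply/eqP; rewrite eqn_leq ab andbT leqNgt; apply/negP => ltb.
  have := no1 (one_position y a.+1); rewrite eb !lt_pos ltnSn ltb => /(_ isT).
  by move/asboolP; apply; exists a.+1.
move: eb; rewrite eab one_positionS => -[] /addnI ->.
by have := valP (y a); rewrite inE.
Qed.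

Definition renewal_code (S : set nat) (hS : S !=set0)
    (y : renewal_base hS) : gap_shift S :=
  exist (fun x => x \in gap_shift_set S) _ (renewal_seq_subproof y).

Definition renewal_type (R : realType) (S : set nat) (hS : S !=set0)
    (phi : gap_shift S -> R) (psi : S -> R) : Prop :=
  forall y : renewal_base hS,
    \sum_(j < return_time y) phi (iter j (@gap_shift_map S) (renewal_code y))
    = psi (y 0%N).

Definition bernoulli_measure (R : realType) (S : set nat) (hS : S !=set0)
    (p : S -> R) (nu : probability (renewal_base hS) R) : Prop :=
  forall (n : nat) (w : nat -> S),
    nu [set y | forall i, (i < n)%N -> y i = w i] = (\prod_(i < n) p (w i))%:E.

Definition mean_return_time (R : realType) (S : set nat) (hS : S !=set0)
    (nu : probability (renewal_base hS) R) : \bar R :=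
  (\int[nu]_y ((return_time y)%:R : R)%:E)%E.

Definition is_lift (R : realType) (S : set nat) (hS : S !=set0)
    (nu : probability (renewal_base hS) R)
    (mu : probability (gap_shift S) R) : Prop :=
  [/\ invariant_measure (@base_shift_map S hS) nu,
      (mean_return_time nu < +oo)%E,
      invariant_measure (@gap_shift_map S) mu &
      forall f : gap_shift S -> R, measurable_fun setT f ->
        (exists M : R, forall x, `|f x| <= M) ->
        (\int[mu]_x (f x)%:E =
         ((fine (mean_return_time nu))^-1)%:E *
         \int[nu]_y (\sum_(j < return_time y)
           f (iter j (@gap_shift_map S) (renewal_code y)))%:E)%E].

(* Main.v *)
Require Import Defs.
From HB Require Import structures.
From mathcomp Require Import all_boot all_order all_algebra.
From mathcomp Require Import all_classical all_reals all_analysis.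
From mathcomp Require Import measurable_realfun.
From mathcomp Require Import ring lra zify.

Set Implicit Arguments.
Unset Strict Implicit.
Unset Printing Implicit Defensive.

Import Order.TTheory GRing.Theory Num.Theory.
Import numFieldNormedType.Exports.

Local Open Scope classical_set_scope.
Local Open Scope ring_scope.


(** Read up to time [N], a point of the gap shift consists of zeros, some completed
    blocks [1 0^n], and an incomplete last block [gap_shift_decomposition].  Since
    [phi] has bounded distortion, its Birkhoff sum [S_N phi - N P] is, up to a bounded
    error, the sum of the logarithms of the weights [p_n] of the completed blocks minus
    [P - phi(0^oo)] times the number of remaining symbols [birkhoff_decomposition].  So
    [exp (S_N phi - N P)] is comparable with the Bernoulli probability of the completed
    blocks times a factor that is geometric in the number of remaining symbols, of ratio
    [exp (phi(0^oo) - P) < 1].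

    Summing this over the words of length [N], with at most [N + 1] positions of the
    first block and [N + 1] numbers of blocks, gives a weight on words that dominates
    [exp (S_N phi - N P)] and has total mass at most [(N + 1)^2] up to a constant
    [word_weights].  This bounds separated sums, whence the pressure is at most [P].  It
    also bounds the free energy of every invariant measure: any finite partition is, up
    to small measure, a partition into words [partition_approximation], so that Gibbs'
    inequality against the weights, with a small penalty for each error of the
    approximation, bounds the entropy of the partition by [P] minus the mean of [phi]
    [partition_entropy_le].

    Conversely, the weights [p_n] decay geometrically because [P > phi(0^oo)], and an
    invariance argument on the tower bounds the mass of a cylinder for the lift by a
    constant times [exp (S_N phi - N P)] [lift_gibbs_upper].  Hence each word carries
    enough information for the partition by the first coordinate to have entropy at
    least [P] minus the mean of [phi], and the lift is an equilibrium state
    [gibbs_free_energy].  As the cylinders of length [N] have total mass one, the same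
    bound makes the separated sums at least [exp (N P)] up to a constant.

    For uniqueness, let [f] depend on finitely many coordinates and have mean zero for
    the lift.  Its sums over the return blocks then have mean zero for the Bernoulli
    measure, and by independence their Birkhoff sums have exponential moments
    [E exp (t S_M) <= exp (C t^2 M)] for small [t] [birkhoff_exp_moment].  So the weights
    dominating [exp (S_N phi - N P + t S_N f)] have total mass [exp (C t^2 N)] up to
    polynomial factors, and every invariant measure [mu'] satisfies
    [h(mu') + mu'(phi) + t mu'(f) <= P + C t^2].  If [mu'] is an equilibrium state, then
    [t mu'(f) <= C t^2] for all small [t] of both signs, and [mu'(f) = 0]
    [equilibrium_mean_eq0].  For [f] the centred indicator of a cylinder this says that
    [mu'] and the lift agree on it. *)

(** * Sequence spaces: cylinders and measurability *)

Section Cylinders.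
Variables (T : Type) (A : Type) (c : T -> nat -> A).

Definition agree (N : nat) (x z : nat -> A) := forall i, (i < N)%N -> x i = z i.

Definition cyl (s : seq A) : set T := [set z | mkseq (c z) (size s) = s].

Definition cylinders : set (set T) := [set B | B = set0 \/ exists s, B = cyl s].

(** Openness for the product topology, expressed by coordinates. *)
Definition locally_determined (B : set T) :=
  forall x, B x -> exists N, forall z, agree N (c x) (c z) -> B z.

Lemma mkseq_agree N x z : mkseq x N = mkseq z N <-> agree N x z.
Proof.
split=> [e i iN|e]; last first.
  by apply/eq_in_map => i; rewrite mem_iota => /andP[_ iN]; exact: e.
by have := congr1 (nth (x i) ^~ i) e; rewrite !nth_mkseq.
Qed.

Lemma agree_sym N (x z : nat -> A) : agree N x z -> agree N z x.
Proof. by move=> e i iN; rewrite e. Qed.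

Lemma agree_le N M (x z : nat -> A) : (N <= M)%N -> agree M x z -> agree N x z.
Proof. by move=> NM e i iN; apply: e; exact: leq_trans NM. Qed.

Lemma cyl_mkseqP N x z : cyl (mkseq (c x) N) z <-> agree N (c x) (c z).
Proof.
rewrite /cyl /= size_mkseq; split=> [/mkseq_agree/agree_sym//|].
by move=> /agree_sym/mkseq_agree.
Qed.

Lemma cyl_mem s z : cyl s z -> cyl s = cyl (mkseq (c z) (size s)).
Proof. by rewrite /cyl /= => e; rewrite e. Qed.

Lemma cyl_nil : cyl [::] = setT.
Proof. by rewrite eqEsubset; split. Qed.

Lemma setI_closed_cylinders : setI_closed cylinders.
Proof.
move=> _ B' [->|[s ->]]; first by rewrite set0I; left.
case=> [->|[s' ->]]; first by rewrite setI0; left.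
wlog ss' : s s' / (size s <= size s')%N.
  move=> wl; case/orP: (leq_total (size s) (size s')); first exact: wl.
  by rewrite setIC; exact: wl.
have [e|ne] := pselect (take (size s) s' = s); last first.
  left; rewrite eqEsubset; split=> // z [zs zs']; apply: ne.
  by rewrite -zs' /mkseq -map_take take_iota (minn_idPl ss').
right; exists s'; rewrite eqEsubset; split=> [z []//|z zs']; split=> //.
by rewrite /cyl /= -[RHS]e -[in RHS]zs' /mkseq -map_take take_iota (minn_idPl ss').
Qed.

End Cylinders.

(** A measurable space of sequences over a countable alphabet whose
    sigma-algebra is the one generated by the cylinders; the one-sided shift
    spaces below are treated uniformly through this interface. *)
Definition cylindrical d (T : measurableType d) (A : Type) (c : T -> nat -> A) :=
  (forall s, measurable (cyl c s)) /\
  (forall B : set T, measurable B -> <<s cylinders c >> B).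

Section Cylindrical.
Context {d : measure_display} {T : measurableType d} {A : countType}.
Variables (c : T -> nat -> A) (cT : cylindrical c).

Lemma cylindrical_measurableE : @measurable d T = <<s cylinders c >>.
Proof.
rewrite eqEsubset; split; first exact: cT.2.
apply: smallest_sub; first exact: sigma_algebra_measurable.
by move=> B [->|[s ->]]; [exact: measurable0|exact: cT.1].
Qed.

Lemma locally_determined_measurable B : locally_determined c B -> measurable B.
Proof.
move=> Bc.
have -> : B = \bigcup_(s in setT) (if `[< cyl c s `<=` B >] then cyl c s else set0).
  rewrite eqEsubset; split=> [x Bx|x [s _]]; last by case: asboolP => // sB /sB.
  have [N NB] := Bc x Bx; exists (mkseq (c x) N) => //.
  case: asboolP => [_|[]]; first exact/cyl_mkseqP.
  by move=> z /cyl_mkseqP/NB.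
apply: countable_bigcupT_measurable => [|s]; first exact: countableP.
by case: asboolP => // _; exact: cT.1.
Qed.

Lemma determined_measurable N B :
  (forall x z, agree N (c x) (c z) -> B x -> B z) -> measurable B.
Proof.
move=> h; apply: locally_determined_measurable => x Bx; exists N => z xz.
exact: h Bx.
Qed.

Lemma locally_determined_fun d' (T' : measurableType d') (G : set (set T'))
    (f : T -> T') : @measurable _ T' = <<s G >> ->
  (forall B, G B -> locally_determined c (f @^-1` B)) -> measurable_fun setT f.
Proof.
move=> mG h; apply: (measurability G) => // _ [B GB <-].
by rewrite setTI; apply: locally_determined_measurable; exact: h.
Qed.

Lemma cylindrical_fun d' (T' : measurableType d') (g : T' -> T) :
  (forall s, measurable (g @^-1` cyl c s)) -> measurable_fun setT g.
Proof.
move=> h; apply: (measurability (cylinders c)); first exact: cylindrical_measurableE.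
move=> _ [B [->|[s ->]] <-]; rewrite setTI; last exact: h.
by rewrite preimage_set0; exact: measurable0.
Qed.

(** The cylinders form a pi-system. *)
Lemma cylindrical_unique (R : realType) (m1 m2 : {measure set T -> \bar R}) :
  (m1 setT < +oo)%E -> (forall s, m1 (cyl c s) = m2 (cyl c s)) ->
  forall B, measurable B -> m1 B = m2 B.
Proof.
move=> m1oo h B mB; apply: (measure_unique (cylinders c) (fun _ => setT)) => //.
- exact: cylindrical_measurableE.
- exact: setI_closed_cylinders.
- by move=> _; right; exists [::]; rewrite cyl_nil.
- by rewrite bigcup_const //; exists 0%N.
- by move=> _ [->|[s ->]]; [rewrite !measure0|exact: h].
Qed.

End Cylindrical.

(** Sequences that agree with [x] on longer and longer initial segments converge
    to [x], whatever the topology of the alphabet. *)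
Lemma open_ptws_determined (V : topologicalType) (O : set {ptws nat -> V})
    (x : {ptws nat -> V}) : open O -> O x ->
  exists N, forall z : {ptws nat -> V}, agree N x z -> O z.
Proof.
move=> oO Ox; apply: contrapT => /forallNP nO.
have {}nO N : exists z : {ptws nat -> V}, agree N x z /\ ~ O z.
  have /existsNP[z /not_implyP[xz nOz]] := nO N; by exists z.
have [z /all_and2[xz nOz]] := choice nO.
have zx : z n @[n --> \oo] --> x.
  apply/cvg_sup => N U [W] [[W' oW' <-]] W'x WU.
  exists N.+1 => //= n Nn; apply: WU => /=.
  by rewrite /preimage /= -(xz n N Nn).
have [N _ /(_ N (leqnn _)) /=] := zx O (open_nbhs_nbhs (conj oO Ox)).
exact: nOz.
Qed.

(** Passing from a topological to a combinatorial description of the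
    sigma-algebra; countability of the alphabet makes an open set a countable
    union of cylinders. *)
Lemma borel_cylindrical d (T : measurableType d) (A : countType)
    (c : T -> nat -> A) (G : set (set T)) :
  @measurable _ T = <<s G >> -> (forall B, G B -> locally_determined c B) ->
  (forall k a, measurable [set x | c x k = a]) -> cylindrical c.
Proof.
move=> mG Gc mk; split=> [s|B].
  have [->|/set0P[z zs]] := eqVneq (cyl c s) set0; first exact: measurable0.
  have -> : cyl c s = \bigcap_(i < size s) [set x | c x i = c z i].
    rewrite eqEsubset (cyl_mem zs); split=> x; first by move=> /cyl_mkseqP e i /= /e.
    by move=> h; apply/cyl_mkseqP => i si; rewrite h.
  exact: fin_bigcap_measurable.
rewrite mG; apply: smallest_sub; first exact: smallest_sigma_algebra.
move=> O /Gc oO.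
have -> : O = \bigcup_(s in setT) (if `[< cyl c s `<=` O >] then cyl c s else set0).
  rewrite eqEsubset; split=> [x Bx|x [s _]]; last by case: asboolP => // sB /sB.
  have [N NB] := oO x Bx; exists (mkseq (c x) N) => //.
  case: asboolP => [_|[]]; first exact/cyl_mkseqP.
  by move=> z /cyl_mkseqP/NB.
apply: (@countable_bigcupT_measurable _ (g_sigma_algebraType (cylinders c))) => [|s].
  exact: countableP.
by apply: sub_sigma_algebra; case: asboolP => _; [right; exists s|left].
Qed.

Definition gap_coord (S : set nat) (x : gap_shift S) : nat -> bool := val x.

Lemma gap_shift_cylindrical (S : set nat) : cylindrical (@gap_coord S).
Proof.
apply: (@borel_cylindrical _ _ bool (@gap_coord S) open) => // [B|k b].
  move=> [U oU <-] x Ux.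
  have [N NU] := open_ptws_determined oU Ux; exists N => z; exact: NU.
apply: sub_sigma_algebra; exists [set z : {ptws nat -> bool} | z k = b] => //.
have : continuous (fun z : {ptws nat -> bool} => z k).
  exact: (@proj_continuous nat (fun=> bool) k).
move=> /continuousP/(_ [set b]); apply; exact: discrete_open.
Qed.

Definition base_coord (S : set nat) (hS : S !=set0) (y : renewal_base hS) :
  nat -> S := y.

Lemma renewal_base_cylindrical (S : set nat) (hS : S !=set0) :
  cylindrical (@base_coord S hS).
Proof.
apply: (@borel_cylindrical _ _ S (@base_coord S hS) open) => // [U oU x Ux|k s].
  have [N NU] := open_ptws_determined oU Ux; exists N => z; exact: NU.
apply: sub_sigma_algebra.
have : continuous (fun z : {ptws nat -> S} => z k).
  exact: (@proj_continuous nat (fun=> S : topologicalType) k).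
move=> /continuousP/(_ [set s]); apply.
exists [set val s]; first exact: discrete_open.
by rewrite eqEsubset; split=> z /= => [/val_inj|->].
Qed.

(** * Bernoulli measures *)

Section PushForward.
Context d d' (T : measurableType d) (T' : measurableType d') (R : realType).

Lemma pushforward_measure (m : {measure set T -> \bar R}) (f : T -> T') :
  measurable_fun setT f ->
  exists m' : {measure set T' -> \bar R}, forall A, m' A = m (f @^-1` A).
Proof.
move=> mf; unshelve refine
  (ex_intro _ (pushforward m f : {measure set T' -> \bar R}) _); first exact: mf.
by [].
Qed.

End PushForward.

Section BernoulliExistence.
Context {R : realType} {S : set nat} (hS : S !=set0).
Variables (p : S -> R).
Hypothesis p_gt0 : forall s, 0 < p s.
Hypothesis p_sum : (\esum_(s in [set: S]) (p s)%:E = 1)%E.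

(** The weight function extended by zero to all of [nat], where the order makes it
    possible to lay the weights end to end. *)
Definition ext_weight (n : nat) : R := oapp p 0 (insub n : option S).

Definition cum_weight (n : nat) : R := \sum_(i < n) ext_weight i.

Lemma ext_weight_ge0 n : 0 <= ext_weight n.
Proof. by rewrite /ext_weight; case: insubP => //= s _ _; exact: ltW. Qed.

Lemma ext_weight_val (s : S) : ext_weight (val s) = p s.
Proof. by rewrite /ext_weight valK. Qed.

Lemma ext_weight_gt0 n : 0 < ext_weight n -> exists s : S, val s = n.
Proof.
by rewrite /ext_weight; case: insubP => /= [s _ <- _|_]; [exists s|rewrite ltxx].
Qed.

Lemma cum_weightS n : cum_weight n.+1 = cum_weight n + ext_weight n.
Proof. by rewrite /cum_weight big_ord_recr. Qed.

Lemma cum_weight_homo : {homo cum_weight : m n / (m <= n)%N >-> m <= n}.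
Proof.
apply: homo_leq => [//|? ? ?|n]; first exact: le_trans.
by rewrite cum_weightS lerDl ext_weight_ge0.
Qed.

Lemma cum_weight_cvg : cum_weight n @[n --> \oo] --> (1 : R).
Proof.
have e : (\sum_(i <oo) (ext_weight i)%:E = 1)%E.
  rewrite nneseries_esumT; last by move=> n; rewrite lee_fin ext_weight_ge0.
  transitivity (\esum_(i in S) (ext_weight i)%:E)%E.
    rewrite [RHS]esum_mkcond; apply: eq_esum => i _; case: ifPn => // iS.
    by rewrite /ext_weight insubN.
  rewrite (@reindex_esum _ _ _ [set: S] S val); last first.
    split=> [s _|s t _ _|n nS]; [exact: set_valP|exact: val_inj|].
    by exists (exist _ n (mem_set nS)).
  by rewrite -p_sum; apply: eq_esum => s _; rewrite ext_weight_val.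
have : (cum_weight n)%:E @[n --> \oo] --> 1%E.
  have -> : (fun n => (cum_weight n)%:E) = (fun n => \sum_(0 <= i < n) (ext_weight i)%:E)%E.
    by apply/funext => n; rewrite sumEFin big_mkord.
  rewrite -e; apply: is_cvg_nneseries => n _ _.
  by rewrite lee_fin ext_weight_ge0.
by move=> /fine_cvgP[_].
Qed.

Lemma cum_weight_le1 n : cum_weight n <= 1.
Proof.
rewrite -(cvg_lim (@Rhausdorff _) cum_weight_cvg).
apply: nondecreasing_cvgn_le; first exact: cum_weight_homo.
by apply/cvg_ex; exists 1; exact: cum_weight_cvg.
Qed.

Let s0 : S := exist (fun n => n \in S) _ (renewal_base_point_subproof hS).

(** The unit interval is cut into consecutive intervals of lengths [p s]; a point
    is coded by the sequence of intervals visited under the map stretching each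
    of them affinely over the whole unit interval. *)
Definition digit (x : R) : S :=
  if pselect (exists s : S, cum_weight (val s) <= x < cum_weight (val s) + p s)
  is left e then projT1 (cid e) else s0.

Definition stretch (x : R) : R := (x - cum_weight (val (digit x))) / p (digit x).

Definition digits (x : R) (k : nat) : S := digit (iter k stretch x).

Lemma digit_uniq x (s : S) :
  cum_weight (val s) <= x < cum_weight (val s) + p s -> digit x = s.
Proof.
move=> xs; rewrite /digit; case: pselect => [e|[]]; last by exists s.
case: (cid e) => t xt /=; apply: val_inj; apply/eqP.
have key (u v : S) : cum_weight (val u) <= x < cum_weight (val u) + p u ->
    cum_weight (val v) <= x < cum_weight (val v) + p v -> (val u <= val v)%N.
  move=> /andP[ux _] /andP[_ xv]; rewrite leqNgt; apply/negP => vu.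
  have := le_lt_trans ux xv.
  by rewrite -ext_weight_val -cum_weightS ltNge cum_weight_homo.
by rewrite eqn_leq (key t s)// (key s t).
Qed.

Lemma digitP x : 0 <= x < 1 ->
  cum_weight (val (digit x)) <= x < cum_weight (val (digit x)) + p (digit x).
Proof.
move=> /andP[x0 x1].
have ex : exists n, x < cum_weight n.
  have [n _ /(_ n (leqnn _)) xn] := cvgr_gt _ cum_weight_cvg _ x1; by exists n.
case: (ex_minnP ex) => -[|n] xn nmin; first by rewrite /cum_weight big_ord0 ltNge x0 in xn.
have nx : cum_weight n <= x by rewrite leNgt; apply/negP => /nmin; rewrite ltnn.
have [s sn] : exists s : S, val s = n.
  by apply: ext_weight_gt0; have := le_lt_trans nx xn; rewrite cum_weightS ltrDl.
have xs : cum_weight (val s) <= x < cum_weight (val s) + p s.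
  by rewrite -ext_weight_val -cum_weightS sn nx.
by rewrite (digit_uniq xs).
Qed.

Lemma stretch_itv x : 0 <= x < 1 -> 0 <= stretch x < 1.
Proof.
move=> /digitP/andP[h1 h2]; rewrite /stretch divr_ge0 ?subr_ge0 ?(ltW (p_gt0 _))//=.
by rewrite ltr_pdivrMr// mul1r ltrBlDl.
Qed.

(** The left endpoint of the interval of points whose first digits are [w]. *)
Definition word_start (w : seq S) : R :=
  foldr (fun s l => cum_weight (val s) + p s * l) 0 w.

Definition word_weight (w : seq S) : R := \prod_(s <- w) p s.

Lemma word_weight_gt0 w : 0 < word_weight w.
Proof. by rewrite /word_weight; apply: prodr_gt0 => s _. Qed.

Lemma word_itv_sub w : 0 <= word_start w /\ word_start w + word_weight w <= 1.
Proof.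
elim: w => [|s w [lo hi]] /=; first by rewrite /word_weight big_nil add0r.
have c0 : 0 <= cum_weight (val s) by apply: sumr_ge0 => i _; exact: ext_weight_ge0.
have c1 : cum_weight (val s) + p s <= 1.
  by rewrite -ext_weight_val -cum_weightS cum_weight_le1.
have ps := p_gt0 s; rewrite /word_weight big_cons -/(word_weight w).
split; first by rewrite addr_ge0// mulr_ge0// ltW.
by apply: le_trans c1; rewrite -addrA lerD2l -mulrDr ler_piMr// ltW.
Qed.

Lemma digits_word w x : 0 <= x < 1 -> (mkseq (digits x) (size w) = w) <->
  (word_start w <= x < word_start w + word_weight w).
Proof.
elim: w x => [|s w IH] x x01; first by rewrite /= /word_weight big_nil add0r x01.
have [lo hi] := word_itv_sub w; have ps := p_gt0 s.
rewrite /= /word_weight big_cons -/(word_weight w).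
have -> : mkseq (digits x) (size w).+1 = digit x :: mkseq (digits (stretch x)) (size w).
  rewrite /mkseq /= -[1%N]addn0 iotaDl -map_comp; congr (_ :: _).
  by apply: eq_map => k; rewrite /digits /= -iterSr.
have e : (word_start w <= (x - cum_weight (val s)) / p s < word_start w + word_weight w) =
  (cum_weight (val s) + p s * word_start w <= x <
   cum_weight (val s) + p s * word_start w + p s * word_weight w).
  rewrite ler_pdivlMr// ltr_pdivrMr// lerBrDl ltrBlDl mulrDl.
  by rewrite ![_ * p s]mulrC addrA.
split=> [[ds]|h].
  by move=> /(IH _ (stretch_itv x01)).1; rewrite /stretch ds e.
have ds : digit x = s.
  apply: digit_uniq; have /andP[h1 h2] := h; apply/andP; split.
    by apply: le_trans h1; rewrite lerDl mulr_ge0// ltW.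
  by apply: lt_le_trans h2 _; rewrite -addrA lerD2l -mulrDr ler_piMr// ltW.
rewrite ds; congr (_ :: _); apply/(IH _ (stretch_itv x01)).2.
by rewrite /stretch ds e.
Qed.

Lemma bernoulli_measure_cylE (nu : probability (renewal_base hS) R) :
  bernoulli_measure p nu <->
  (forall w, nu (cyl (@base_coord S hS) w) = (word_weight w)%:E).
Proof.
have E n (w : nat -> S) : [set y : renewal_base hS | forall i, (i < n)%N -> y i = w i] =
    cyl (@base_coord S hS) (mkseq w n).
  rewrite eqEsubset /cyl; split=> y /=; rewrite size_mkseq; first by move/mkseq_agree.
  by move/mkseq_agree.
split=> [h w|h n w]; last first.
  by rewrite E h /word_weight big_map -{1}[n]subn0 big_mkord.
have := h (size w) (nth s0 w); rewrite E mkseq_nth => ->.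
by rewrite /word_weight (big_nth s0) big_mkord.
Qed.

(** The digits of a uniformly distributed point of the unit interval are independent:
    the points with digits [w] form an interval of length [word_weight w]. *)
Lemma bernoulli_measure_exists :
  exists nu : probability (renewal_base hS) R, bernoulli_measure p nu.
Proof.
pose I : set R := `[0, 1[%classic.
have mI : measurable I by exact: measurable_itv.
(* Outside [0, 1[ the digits are meaningless, and the base point is used. *)
pose code (x : measurableTypeR R) : renewal_base hS :=
  if 0 <= x < 1 then (digits x : renewal_base hS) else point.
have codeE w : I `&` code @^-1` cyl (@base_coord S hS) w =
    `[word_start w, word_start w + word_weight w[%classic.
  have [lo hi] := word_itv_sub w.
  rewrite eqEsubset; split=> x /=; rewrite /I /= !in_itv /= /cyl /= /code.
    by move=> [x01]; rewrite x01 => /(digits_word _ x01).1.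
  move=> h; have x01 : 0 <= x < 1.
    by have /andP[h1 h2] := h; rewrite (le_trans lo h1) (lt_le_trans h2 hi).
  by split=> //; rewrite x01; exact/(digits_word _ x01).2.
have mcode : measurable_fun setT code.
  apply: (cylindrical_fun (@renewal_base_cylindrical S hS)) => w.
  rewrite -(setUIDK (code @^-1` cyl (@base_coord S hS) w) I) -/I.
  rewrite [X in X `|` _]setIC; apply: measurableU.
    by rewrite codeE; exact: measurable_itv.
  have [pw|pw] := pselect (cyl (@base_coord S hS) w point).
    suff -> : code @^-1` cyl (@base_coord S hS) w `\` I = ~` I by exact: measurableC.
    rewrite eqEsubset; split=> [x []//|x nx]; split=> //=.
    by rewrite /code; case: ifPn => // x01; exfalso; apply: nx; rewrite /I /= in_itv.
  suff -> : code @^-1` cyl (@base_coord S hS) w `\` I = set0 by exact: measurable0.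
  rewrite eqEsubset; split=> // x [/= + nx].
  by rewrite /code; case: ifPn => // x01; exfalso; apply: nx; rewrite /I /= in_itv.
have [m mE] := pushforward_measure (mrestr (@lebesgue_measure R) mI) mcode.
pose nu : probability (renewal_base hS) R := mnormalize m (dirac point).
have mcyl w : m (cyl (@base_coord S hS) w) = (word_weight w)%:E.
  transitivity (lebesgue_measure (code @^-1` cyl (@base_coord S hS) w `&` I)).
    exact: mE.
  rewrite setIC codeE lebesgue_measure_itv /= lte_fin ltrDl.
  by rewrite word_weight_gt0 -EFinD addrAC subrr add0r.
have m1 : m setT = 1%E.
  by rewrite -(cyl_nil (@base_coord S hS)) mcyl /word_weight big_nil.
exists nu; apply/bernoulli_measure_cylE => w; rewrite /nu /= /mnormalize m1 onee_eq0 /=.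
by rewrite invr1 mule1 mcyl.
Qed.

End BernoulliExistence.

(** * Transfer of integrals and independence *)

Section Transfer.
Context d d' (T : measurableType d) (T' : measurableType d') (R : realType).
Import HBNNSimple.
Local Open Scope ereal_scope.

(** Change of variables for a map defined on part of the space only: this is the
    form in which both excursions of the tower and conditioning on a cylinder
    occur. *)
Lemma ge0_integral_transfer (m : {measure set T -> \bar R})
    (m' : {measure set T' -> \bar R}) (D : set T) (phi : T -> T') (f : T' -> \bar R) :
  measurable D -> measurable_fun setT phi ->
  (forall A, measurable A -> m' A = m (phi @^-1` A `&` D)) ->
  measurable_fun setT f -> (forall y, 0 <= f y) ->
  \int[m']_y f y = \int[m]_(x in D) f (phi x).
Proof.
move=> mD mphi mE mf f0; pose f_ := nnsfun_approx measurableT mf.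
have mphiA A : measurable A -> measurable (phi @^-1` A).
  by move=> mA; rewrite -[X in measurable X]setTI; exact: mphi.
transitivity (limn (fun n => \int[m']_x (f_ n x)%:E)).
  rewrite -monotone_convergence//.
  - apply: eq_integral => y _; apply/esym/cvg_lim => //.
    exact: cvg_nnsfun_approx.
  - by move=> n; exact/measurable_EFinP/measurable_funP.
  - by move=> n y _; rewrite lee_fin.
  - by move=> y _ k n kn; rewrite lee_fin; exact/lefP/nd_nnsfun_approx.
rewrite [X in limn X](_ : _ = (fun n => \int[m]_(x in D) (EFin \o f_ n \o phi) x)).
  rewrite -monotone_convergence//; last 3 first.
    - move=> n /=; apply/measurable_EFinP; apply: measurable_funTS.
      exact: measurableT_comp.
    - by move=> n x _ /=; rewrite lee_fin.
    - by move=> x _ k n kn; rewrite lee_fin; exact/lefP/nd_nnsfun_approx.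
  by apply: eq_integral => x _ /=; apply/cvg_lim => //; exact: cvg_nnsfun_approx.
apply/funext => n.
transitivity (\sum_(k \in range (f_ n))
    \int[m]_(x in D) (k * \1_(phi @^-1` (f_ n @^-1` [set k])) x)%:E).
  rewrite integralT_nnsfun sintegralE; apply: eq_fsbigr => r _.
  have mr : measurable (f_ n @^-1` [set r]) by [].
  rewrite (integralZl_indic mD (fun r => phi @^-1` (f_ n @^-1` [set r])))//.
  - by rewrite integral_indic// ?mE//; exact: mphiA.
  - by move=> r0; rewrite preimage_nnfun0// preimage_set0.
  - exact: mphiA.
rewrite -ge0_integral_fsum//.
- apply: eq_integral => x _ /=; rewrite fsumEFin// fimfunE.
  by congr EFin; apply: eq_fsbigr => k _.
- move=> r; apply/measurable_EFinP; apply: measurable_funM => //.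
  by apply: measurable_indic; exact: mphiA.
- move=> r x _; have := nnfun_muleindic_ge0 (f_ n) r (phi x).
  by rewrite EFinM.
Qed.

(** The image under [phi] of the restriction of [m] to [D]. *)
Lemma transfer_measure (m : {measure set T -> \bar R}) (D : set T) (phi : T -> T') :
  measurable D -> measurable_fun setT phi ->
  exists m' : {measure set T' -> \bar R}, forall A, m' A = m (phi @^-1` A `&` D).
Proof.
move=> mD mphi; have [m' mE] := pushforward_measure (mrestr m mD) mphi.
by exists m'.
Qed.

End Transfer.

Section BernoulliShift.
Context {R : realType} {S : set nat} {hS : S !=set0}.
Variables (p : S -> R).
Hypothesis p_gt0 : forall s, 0 < p s.
Variable nu : probability (renewal_base hS) R.
Hypothesis nuP : bernoulli_measure p nu.

Local Notation Y := (renewal_base hS).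
Local Notation bc := (@base_coord S hS).
Local Notation shift := (@base_shift_map S hS).

Definition determined_by (U : Type) (L : nat) (g : Y -> U) :=
  forall y z : Y, agree L y z -> g y = g z.

Lemma iter_base_shift n (y : Y) k : iter n shift y k = y (k + n)%N.
Proof. by elim: n k => [|n IH] k; rewrite ?addn0//= /base_shift_map IH addSnnS. Qed.

Lemma determined_set_measurable L (B : set Y) :
  (forall y z : Y, agree L y z -> B y -> B z) -> measurable B.
Proof.
exact: (determined_measurable (@renewal_base_cylindrical S hS)).
Qed.

Lemma determined_fun_measurable d (U : measurableType d) L (g : Y -> U) :
  determined_by L g -> measurable_fun setT g.
Proof.
move=> gL _ B mB; rewrite setTI; apply: (@determined_set_measurable L).
by move=> y z yz; rewrite /= (gL y z).
Qed.

Lemma iter_base_shift_measurable n : measurable_fun setT (iter n shift).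
Proof.
apply: (cylindrical_fun (@renewal_base_cylindrical S hS)) => s.
apply: (@determined_set_measurable (n + size s)%N) => y z yz /=.
rewrite /cyl /= => <-; rewrite size_mkseq; apply/mkseq_agree => i si.
by rewrite /base_coord !iter_base_shift yz// addnC ltn_add2l.
Qed.

Lemma measurable_cyl_base w : measurable (cyl bc w).
Proof. exact: (@renewal_base_cylindrical S hS).1. Qed.

Lemma bernoulli_cyl w : nu (cyl bc w) = (word_weight p w)%:E.
Proof. exact: (bernoulli_measure_cylE p nu).1 nuP w. Qed.

Lemma cyl_cat u v : cyl bc (u ++ v) = cyl bc u `&` iter (size u) shift @^-1` cyl bc v.
Proof.
have E (y : Y) : mkseq (bc y) (size (u ++ v)) =
    mkseq (bc y) (size u) ++ mkseq (bc (iter (size u) shift y)) (size v).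
  rewrite /mkseq size_cat iotaD map_cat; congr cat.
  rewrite add0n -[X in iota X _]addn0 iotaDl -map_comp.
  by apply: eq_map => k; rewrite /= /base_coord iter_base_shift addnC.
rewrite eqEsubset /cyl; split=> y /=; rewrite E.
  by move/eqP; rewrite eqseq_cat ?size_mkseq// => /andP[/eqP e1 /eqP e2].
by move=> [-> ->].
Qed.

(** After a prescribed initial word the sequence starts afresh. *)
Lemma bernoulli_restart w (B : set Y) : measurable B ->
  nu (iter (size w) shift @^-1` B `&` cyl bc w) = ((word_weight p w)%:E * nu B)%E.
Proof.
move=> mB; have w0 := word_weight_gt0 p_gt0 w.
have [m mE] := transfer_measure nu (measurable_cyl_base w)
  (@iter_base_shift_measurable (size w)).
have {}mE A : m A = nu (iter (size w) shift @^-1` A `&` cyl bc w) := mE A.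
rewrite -mE; pose m2 := mscale (NngNum (ltW w0)) nu.
suff -> : m B = m2 B by [].
apply: (cylindrical_unique (@renewal_base_cylindrical S hS)) => //.
  by rewrite mE preimage_setT setTI bernoulli_cyl ltry.
move=> s; rewrite mE setIC -cyl_cat bernoulli_cyl.
transitivity ((word_weight p w)%:E * nu (cyl bc s))%E; last by [].
by rewrite bernoulli_cyl -EFinM /word_weight big_cat.
Qed.

Lemma base_shift_iter_set_measurable n (B : set Y) :
  measurable B -> measurable (iter n shift @^-1` B).
Proof.
by move=> mB; rewrite -[X in measurable X]setTI; exact: iter_base_shift_measurable.
Qed.

Lemma ge0_integral_restart w (h : Y -> \bar R) :
  measurable_fun setT h -> (forall y, 0 <= h y)%E ->
  (\int[nu]_(y in cyl bc w) h (iter (size w) shift y) =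
   (word_weight p w)%:E * \int[nu]_y h y)%E.
Proof.
move=> mh h0; pose m2 := mscale (NngNum (ltW (word_weight_gt0 p_gt0 w))) nu.
rewrite -(ge0_integral_transfer (m' := m2))//.
- by rewrite ge0_integral_mscale.
- exact: measurable_cyl_base.
- exact: iter_base_shift_measurable.
- by move=> A mA; apply/esym; exact: bernoulli_restart.
Qed.

(** The cylinders of a given length form a countable partition, enumerated by the
    encoding of words as numbers. *)
Lemma ge0_integral_words L (f : Y -> \bar R) :
  measurable_fun setT f -> (forall y, 0 <= f y)%E ->
  (\int[nu]_y f y = \sum_(n <oo)
    if pickle_inv n is Some w then \int[nu]_(y in cyl bc (w : L.-tuple S)) f y else 0)%E.
Proof.
move=> mf f0.
pose F n : set Y := if pickle_inv n is Some w then cyl bc (w : L.-tuple S) else set0.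
have FT : \bigcup_n F n = setT.
  rewrite eqEsubset; split=> // y _.
  have wL : size (mkseq (bc y) L) == L by rewrite size_mkseq.
  by exists (pickle (Tuple wL)) => //; rewrite /F pickleK_inv /=; exact/cyl_mkseqP.
have FI n : (\int[nu]_(y in F n) f y)%E =
    (if pickle_inv n is Some w then \int[nu]_(y in cyl bc (w : L.-tuple S)) f y else 0)%E.
  by rewrite /F; case: (pickle_inv n) => //; rewrite integral_set0.
rewrite -FT ge0_integral_bigcup.
- by apply: eq_eseriesr => n _; exact: FI.
- by move=> n; rewrite /F; case: (pickle_inv n) => // w; exact: measurable_cyl_base.
- by rewrite FT.
- by [].
- apply/trivIsetP => i j _ _ ij; rewrite eqEsubset; split=> // y [].
  rewrite /F; case ei : (pickle_inv i) => [u|//]; case ej : (pickle_inv j) => [v|//].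
  rewrite /cyl /= !size_tuple => eu ev; apply/(negP ij).
  have := @pickle_invK (L.-tuple S) i; have := @pickle_invK (L.-tuple S) j.
  rewrite ei ej /= => <- <-; apply/eqP; congr pickle; apply: val_inj.
  by rewrite /= -eu -ev.
Qed.

(** On a cylinder of length [L] the function [g] is constant, and the rest of the
    sequence starts afresh. *)
Lemma ge0_integral_independent L (g h : Y -> \bar R) :
  determined_by L g -> (forall y, 0 <= g y)%E ->
  measurable_fun setT h -> (forall y, 0 <= h y)%E ->
  (\int[nu]_y (g y * h (iter L shift y)) = \int[nu]_y g y * \int[nu]_y h y)%E.
Proof.
move=> gL g0 mh h0; have mg := determined_fun_measurable gL.
have mhL : measurable_fun setT (fun y => h (iter L shift y)).
  by apply: measurableT_comp => //; exact: iter_base_shift_measurable.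
have cylg w (y z : Y) : size w = L -> cyl bc w y -> cyl bc w z -> g y = g z.
  move=> wL; rewrite /cyl /= wL => <- e; apply: gL.
  by move/mkseq_agree: e => e i iL; rewrite /base_coord in e; rewrite e.
have hint0 : (0 <= \int[nu]_y h y)%E by exact: integral_ge0.
rewrite -ge0_integralZr// (ge0_integral_words L)//; last 2 first.
- exact: emeasurable_funM.
- by move=> y; exact: mule_ge0.
rewrite [RHS](ge0_integral_words L)//; last 2 first.
- by apply: emeasurable_funM => //; exact: measurable_cst.
- by move=> y; exact: mule_ge0.
apply: eq_eseriesr => n _; case: (pickle_inv n) => // w.
have mw := measurable_cyl_base w.
have [->|/set0P[z zw]] := eqVneq (cyl bc w) set0; first by rewrite !integral_set0.
transitivity (\int[nu]_(y in cyl bc w) (g z * h (iter (size w) shift y)))%E.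
  apply: eq_integral => y; rewrite inE => yw; rewrite size_tuple.
  by rewrite (cylg w y z)// size_tuple.
rewrite ge0_integralZl//; last first.
  by rewrite size_tuple; exact: measurable_funTS.
rewrite ge0_integral_restart// -bernoulli_cyl muleCA muleC -integral_cst//.
rewrite [RHS](eq_integral (cst (g z * \int[nu]_y h y)%E))//.
by move=> y; rewrite inE => yw /=; rewrite (cylg w y z)// size_tuple.
Qed.

(** A function of the shifted sequence is independent of the first coordinate. *)
Lemma bernoulli_invariant : invariant_measure shift nu.
Proof.
move=> B mB; have mB1 : measurable (shift @^-1` B) by exact: (@base_shift_iter_set_measurable 1).
have := @ge0_integral_independent 1 (fun=> 1%E) (fun y => (\1_B y)%:E).
rewrite -[X in (X * _)%E](_ : nu setT = _); last first.
  by rewrite (integral_cst nu measurableT 1%E) mul1e.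
rewrite [nu setT]probability_setT mul1e integral_indic// setIT.
under [X in _ -> _ -> _ -> _ -> X = _]eq_integral do
  rewrite mul1e -[\1_B _]/(\1_(shift @^-1` B) _).
rewrite integral_indic// setIT => -> //.
exact/measurable_EFinP/measurable_indic.
Qed.

End BernoulliShift.

(** * Exponential moments of the return time *)

Section RealInequalities.
Variable R : realType.

Lemma expR_ge1 (x : R) : 0 <= x -> 1 <= expR x.
Proof. by rewrite -[X in _ -> X <= _]expR0 ler_expR. Qed.

(** A second-order Taylor bound on the whole line; for a variable of mean zero the
    linear term integrates to zero. *)
Lemma expR_le_quadratic (x : R) : expR x <= 1 + x + x ^+ 2 * expR `|x|.
Proof.
have h1 : expR x - 1 <= x * expR x.
  have := expR_ge1Dx (- x); rewrite -(ler_pM2r (expR_gt0 x)) -expRD addNr expR0.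
  by rewrite mulrBl mul1r; lra.
have h2 := expR_ge1Dx x; have e1 : 1 <= expR `|x| by rewrite expR_ge1.
have [x0|x0] := leP 0 x.
  rewrite (ger0_norm x0); have : x * (expR x - 1) <= x * (x * expR x) by exact: ler_wpM2l.
  by rewrite mulrA -expr2; lra.
have h3 : x * (expR x - 1) <= x * x by rewrite ler_nM2l//; lra.
have h4 : x ^+ 2 <= x ^+ 2 * expR `|x| by rewrite ler_peMr// sqr_ge0.
by rewrite -expr2 in h3; lra.
Qed.

Lemma sum_geometric_le (r : R) (a n : nat) : 0 <= r < 1 ->
  \sum_(i < n | (a <= i)%N) r ^+ i <= r ^+ a / (1 - r).
Proof.
move=> /andP[r0 r1]; have r1' : 0 < 1 - r by rewrite subr_gt0.
suff : (1 - r) * \sum_(i < n | (a <= i)%N) r ^+ i <= r ^+ a - (if (a <= n)%N then r ^+ n else r ^+ a).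
  rewrite ler_pdivlMr// mulrC => /le_trans; apply; rewrite gerBl.
  by case: ifP => _; exact: exprn_ge0.
elim: n => [|n IH].
  by rewrite big_ord0 mulr0; case: a => [|a] /=; rewrite subrr.
rewrite big_mkcond big_ord_recr -big_mkcond /=; move: IH.
have [an|an] := leqP a n.
  by rewrite leqW// mulrDr exprS; lra.
rewrite subrr addr0 => IH; apply: le_trans IH _; case: ifP => an1; last by rewrite subrr.
by have -> : a = n.+1; [lia|rewrite subrr].
Qed.

Lemma geometric_series_le (u : nat -> R) (C r : R) (a : nat) :
  0 <= C -> 0 <= r < 1 -> (forall n, 0 <= u n) ->
  (forall n, (n < a)%N -> u n = 0) -> (forall n, u n <= C * r ^+ n) ->
  (\sum_(n <oo) (u n)%:E <= (C * (r ^+ a / (1 - r)))%:E)%E.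
Proof.
move=> C0 r01 u0 ua uC; apply: lime_le.
  by apply: is_cvg_nneseries => n _ _; rewrite lee_fin.
apply: nearW => n; rewrite sumEFin lee_fin big_mkord.
apply: le_trans (ler_wpM2l C0 (sum_geometric_le a n r01)).
rewrite [leRHS]mulr_sumr [leRHS]big_mkcond; apply: ler_sum => i _.
by case: leqP => [_|/ua ->//]; exact: uC.
Qed.

(** Convexity of the exponential, in the form of a mean of [L] numbers. *)
Lemma expR_mean_le (L : nat) (x : nat -> R) : (0 < L)%N ->
  expR (\sum_(r < L) x r) <= L%:R^-1 * \sum_(r < L) expR (L%:R * x r).
Proof.
move=> L0; have L0' : 0 < L%:R :> R by rewrite ltr0n.
set m := \sum_(r < L) x r.
rewrite ler_pdivlMl// -[leLHS]/(L%:R * expR m).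
have -> : L%:R * expR m = \sum_(r < L) (expR m * (1 + (L%:R * x r - m))).
  rewrite -mulr_sumr big_split /= sumrB -mulr_sumr -/m !sumr_const !card_ord.
  by rewrite -[m *+ L]mulr_natl subrr addr0 mulrC.
apply: ler_sum => r _; rewrite -{2}[L%:R * x r](subrK m) addrC expRD mulrC.
by rewrite ler_pM2r ?expR_gt0// addrC expR_ge1Dx.
Qed.

Lemma sum_divmod (M L : nat) (a : nat -> R) : (0 < L)%N ->
  \sum_(i < M) a i =
  \sum_(r < L) \sum_(l < M) (if (l * L + r < M)%N then a (l * L + r)%N else 0).
Proof.
move=> L0; rewrite exchange_big /=.
transitivity (\sum_(0 <= i < M * L) (if (i < M)%N then a i else 0)).
  rewrite (big_cat_nat _ (n := M)) ?leq_pmulr//= [X in _ = _ + X]big1_seq.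
    by rewrite addr0 big_mkord; apply: eq_bigr => i _; rewrite ltn_ord.
  by move=> i; rewrite mem_index_iota => /and3P[_ Mi _]; rewrite ltnNge Mi.
rewrite big_nat_mul big_mkord; apply: eq_bigr => l _.
by rewrite mulSn addnC -{1}[(l * L)%N]add0n big_addn addKn big_mkord; apply: eq_bigr => r _; rewrite addnC.
Qed.

End RealInequalities.

Lemma probability_integral_cst d (T : measurableType d) (R : realType)
    (P : probability T R) (r : \bar R) : (\int[P]_x r = r)%E.
Proof.
transitivity (r * P setT)%E; first exact: integral_cst.
by rewrite probability_setT mule1.
Qed.

Section IntegralLinearity.
Context d (T : measurableType d) (R : realType) (m : {measure set T -> \bar R}).

Lemma integral_EFinD (f g : T -> R) :
  m.-integrable setT (EFin \o f) -> m.-integrable setT (EFin \o g) ->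
  (\int[m]_x (f x + g x)%:E = \int[m]_x (f x)%:E + \int[m]_x (g x)%:E)%E.
Proof. by move=> fi gi; rewrite -integralD_EFin. Qed.

Lemma integral_EFinZ (k : R) (f : T -> R) : m.-integrable setT (EFin \o f) ->
  (\int[m]_x (k * f x)%:E = k%:E * \int[m]_x (f x)%:E)%E.
Proof. by move=> fi; rewrite -integralZl. Qed.

Lemma integrable_EFinD (f g : T -> R) :
  m.-integrable setT (EFin \o f) -> m.-integrable setT (EFin \o g) ->
  m.-integrable setT (EFin \o (fun x => f x + g x)).
Proof. by move=> fi gi; exact: (integrableD measurableT fi gi). Qed.

Lemma integrable_EFinZ (k : R) (f : T -> R) : m.-integrable setT (EFin \o f) ->
  m.-integrable setT (EFin \o (fun x => k * f x)).
Proof. by move=> fi; exact: (integrableZl measurableT k fi). Qed.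

End IntegralLinearity.

Section Moments.
Context {R : realType} {S : set nat} {hS : S !=set0}.
Variables (p : S -> R).
Hypothesis p_gt0 : forall s, 0 < p s.
Variable nu : probability (renewal_base hS) R.
Hypothesis nuP : bernoulli_measure p nu.
Variables (C0 rho : R).
Hypothesis rho01 : 0 < rho < 1.
Hypothesis p_le : forall s : S, p s <= C0 * rho ^+ val s.

Local Notation Y := (renewal_base hS).
Local Notation shift := (@base_shift_map S hS).
Local Notation tau := (@return_time S hS).

Lemma decay_const_ge0 : 0 <= C0.
Proof.
have [n nS] := hS; pose s : S := exist (fun k => k \in S) n (mem_set nS).
have := lt_le_trans (p_gt0 s) (p_le s).
by case/andP: rho01 => r0 _; rewrite pmulr_lgt0 ?exprn_gt0// => /ltW.
Qed.

Lemma ext_weight_le n : ext_weight p n <= C0 * rho ^+ n.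
Proof.
rewrite /ext_weight; case: insubP => [s _ <-|_] /=; first exact: p_le.
by case/andP: rho01 => r0 _; rewrite mulr_ge0 ?decay_const_ge0// exprn_ge0// ltW.
Qed.

Lemma measurable_first (u : nat -> R) :
  measurable_fun setT (fun y : Y => (u (val (y 0%N)))%:E).
Proof. by apply: (determined_fun_measurable (L := 1)) => y z yz; rewrite yz. Qed.

Lemma ge0_integral_first (u : nat -> R) : (forall n, 0 <= u n) ->
  (\int[nu]_y (u (val (y 0%N)))%:E = \sum_(n <oo) (ext_weight p n * u n)%:E)%E.
Proof.
move=> u0; pose F n : set Y := [set y | val (y 0%N) = n].
have mF n : measurable (F n).
  by apply: (@determined_set_measurable _ _ 1) => y z yz; rewrite /F /= yz.
have FT : \bigcup_n F n = setT by rewrite eqEsubset; split=> // y _; exists (val (y 0%N)).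
have nuF n : (nu (F n) = (ext_weight p n)%:E)%E.
  rewrite /ext_weight; case: insubP => [s _ sn|nS] /=.
    have -> : F n = cyl (@base_coord S hS) [:: s].
      rewrite eqEsubset /F /cyl; split=> y /=.
        by rewrite -sn => /val_inj e; rewrite /mkseq /= /base_coord e.
      by rewrite /mkseq /= -sn => -[<-].
    by rewrite (bernoulli_cyl nuP) /word_weight big_seq1.
  have -> : F n = set0; last by rewrite measure0.
  by rewrite eqEsubset /F; split=> // y /= yn; move: nS; rewrite -yn; case: (y 0%N) => k /= ->.
rewrite -FT ge0_integral_bigcup//.
- apply: eq_eseriesr => n _; rewrite (eq_integral (cst (u n)%:E)).
    transitivity ((u n)%:E * nu (F n))%E; first exact: integral_cst.
    by rewrite nuF -EFinM mulrC.
  by move=> y; rewrite inE /F /= => ->.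
- by rewrite FT; exact: measurable_first.
- by move=> y _; rewrite lee_fin.
- apply/trivIsetP => i j _ _ /eqP ij; rewrite eqEsubset; split=> // y [ei ej].
  by apply: ij; transitivity (val (y 0%N)); [exact/esym|].
Qed.

(** Growth at half the decay rate of the weights remains summable. *)
Lemma return_time_exp_moment :
  exists s1 M : R, [/\ 0 < s1, 0 <= M &
    (\int[nu]_y (expR (s1 * (tau y)%:R))%:E <= M%:E)%E].
Proof.
have /andP[r0 r1] := rho01.
have lr : ln rho < 0 by rewrite ln_lt0// r0.
pose s1 := - ln rho / 2; pose r := expR (ln rho / 2).
have s10 : 0 < s1 by rewrite /s1; lra.
have r01 : 0 <= r < 1 by rewrite expR_ge0 /= expR_lt1; lra.
have e n : rho ^+ n * expR (s1 * n.+1%:R) = expR s1 * r ^+ n.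
  rewrite -natr1 mulrDr mulr1 expRD mulrA mulrC; congr (_ * _).
  rewrite [s1 * _]mulrC expRM_natl -exprMn; congr (_ ^+ _).
  by rewrite -{1}(lnK r0) -expRD /r /s1; congr expR; lra.
exists s1, (C0 * expR s1 * (r ^+ 0 / (1 - r))); split=> //.
  have /andP[rr0 rr1] := r01.
  by rewrite !mulr_ge0 ?decay_const_ge0 ?expR_ge0 ?exprn_ge0// invr_ge0 subr_ge0 ltW.
rewrite (ge0_integral_first (u := fun n => expR (s1 * n.+1%:R)))//.
apply: geometric_series_le => //.
- by rewrite mulr_ge0 ?decay_const_ge0 ?expR_ge0.
- by move=> n; rewrite mulr_ge0 ?expR_ge0// ext_weight_ge0.
- move=> n; rewrite -mulrA -e mulrA ler_pM2r ?expR_gt0//; exact: ext_weight_le.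
Qed.

Lemma return_time_tail (a : nat) :
  (nu [set y : Y | (a <= val (y 0%N))%N] <= (C0 * (rho ^+ a / (1 - rho)))%:E)%E.
Proof.
have /andP[r0 r1] := rho01.
set B := [set y | _]; have mB : measurable B.
  by apply: (@determined_set_measurable _ _ 1) => y z yz; rewrite /B /= yz.
have -> : nu B = (\int[nu]_y ((a <= val (y 0%N))%N%:R : R)%:E)%E.
  rewrite -[B]setIT -integral_indic//; apply: eq_integral => y _.
  by rewrite indicE; congr (_%:R%:E); rewrite mem_setE.
rewrite (ge0_integral_first (u := fun n => (a <= n)%N%:R))//.
apply: geometric_series_le; rewrite ?decay_const_ge0 ?ltW//.
- by move=> n; rewrite mulr_ge0// ext_weight_ge0.
- by move=> n na; rewrite leqNgt na mulr0.
- move=> n; apply: le_trans (ext_weight_le n).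
  by rewrite ler_piMr ?ext_weight_ge0// lern1 leq_b1.
Qed.

Lemma determined_by_shift U L n (g : Y -> U) :
  determined_by L g -> determined_by (n + L) (fun y => g (iter n shift y)).
Proof.
move=> gL y z yz; apply: gL => i iL; rewrite !iter_base_shift yz//.
by rewrite addnC ltn_add2l.
Qed.

Section Centered.
Variables (L : nat) (F : Y -> R).
Hypothesis L_gt0 : (0 < L)%N.
Hypothesis F_det : determined_by L F.
Hypothesis F_le : forall y, `|F y| <= (tau y)%:R.
Hypothesis F_mean : (\int[nu]_y (F y)%:E = 0)%E.

(** For a variable of mean zero the first-order term of the exponential moment
    vanishes; the second-order one is finite by [return_time_exp_moment]. *)
Lemma centered_exp_moment : exists C t1 : R, [/\ 0 <= C, 0 < t1 &
  forall s, `|s| <= t1 ->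
    (\int[nu]_y (expR (s * F y))%:E <= (expR (C * s ^+ 2))%:E)%E].
Proof.
have [s1 [M [s10 M0 EM]]] := return_time_exp_moment.
(* [K] makes [tau ^+ 2 * expR (s1 / 2 * tau) <= K * expR (s1 * tau)], the quadratic
   factor being absorbed by the other half of the exponential. *)
pose K := 8%:R / s1 ^+ 2; have K0 : 0 < K by rewrite divr_gt0// exprn_gt0.
pose E (y : Y) := expR (s1 * (tau y)%:R).
have tauE y : (tau y)%:R ^+ 2 * expR (s1 / 2 * (tau y)%:R) <= K * E y.
  set t := (tau y)%:R; have t0 : 0 <= t by exact: ler0n.
  have h0 : 0 <= s1 / 2 * t by rewrite mulr_ge0// divr_ge0// ltW.
  have := @expR_ge1Dxn R (s1 / 2 * t) 1 h0.
  have -> : (1.+1)`!%:R = 2 :> R by [].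
  move=> h; have {h} h : t ^+ 2 <= K * expR (s1 / 2 * t).
    rewrite /K mulrAC ler_pdivlMr ?exprn_gt0//.
    have : 0 < expR (s1 / 2 * t) by exact: expR_gt0.
    move: h; set e := expR _ => h e0; have : (s1 / 2 * t) ^+ 2 / 2 <= e by lra.
    by rewrite !exprMn; lra.
  have -> : E y = expR (s1 / 2 * t) * expR (s1 / 2 * t).
    by rewrite -expRD -mulrDl; congr expR; rewrite -/t; lra.
  by rewrite mulrA ler_pM2r// expR_gt0.
have mE : measurable_fun setT (fun y : Y => (E y)%:E).
  exact: (measurable_first (fun n => expR (s1 * n.+1%:R))).
have iE : nu.-integrable setT (EFin \o E).
  apply/integrableP; split=> //; apply: le_lt_trans (ltry M).
  by under eq_integral do rewrite /= ger0_norm ?expR_ge0//.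
have mF : measurable_fun setT (fun y : Y => (F y)%:E).
  by apply: (determined_fun_measurable (L := L)) => y z /F_det ->.
have iF : nu.-integrable setT (EFin \o F).
  apply: (le_integrable _ _ _ (integrableZl measurableT (1 + K) iE)) => //.
  move=> y _ /=; rewrite lee_fin; apply: le_trans (F_le y) _.
  rewrite ger0_norm ?mulr_ge0 ?expR_ge0//; last by lra.
  have e1 : 1 <= expR (s1 / 2 * (tau y)%:R).
    by apply: expR_ge1; rewrite mulr_ge0// divr_ge0// ltW.
  have := tauE y; have := ler0n R (tau y); have : 1 <= (tau y)%:R :> R by rewrite ler1n.
  move: e1 (expR_gt0 (s1 * (tau y)%:R)); rewrite -/(E y).
  set e := expR _; set t := (tau y)%:R => e1 E0 t1 t0 h.
  have : t * 1 <= t ^+ 2 * e by rewrite expr2 -mulrA ler_pM2l ?(lt_le_trans ltr01)//; nra.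
  by nra.
exists (K * M), (s1 / 2); split; [by rewrite mulr_ge0// ltW|by rewrite divr_gt0|].
move=> s ss1; pose g y := 1 + s * F y + s ^+ 2 * K * E y.
have mexp : measurable_fun setT (fun y : Y => (expR (s * F y))%:E).
  by apply: (determined_fun_measurable (L := L)) => y z /F_det ->.
have eg y : expR (s * F y) <= g y.
  apply: le_trans (expR_le_quadratic _) _; rewrite /g lerD2l exprMn.
  suff h : F y ^+ 2 * expR `|s * F y| <= K * E y.
    by have := ler_wpM2l (sqr_ge0 s) h; lra.
  apply: le_trans (tauE y); apply: ler_pM; rewrite ?sqr_ge0 ?expR_ge0//.
    by rewrite -real_normK ?num_real// ler_pXn2r ?nnegrE// ?F_le.
  by rewrite ler_expR normrM ler_pM.
have ic : nu.-integrable setT (EFin \o fun=> 1 : R) by exact: finite_measure_integrable_cst.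
have i1 : nu.-integrable setT (EFin \o (fun y => 1 + s * F y)).
  by apply: integrable_EFinD => //; exact: integrable_EFinZ.
have i2 : nu.-integrable setT (EFin \o (fun y => s ^+ 2 * K * E y)).
  exact: integrable_EFinZ.
have ig : (\int[nu]_y (g y)%:E <= (1 + s ^+ 2 * K * M)%:E)%E.
  rewrite integral_EFinD// integral_EFinD//; last exact: integrable_EFinZ.
  rewrite !integral_EFinZ// (probability_integral_cst nu 1%:E) F_mean mule0 adde0.
  rewrite EFinD; apply: leeD => //; rewrite [(_ * M)%:E]EFinM; apply: lee_wpmul2l => //.
  by rewrite lee_fin mulr_ge0 ?sqr_ge0// ltW.
have g0 y : 0 <= g y by apply: le_trans (eg y); exact: expR_ge0.
apply: (@le_trans _ _ (\int[nu]_y (g y)%:E)%E).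
  apply: ge0_le_integral => //.
  - by case/integrableP: (integrable_EFinD i1 i2).
  - by move=> y _; rewrite lee_fin.
apply: le_trans ig _; rewrite lee_fin; apply: le_trans (expR_ge1Dx _) _.
by rewrite ler_expR -mulrA mulrC.
Qed.

(** Successive blocks of [L] symbols are independent. *)
Lemma blocks_exp_moment (C t1 : R) (q : nat) (s : nat -> R) (b : R) : 0 <= C ->
  (forall s, `|s| <= t1 ->
    (\int[nu]_y (expR (s * F y))%:E <= (expR (C * s ^+ 2))%:E)%E) ->
  b <= t1 -> (forall l, `|s l| <= b) ->
  (\int[nu]_y (expR (\sum_(l < q) s l * F (iter (l * L) shift y)))%:E <=
    (expR (q%:R * (C * b ^+ 2)))%:E)%E.
Proof.
move=> C_ge0 hC bt1; elim: q s => [|q IH] s sb.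
  under eq_integral do rewrite big_ord0 expR0.
  by rewrite (probability_integral_cst nu 1%:E) mul0r expR0.
pose h (y : Y) := expR (\sum_(l < q) s l.+1 * F (iter (l * L) shift y)).
have mh : measurable_fun setT (fun y => (h y)%:E).
  apply: (determined_fun_measurable (L := q * L + L)) => y z yz.
  congr ((expR _)%:E); apply: eq_bigr => l _; congr (_ * _).
  apply: (determined_by_shift (n := l * L) F_det); apply: agree_le yz.
  by rewrite leq_add2r leq_mul2r (ltnW (ltn_ord l)) orbT.
have step y : expR (\sum_(l < q.+1) s l * F (iter (l * L) shift y)) =
    expR (s 0%N * F y) * h (iter L shift y).
  rewrite big_ord_recl expRD; congr (_ * expR _).
  by apply: eq_bigr => l _; rewrite lift0 mulSn addnC iterD.
under eq_integral do rewrite step EFinM.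
rewrite (ge0_integral_independent p_gt0 nuP (L := L) (g := fun y => (expR (s 0%N * F y))%:E) (h := fun y => (h y)%:E))//; last 2 first.
- by move=> y z /F_det ->.
- by move=> y; rewrite lee_fin expR_ge0.
rewrite -natr1 mulrDl mul1r addrC expRD EFinM; apply: lee_pmul.
- by apply: integral_ge0 => y _; rewrite lee_fin expR_ge0.
- by apply: integral_ge0 => y _; rewrite lee_fin expR_ge0.
- apply: le_trans (hC _ (le_trans (sb 0%N) bt1)) _.
  rewrite lee_fin ler_expR ler_wpM2l//.
  by rewrite -real_normK ?num_real// ler_pXn2r ?nnegrE// (le_trans _ (sb 0%N)).
- exact: (IH (fun l => s l.+1)).
Qed.

(** Splitting a Birkhoff sum according to the residue of the index mod [L], and
    averaging the residues by convexity of the exponential, reduces the dependent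
    summands to independent blocks. *)
Lemma birkhoff_exp_moment : exists C t0 : R, [/\ 0 <= C, 0 < t0 &
  forall t, `|t| <= t0 -> forall M,
    (\int[nu]_y (expR (t * \sum_(i < M) F (iter i shift y)))%:E <=
      (expR (M%:R * (C * t ^+ 2)))%:E)%E].
Proof.
have [C [t1 [C_ge0 t10 hC]]] := centered_exp_moment.
have L0 : 0 < L%:R :> R by rewrite ltr0n.
exists (C * L%:R ^+ 2), (t1 / L%:R); split; [by rewrite mulr_ge0// exprn_ge0|by rewrite divr_gt0|].
move=> t tt0 M; pose b := L%:R * `|t|.
have bt1 : b <= t1 by rewrite /b mulrC -ler_pdivlMr.
pose s r l : R := if (l * L + r < M)%N then L%:R * t else 0.
have sb r l : `|s r l| <= b.
  rewrite /s; case: ifP => _; last by rewrite normr0 mulr_ge0.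
  by rewrite normrM ger0_norm.
pose G r (y : Y) := expR (\sum_(l < M) s r l * F (iter (l * L) shift y)).
have detG r : determined_by (M * L + L) (G r).
  move=> y z yz; congr (expR _); apply: eq_bigr => l _; congr (_ * _).
  apply: (determined_by_shift (n := l * L) F_det); apply: agree_le yz.
  by rewrite leq_add2r leq_mul2r (ltnW (ltn_ord l)) orbT.
have mG r : measurable_fun setT (fun y : Y => (G r y)%:E).
  by apply: (determined_fun_measurable (L := M * L + L)) => y z /detG ->.
have mGr r : measurable_fun setT (fun y : Y => (G r (iter r shift y))%:E).
  by apply: measurableT_comp (mG r) _; exact: iter_base_shift_measurable.
have G0 r y : (0 <= (G r y)%:E)%E by rewrite lee_fin expR_ge0.
have IG r : (\int[nu]_y (G r (iter r shift y))%:E <= (expR (M%:R * (C * b ^+ 2)))%:E)%E.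
  have := ge0_integral_independent p_gt0 nuP (L := r) (g := fun=> 1%E) (h := fun y => (G r y)%:E).
  under eq_integral do rewrite mul1e.
  rewrite (probability_integral_cst nu 1%E) !mul1e => -> //.
  exact: (blocks_exp_moment M C_ge0 hC bt1 (sb r)).
have le1 y : expR (t * \sum_(i < M) F (iter i shift y)) <=
    L%:R^-1 * \sum_(r < L) G r (iter r shift y).
  rewrite (sum_divmod _ (fun i => F (iter i shift y)) L_gt0) mulr_sumr.
  apply: le_trans (expR_mean_le (fun r => t * \sum_(l < M)
    (if (l * L + r < M)%N then F (iter (l * L + r) shift y) else 0)) L_gt0) _; apply: ler_wpM2l; first by rewrite invr_ge0 ltW.
  apply: ler_sum => r _; rewrite /G ler_expR mulrA mulr_sumr; apply: ler_sum => l _.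
  rewrite /s; case: ifP => _; last by rewrite mul0r mulr0.
  by rewrite -iterD.
apply: (@le_trans _ _ (\int[nu]_y (L%:R^-1%:E * \sum_(r < L) (G r (iter r shift y))%:E))%E).
  apply: ge0_le_integral => //.
  - apply: (determined_fun_measurable (L := M + L)) => y z yz.
    congr ((expR (_ * _))%:E); apply: eq_bigr => i _.
    apply: (determined_by_shift (n := i) F_det); apply: agree_le yz.
    by rewrite leq_add2r ltnW.
  - by apply: emeasurable_funM => //; apply: emeasurable_sum.
  - by move=> y _; rewrite sumEFin -EFinM lee_fin.
rewrite ge0_integralZl//; last 2 first.
- by apply: emeasurable_sum.
- by move=> y _; exact: sume_ge0.
rewrite ge0_integral_sum//.
have -> : C * L%:R ^+ 2 * t ^+ 2 = C * b ^+ 2.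
  by rewrite /b exprMn real_normK ?num_real//; ring.
apply: (@le_trans _ _ (L%:R^-1%:E * \sum_(r < L) (expR (M%:R * (C * b ^+ 2)))%:E)%E).
  by apply: lee_wpmul2l; [rewrite lee_fin invr_ge0 ltW|exact: lee_sum].
by rewrite sumEFin -EFinM lee_fin sumr_const card_ord -[X in _ * X]mulr_natl mulKf// gt_eqF.
Qed.

End Centered.
End Moments.

(** * Coding by return times *)

Section Coding.
Variables (S : set nat) (hS : S !=set0).
Local Notation X := (gap_shift S).
Local Notation Y := (renewal_base hS).
Local Notation sigma := (@gap_shift_map S).
Local Notation shift := (@base_shift_map S hS).
Local Notation gc := (@gap_coord S).
Local Notation code := (@renewal_code S hS).
Local Notation pos := (@one_position S hS).

Lemma gap_coord_iter n (x : X) k : gc (iter n sigma x) k = gc x (k + n)%N.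
Proof. by elim: n k => [|n IH] k; rewrite ?addn0//= -addSnnS -IH. Qed.

Lemma gap_coord_inj (x z : X) : gc x =1 gc z -> x = z.
Proof. by move=> xz; apply: val_inj; apply/funext. Qed.

Lemma iter_sigma_zero n : iter n sigma (zero_seq S) = zero_seq S.
Proof. by apply: gap_coord_inj => k; rewrite gap_coord_iter. Qed.

Lemma agree_iter_sigma N n (x z : X) : agree (n + N) (gc x) (gc z) ->
  agree N (gc (iter n sigma x)) (gc (iter n sigma z)).
Proof. by move=> xz i iN; rewrite !gap_coord_iter xz// addnC ltn_add2l. Qed.

Lemma renewal_seqP (y : Y) k : reflect (exists m, k = pos y m) (gc (code y) k).
Proof. exact: asboolP. Qed.

Lemma one_position0 (y : Y) : pos y 0 = 0%N.
Proof. by rewrite /one_position big_ord0. Qed.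

Lemma one_position_shift (y : Y) m : pos y m.+1 = (return_time y + pos (shift y) m)%N.
Proof. by rewrite /one_position big_ord_recl. Qed.

Lemma one_position_mono (y : Y) : {mono pos y : m n / (m <= n)%N}.
Proof. by apply: leq_mono => ? ?; exact: one_position_homo. Qed.

Lemma leq_one_position (y : Y) m : (m <= pos y m)%N.
Proof.
by elim: m => // m IH; apply: leq_ltn_trans IH _; exact: one_position_homo.
Qed.

Lemma one_position_agree M (y z : Y) : agree M y z ->
  forall m, (m <= M)%N -> pos y m = pos z m.
Proof.
move=> yz m mM; rewrite /one_position; apply: eq_bigr => i _.
by rewrite yz// (leq_trans (ltn_ord i)).
Qed.

Lemma code_agree M (y z : Y) : agree M y z -> agree (pos y M).+1 (gc (code y)) (gc (code z)).
Proof.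
move=> yz k kM; apply/renewal_seqP/renewal_seqP => -[m km]; exists m.
  by rewrite km (one_position_agree yz)// -(one_position_mono y) -km.
have mM : (m <= M)%N.
  by rewrite -(one_position_mono z) -km -(one_position_agree yz (leqnn M)).
by rewrite km (one_position_agree yz).
Qed.

Lemma code_one (y : Y) m : gc (code y) (pos y m).
Proof. by apply/renewal_seqP; exists m. Qed.

Lemma code_gap (y : Y) m k : (pos y m < k < pos y m.+1)%N -> gc (code y) k = false.
Proof.
move=> /andP[mk km]; apply/renewal_seqP => -[n kn]; move: mk km; rewrite kn.
by rewrite !ltnNge !one_position_mono -!ltnNge ltnS => mn nm; rewrite ltnNge nm in mn.
Qed.

Lemma sigma_code (y : Y) : iter (return_time y) sigma (code y) = code (shift y).
Proof.
apply: gap_coord_inj => k; rewrite gap_coord_iter.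
apply/renewal_seqP/renewal_seqP => -[m km].
  case: m km => [|m]; first by rewrite one_position0 /return_time addnS.
  by rewrite one_position_shift addnC => /addnI; exists m.
by exists m.+1; rewrite one_position_shift km addnC.
Qed.

Lemma one_position_add (y : Y) m n : pos y (m + n) = (pos y m + pos (iter m shift y) n)%N.
Proof.
elim: n => [|n IH]; first by rewrite addn0 one_position0 addn0.
by rewrite addnS !one_positionS IH iter_base_shift [(n + m)%N]addnC -addnA -addnS.
Qed.

Lemma sigma_code_iter (y : Y) m : iter (pos y m) sigma (code y) = code (iter m shift y).
Proof.
elim: m => [|m IH]; first by rewrite one_position0.
by rewrite -addn1 one_position_add addn1 addnC iterD IH -sigma_code /one_position big_ord1.
Qed.

(** The sequence with [a] zeros, then the first [M] blocks of the code of [y] and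
    one more symbol 1, then zeros only.  Every initial segment of a point of the
    gap shift has this form, see [gap_shift_decomposition]. *)
Definition block_seq (a M : nat) (y : Y) (j : nat) : bool :=
  (a <= j <= a + pos y M)%N && gc (code y) (j - a).

Lemma block_seq_agree a M (y z : Y) : agree M y z -> block_seq a M y =1 block_seq a M z.
Proof.
move=> yz j; rewrite /block_seq -(one_position_agree yz)//.
case: (boolP (a <= j <= _)%N) => //= /andP[aj jM].
by apply: (code_agree yz); rewrite ltnS leq_subLR.
Qed.

(** Symbol by symbol: a new symbol 1 either ends the initial run of zeros, or closes
    a block whose length is allowed by the definition of the gap shift. In the first
    alternative of the conclusion no symbol 1 has been seen. *)
Lemma gap_shift_decomposition (x : X) (N : nat) : exists a M (y : Y),
  ((M = 0%N /\ a = N) \/ (a + pos y M < N)%N) /\ agree N (gc x) (block_seq a M y).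
Proof.
elim: N => [|N [a [M [y [h xz]]]]].
  by exists 0%N, 0%N, point; split; [left|].
have ext b m (u : Y) : agree N (gc x) (block_seq b m u) ->
    gc x N = block_seq b m u N -> agree N.+1 (gc x) (block_seq b m u).
  by move=> e eN j; rewrite ltnS leq_eqVlt => /orP[/eqP ->//|]; exact: e.
have [xN|xN] := boolP (gc x N); last first.
  case: h => [[M0 aN]|LN].
    exists N.+1, 0%N, y; split; [by left|].
    have zz j : (j < N.+1)%N -> block_seq N.+1 0 y j = false.
      by move=> jN; rewrite /block_seq leqNgt jN.
    apply: ext; last by rewrite (negbTE xN) zz.
    move=> j jN; rewrite (xz j jN) (zz j (ltnW jN)) /block_seq aN.
    by rewrite [(N <= j)%N]leqNgt jN.
  exists a, M, y; split; first by right; exact: leqW.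
  by apply: ext => //; rewrite (negbTE xN) /block_seq [(N <= _)%N]leqNgt LN andbF.
case: h => [[M0 aN]|LN].
  exists a, M, y; split; first by right; rewrite M0 one_position0 addn0 aN.
  by apply: ext => //; rewrite xN /block_seq aN M0 one_position0 addn0 leqnn subnn -(one_position0 y) code_one.
set L := (a + pos y M)%N in LN.
have xL : gc x L.
  by rewrite xz// /block_seq leq_addr leqnn /= /L addKn code_one.
pose g := (N - L.+1)%N; have LgN : (L + g).+1 = N by rewrite /g; lia.
have gS : S g.
  have := valP x; rewrite inE => /(_ L g xL); rewrite LgN; apply => // j /andP[Lj jN].
  have := xz j jN; rewrite /gap_coord => ->.
  by rewrite /block_seq -/L [(j <= L)%N]leqNgt Lj andbF.
pose u : Y := fun i => if i == M then exist (fun n => n \in S) g (mem_set gS) else y i.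
have yu : agree M y u by move=> i iM; rewrite /u ltn_eqF.
have posM : pos u M = pos y M by rewrite (one_position_agree yu).
have posS : (a + pos u M.+1)%N = N.
  by rewrite one_positionS posM /u eqxx /= addnS addnA -/L LgN.
exists a, M.+1, u; split; first by right; rewrite posS.
apply: ext; last first.
  rewrite xN /block_seq posS leqnn andbT; have aN : (a <= N)%N by rewrite -posS leq_addr.
  by rewrite aN /= -[X in (X - a)%N]posS addKn code_one.
move=> j jN; rewrite xz// (block_seq_agree a yu) /block_seq posS (ltnW jN) andbT.
case: (leqP a j) => //= aj; case: (leqP j (a + pos u M)) => [//|jL] /=.
apply/esym; apply: (@code_gap _ M); rewrite -(ltn_add2l a) subnKC//.
by rewrite jL /= -(ltn_add2l a) subnKC// posS.
Qed.

Lemma block_length_le a M (y : Y) N :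
  (M = 0%N /\ a = N) \/ (a + pos y M < N)%N -> (a + pos y M <= N)%N.
Proof. by case=> [[-> ->]|/ltnW//]; rewrite one_position0 addn0. Qed.

(** The positions of the symbols 1 determine the block lengths. *)
Lemma code_agree_inv M (y z : Y) :
  agree (pos y M).+1 (gc (code y)) (gc (code z)) -> agree M y z.
Proof.
elim: M => [|M IH] yz i //.
have posM : (pos y M < pos y M.+1)%N by exact: one_position_homo.
have yzM : agree M y z by apply: IH; apply: agree_le yz; exact: ltnW.
rewrite ltnS leq_eqVlt => /orP[/eqP ->{i}|]; last exact: yzM.
have eM : pos y M = pos z M by rewrite (one_position_agree yzM).
apply: val_inj; case: (ltngtP (val (y M)) (val (z M))) => // lt.
  have := yz (pos y M.+1) (leqnn _); rewrite code_one.
  by rewrite (@code_gap z M)// -eM posM !one_positionS -eM ltnS ltn_add2l.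
have lt' : (pos z M.+1 < pos y M.+1)%N by rewrite !one_positionS -eM ltnS ltn_add2l.
have := yz (pos z M.+1) (ltnW lt'); rewrite code_one (@code_gap y M)// lt' andbT.
by rewrite eM; exact: one_position_homo.
Qed.

(** Shifting the code strictly inside its first block leaves a run of zeros followed
    by the code of the shifted sequence. *)
Lemma code_shifted (y : Y) j k : (j < return_time y)%N ->
  gc (iter j.+1 sigma (code y)) k =
  (return_time y - j.+1 <= k)%N && gc (code (shift y)) (k - (return_time y - j.+1)).
Proof.
move=> jt; rewrite gap_coord_iter; set r := (return_time y - j.+1)%N.
have e : return_time y = (r + j.+1)%N by rewrite /r subnK.
case: (leqP r k) => rk /=.
  rewrite -sigma_code gap_coord_iter; congr (gc (code y) _); rewrite e; lia.
have p1 : pos y 1 = return_time y by rewrite one_position_shift one_position0 addn0.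
by apply: (@code_gap y 0); rewrite one_position0 p1 e ltn_add2r rk addnS.
Qed.

End Coding.

Section BirkhoffSums.
Context {R : realType} {T : Type}.
Variables (f : T -> T) (phi : T -> R).

Lemma birkhoff_sumD n m x :
  birkhoff_sum f phi (n + m) x = birkhoff_sum f phi n x + birkhoff_sum f phi m (iter n f x).
Proof.
rewrite /birkhoff_sum big_split_ord /=; congr (_ + _).
by apply: eq_bigr => i _; rewrite addnC iterD.
Qed.

Lemma birkhoff_sum_le n x (B : R) : (forall x, `|phi x| <= B) ->
  `|birkhoff_sum f phi n x| <= n%:R * B.
Proof.
move=> phiB; apply: le_trans (ler_norm_sum _ _ _) _.
by apply: le_trans (ler_sum _ (fun i _ => phiB _)) _; rewrite sumr_const card_ord mulr_natl.
Qed.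

End BirkhoffSums.

(** At the end of a block the orbit is the code of the shifted sequence. *)
Lemma birkhoff_code_blocks (R : realType) (S : set nat) (hS : S !=set0)
    (phi : gap_shift S -> R) M (y : renewal_base hS) :
  birkhoff_sum (@gap_shift_map S) phi (one_position y M) (renewal_code y) =
  \sum_(i < M) birkhoff_sum (@gap_shift_map S) phi
    (return_time (iter i (@base_shift_map S hS) y))
    (renewal_code (iter i (@base_shift_map S hS) y)).
Proof.
elim: M => [|M IH]; first by rewrite one_position0 /birkhoff_sum !big_ord0.
rewrite -addn1 one_position_add birkhoff_sumD IH addn1 big_ord_recr /=; congr (_ + _).
by rewrite sigma_code_iter /one_position big_ord1.
Qed.

(** * Bounded distortion *)

Section Distortion.
Context {R : realType} {S : set nat} {hS : S !=set0}.
Variables (theta : R) (phi : gap_shift S -> R).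
Hypothesis theta01 : 0 < theta < 1.
Local Notation X := (gap_shift S).
Local Notation Y := (renewal_base hS).
Local Notation sigma := (@gap_shift_map S).
Local Notation shift := (@base_shift_map S hS).
Local Notation gc := (@gap_coord S).
Local Notation code := (@renewal_code S hS).
Local Notation pos := (@one_position S hS).
Local Notation Sn := (birkhoff_sum sigma phi).

Lemma dtheta_agree_le N (x z : X) : agree N (gc x) (gc z) -> dtheta theta S x z <= theta ^+ N.
Proof.
have /andP[t0 t1] := theta01.
move=> xz; rewrite /dtheta; case: pselect => [e|_]; last by rewrite exprn_ge0// ltW.
case: ex_minnP => m xzm _; apply: ler_wiXn2l; rewrite ?ltW//.
by rewrite leqNgt; apply/negP => /xz e'; move/eqP: xzm; apply; exact: e'.
Qed.

Lemma dtheta_gt0 (x z : X) : x <> z -> 0 < dtheta theta S x z.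
Proof.
have /andP[t0 t1] := theta01.
move=> xz; rewrite /dtheta; case: pselect => [e|ne]; first by rewrite exprn_gt0.
exfalso; apply: xz; apply: gap_coord_inj => k; apply: contrapT => xzk.
by apply: ne; exists k; apply/eqP.
Qed.

(** The gap shift has two distinct points, the zero sequence and a coded one, which
    makes the Hoelder seminorm nonnegative. *)
Lemma holder_space_bounds : S !=set0 -> holder_space (dtheta theta S) phi ->
  exists B H : R, [/\ 0 <= B, 0 <= H, forall x, `|phi x| <= B &
    forall N x z, agree N (gc x) (gc z) -> `|phi x - phi z| <= H * theta ^+ N].
Proof.
move=> S0; rewrite /holder_space /= => fin.
have sup_ge x : ((`|phi x|)%:E <= sup_norm phi)%E by apply: ereal_sup_ubound; exists x.
have hol_ge x z : x <> z ->
    ((`|phi x - phi z| / dtheta theta S x z)%:E <= holder_seminorm (dtheta theta S) phi)%E.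
  by move=> xz; apply: ereal_sup_ubound; exists (x, z).
have [x [z xz]] : exists x z : X, x <> z.
  exists (@renewal_code S S0 point), (zero_seq S) => e.
  have := code_one (point : renewal_base S0) 0; rewrite one_position0.
  by rewrite e.
move: fin sup_ge hol_ge; case: (sup_norm phi) => [B| |]; last 2 first.
- move=> + _ /(_ x z xz); case: (holder_seminorm _ _) => //.
- by move=> _ /(_ (zero_seq S)).
case: (holder_seminorm _ _) => [H| |] //; last by move=> _ _ /(_ x z xz).
move=> _ sup_ge hol_ge; exists B, H; split.
- by have := sup_ge x; rewrite lee_fin; exact: le_trans.
- have := hol_ge x z xz; rewrite lee_fin; apply: le_trans.
  by rewrite divr_ge0// ltW// dtheta_gt0.
- by move=> u; have := sup_ge u; rewrite lee_fin.
move=> N u v uv; have [->|uv'] := pselect (u = v).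
  rewrite subrr normr0 mulr_ge0//; last by rewrite exprn_ge0// ltW//; case/andP: theta01.
  have := hol_ge x z xz; rewrite lee_fin; apply: le_trans.
  by rewrite divr_ge0// ltW// dtheta_gt0.
have := hol_ge u v uv'; rewrite lee_fin ler_pdivrMr ?dtheta_gt0// => /le_trans; apply.
apply: ler_wpM2l; last exact: dtheta_agree_le.
have := hol_ge x z xz; rewrite lee_fin; apply: le_trans.
by rewrite divr_ge0// ltW// dtheta_gt0.
Qed.

Variables (B H : R).
Hypothesis B_ge0 : 0 <= B.
Hypothesis H_ge0 : 0 <= H.
Hypothesis phi_bounded : forall x, `|phi x| <= B.
Hypothesis phi_holder :
  forall N x z, agree N (gc x) (gc z) -> `|phi x - phi z| <= H * theta ^+ N.

(** A Hoelder function is continuous: its superlevel sets are locally determined. *)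
Lemma phi_measurable : measurable_fun setT phi.
Proof.
have /andP[t0 t1] := theta01.
apply: (locally_determined_fun (@gap_shift_cylindrical S) (RGenOInfty.measurableE R)).
move=> _ [c ->] x /=; rewrite in_itv /= andbT => cx.
have : (H * theta ^+ n) @[n --> \oo] --> (0 : R).
  rewrite -[X in _ --> X](mulr0 H); apply: cvgMr; apply: cvg_expr.
  by rewrite ger0_norm// ltW.
move=> /cvgr_lt/(_ (phi x - c)); rewrite subr_gt0 => /(_ cx)[N _ /(_ N (leqnn _)) hN].
exists N => z xz; rewrite in_itv /= andbT.
by have := le_lt_trans (phi_holder xz) hN; rewrite ltr_norml; lra.
Qed.

Definition distortion : R := H / (1 - theta).

Lemma distortion_ge0 : 0 <= distortion.
Proof. by case/andP: theta01 => _ t1; rewrite divr_ge0// subr_ge0 ltW. Qed.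

(** Orbits that agree up to time [N] stay exponentially close, the closer the
    further they are from time [N], so that their Birkhoff sums differ by a
    geometric series. *)
Lemma birkhoff_distortion n N (x z : X) : (n <= N)%N -> agree N (gc x) (gc z) ->
  `|Sn n x - Sn n z| <= distortion.
Proof.
have /andP[t0 t1] := theta01.
move=> nN xz; rewrite /birkhoff_sum -sumrB; apply: le_trans (ler_norm_sum _ _ _) _.
apply: (@le_trans _ _ (\sum_(j < n) H * theta ^+ (N - j))).
  apply: ler_sum => j _; apply: phi_holder; apply: agree_iter_sigma.
  by rewrite subnKC// (leq_trans (ltnW (ltn_ord j))).
rewrite -mulr_sumr; apply: ler_wpM2l => //.
rewrite (reindex_inj rev_ord_inj) /=.
apply: (@le_trans _ _ (\sum_(j < n | (0 <= j)%N) theta ^+ j)).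
  apply: ler_sum => j _; apply: ler_wiXn2l; rewrite ?ltW//.
  by have := ltn_ord j; lia.
have := @sum_geometric_le R theta 0 n; rewrite expr0 mul1r; apply.
by rewrite ltW.
Qed.

Local Notation phi0 := (phi (zero_seq S)).

Lemma birkhoff_zero_run n (x : X) : agree n (gc x) (gc (zero_seq S)) ->
  `|Sn n x - n%:R * phi0| <= distortion.
Proof.
move=> xz; have -> : n%:R * phi0 = Sn n (zero_seq S).
  rewrite /birkhoff_sum (eq_bigr (fun=> phi0)).
    by rewrite sumr_const card_ord mulr_natl.
  by move=> i _; rewrite iter_sigma_zero.
exact: (birkhoff_distortion (leqnn n) xz).
Qed.

Variables (psi : S -> R) (P : R).
Hypothesis phi_renewal : renewal_type hS phi psi.

Definition log_weight (s : S) : R := psi s - P * (val s).+1%:R.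

Lemma birkhoff_code M (y : Y) : Sn (pos y M) (code y) = \sum_(i < M) psi (y i).
Proof.
rewrite birkhoff_code_blocks; apply: eq_bigr => i _.
have -> : y i = iter i shift y 0%N by rewrite iter_base_shift.
exact: phi_renewal.
Qed.

Lemma sum_log_weight M (y : Y) :
  \sum_(i < M) log_weight (y i) = \sum_(i < M) psi (y i) - P * (pos y M)%:R.
Proof.
rewrite /log_weight sumrB; congr (_ - _).
by rewrite -mulr_sumr /one_position natr_sum.
Qed.

(** Within a block the orbit follows the fixed point, except for its first symbol;
    hence the weights decay at the rate [phi0 - P]. *)
Lemma log_weight_le (s : S) :
  log_weight s <= (B + distortion - P) + (val s)%:R * (phi0 - P).
Proof.
pose y : Y := fun=> s.
have := birkhoff_code 1 y; rewrite big_ord1.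
have -> : pos y 1 = (1 + val s)%N by rewrite /one_position big_ord1.
rewrite birkhoff_sumD {1}/birkhoff_sum big_ord1 /= => e.
have := birkhoff_zero_run (n := val s) (x := sigma (code y)).
have az : agree (val s) (gc (sigma (code y))) (gc (zero_seq S)).
  move=> k ks; rewrite (gap_coord_iter 1) /=.
  rewrite (@code_gap _ _ _ 0)// one_position0 addn1 /=.
  by rewrite one_positionS one_position0 add0n ltnS.
move=> /(_ az); have := phi_bounded (code y).
rewrite /log_weight -e -natr1 !ler_norml; lra.
Qed.

Definition gibbs_const : R := 3 * distortion + 2 * B.

(** A Birkhoff sum is, up to a bounded error, the sum of the induced potential
    over the completed blocks plus the contribution of the two incomplete blocks,
    in which the orbit stays close to the fixed point. *)
Lemma birkhoff_decomposition (x : X) N a M (y : Y) :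
  (a + pos y M <= N)%N -> agree N (gc x) (block_seq a M y) ->
  `|Sn N x - N%:R * P
    - (\sum_(i < M) log_weight (y i) + (N - pos y M)%:R * (phi0 - P))| <= gibbs_const.
Proof.
move=> LN xz; set q := pos y M in LN *; set b := (N - (a + q))%N.
have Nab : N = (a + (q + b))%N by rewrite /b; lia.
have -> : (N - q)%N = (a + b)%N by lia.
rewrite {1}Nab !birkhoff_sumD sum_log_weight -/q -birkhoff_code -/q.
have h1 : `|Sn a x - a%:R * phi0| <= distortion.
  apply: birkhoff_zero_run => j ja; rewrite xz; last by lia.
  by rewrite /block_seq leqNgt ja.
have h2 : `|Sn q (iter a sigma x) - Sn q (code y)| <= distortion.
  apply: (@birkhoff_distortion q q) => // j jq; rewrite gap_coord_iter xz; last by lia.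
  by rewrite /block_seq leq_addl /= addnK addnC leq_add2l (ltnW jq).
have h3 : `|Sn b (iter q sigma (iter a sigma x)) - b%:R * phi0| <= distortion + 2 * B.
  have b2 : 0 <= 2 * B by rewrite mulr_ge0.
  have zr := distortion_ge0.
  rewrite -iterD; case: b Nab => [|b'] Nab.
    by rewrite /birkhoff_sum big_ord0 mul0r subrr normr0 addr_ge0.
  rewrite -[b'.+1]add1n birkhoff_sumD {1}/birkhoff_sum big_ord1 /=.
  have := birkhoff_zero_run (n := b') (x := sigma (iter (q + a) sigma x)).
  have az : agree b' (gc (sigma (iter (q + a) sigma x))) (gc (zero_seq S)).
    move=> j jb; rewrite (gap_coord_iter 1) gap_coord_iter xz; last by lia.
    rewrite /block_seq -/q; have -> : (j + 1 + (q + a) <= a + q)%N = false by lia.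
    by rewrite andbF.
  move=> /(_ az); have := phi_bounded (iter (q + a) sigma x).
  have := phi_bounded (zero_seq S); rewrite add1n -natr1 !ler_norml; lra.
have e : N%:R = a%:R + q%:R + b%:R :> R by rewrite Nab !natrD addrA.
rewrite e natrD /gibbs_const; move: h1 h2 h3; rewrite !ler_norml; lra.
Qed.

End Distortion.

(** * Counting words with exponential weights *)

Section Words.
Variable R : realType.

Definition word (N : nat) (s : nat -> bool) : {ffun 'I_N -> bool} := [ffun i => s (val i)].

Definition word_ext (N : nat) (w : {ffun 'I_N -> bool}) (j : nat) : bool :=
  oapp w false (insub j).

Definition sft (j : nat) (s : nat -> bool) : nat -> bool := fun k => s (k + j)%N.

Definition fsum (f : (nat -> bool) -> R) (n : nat) (s : nat -> bool) : R :=
  \sum_(j < n) f (sft j s).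

Lemma word_extK N s : agree N (word_ext (word N s)) s.
Proof. by move=> i iN; rewrite /word_ext insubT /= ffunE. Qed.

Lemma word_eqP N s s' : word N s = word N s' <-> agree N s s'.
Proof.
split=> [e i iN|e]; last by apply/ffunP => i; rewrite !ffunE; exact: (e i (ltn_ord i)).
by have /ffunP/(_ (Ordinal iN)) := e; rewrite !ffunE.
Qed.

Lemma sum_close (n K : nat) (u v : nat -> R) :
  (forall j, `|u j| <= 1) -> (forall j, `|v j| <= 1) ->
  (forall j, (j + K <= n)%N -> u j = v j) ->
  `|\sum_(j < n) u j - \sum_(j < n) v j| <= 2 * K%:R.
Proof.
move=> u1 v1 uv; rewrite -sumrB; apply: le_trans (ler_norm_sum _ _ _) _.
have [nK|Kn] := leqP n K.
  apply: (@le_trans _ _ (\sum_(j < n) 2)).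
    apply: ler_sum => j _; have := u1 j; have := v1 j; rewrite !ler_norml; lra.
  by rewrite sumr_const card_ord -[X in X <= _]mulr_natr ler_wpM2l// ler_nat.
have -> : n = (n - K + K)%N by lia.
rewrite big_split_ord /= big1 ?add0r => [|j _]; last first.
  by rewrite uv ?subrr ?normr0//; have := ltn_ord j; lia.
apply: (@le_trans _ _ (\sum_(j < K) 2)).
  by apply: ler_sum => j _; have := u1 (n - K + j)%N; have := v1 (n - K + j)%N; rewrite !ler_norml; lra.
by rewrite sumr_const card_ord -[X in X <= _]mulr_natr.
Qed.

Variables (f : (nat -> bool) -> R) (K : nat).
Hypothesis f_le1 : forall s, `|f s| <= 1.
Hypothesis f_det : forall s s', agree K s s' -> f s = f s'.

Lemma fsumD n m s : fsum f (n + m) s = fsum f n s + fsum f m (sft n s).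
Proof.
rewrite /fsum big_split_ord /=; congr (_ + _); apply: eq_bigr => j _.
by apply: f_det => k _; rewrite /sft -addnA [(j + n)%N]addnC.
Qed.

Lemma fsum_le n s : `|fsum f n s| <= n%:R.
Proof.
apply: le_trans (ler_norm_sum _ _ _) _.
by apply: le_trans (ler_sum _ (fun i _ => f_le1 _)) _; rewrite sumr_const card_ord.
Qed.

(** Only the last [K] summands see coordinates beyond [n]. *)
Lemma fsum_close n s s' : agree n s s' -> `|fsum f n s - fsum f n s'| <= 2 * K%:R.
Proof.
move=> ss; apply: (@sum_close _ _ (fun j => f (sft j s)) (fun j => f (sft j s'))) => //.
move=> j jn; apply: f_det => k kK; rewrite /sft ss//.
by apply: leq_trans jn; rewrite addnC ltn_add2l.
Qed.

End Words.

(** The partition function of the potential [phi - P], perturbed by [t] times [f], grows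
    at most like [expR (N%:R * (C * t ^+ 2))]. It is expressed by a weight on words
    rather than by a sum over points so that it can serve both as a bound for
    separated sums and as the reference weight in Gibbs' inequality. *)
Definition word_weight_bound (R : realType) (S : set nat) (phi : gap_shift S -> R)
    (P : R) (f : (nat -> bool) -> R) (C t : R) : Prop :=
  forall N, exists V : {ffun 'I_N -> bool} -> R,
  [/\ forall w, 0 <= V w,
      \sum_w V w <= (N.+1)%:R ^+ 2 * expR (C + N%:R * (C * t ^+ 2)) &
      forall x : gap_shift S,
        expR (birkhoff_sum (@gap_shift_map S) phi N x - N%:R * P + t * fsum f N (gap_coord x)) <=
        expR C * V (word N (gap_coord x))].

Section WeightedWords.
Context {R : realType} {S : set nat} {hS : S !=set0}.
Local Notation X := (gap_shift S).
Local Notation Y := (renewal_base hS).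
Local Notation sigma := (@gap_shift_map S).
Local Notation shift := (@base_shift_map S hS).
Local Notation gc := (@gap_coord S).
Local Notation code := (@renewal_code S hS).
Local Notation pos := (@one_position S hS).
Variables (phi : X -> R) (P lam c1 C0 : R) (lw : S -> R).
Local Notation p := (fun s : S => expR (lw s)).
Local Notation Sn := (birkhoff_sum sigma phi).
Hypothesis lam_gt0 : 0 < lam.
Hypothesis phi_decomposition : forall (x : X) N a M (y : Y),
  (a + pos y M <= N)%N -> agree N (gc x) (block_seq a M y) ->
  `|Sn N x - N%:R * P - (\sum_(i < M) lw (y i) - (N - pos y M)%:R * lam)| <= c1.
Hypothesis p_le : forall s : S, p s <= C0 * expR (- lam) ^+ val s.
Variable nu : probability Y R.
Hypothesis nuP : bernoulli_measure p nu.

Variables (f : (nat -> bool) -> R) (K : nat).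
Hypothesis f_le1 : forall s, `|f s| <= 1.
Hypothesis f_det : forall s s', agree K s s' -> f s = f s'.

Definition induced_sum (y : Y) : R := fsum f (return_time y) (gc (code y)).

Hypothesis f_mean : (\int[nu]_y (induced_sum y)%:E = 0)%E.

Lemma fsum_birkhoff n (x : X) : fsum f n (gc x) = birkhoff_sum sigma (fun x => f (gc x)) n x.
Proof.
rewrite /fsum /birkhoff_sum; apply: eq_bigr => j _; congr f.
by apply/funext => k; rewrite gap_coord_iter.
Qed.

Lemma fsum_code M (y : Y) :
  fsum f (pos y M) (gc (code y)) = \sum_(i < M) induced_sum (iter i shift y).
Proof.
rewrite fsum_birkhoff birkhoff_code_blocks; apply: eq_bigr => i _.
by rewrite /induced_sum fsum_birkhoff.
Qed.

Lemma induced_sum_det : determined_by K.+1 induced_sum.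
Proof.
move=> y z yz; rewrite /induced_sum.
have e0 : y 0%N = z 0%N by apply: yz.
have -> : return_time y = return_time z by rewrite /return_time e0.
apply: eq_bigr => j _; apply: f_det => k kK; rewrite /sft.
apply: (code_agree yz); rewrite ltnS.
have -> : pos y K.+1 = (return_time z + pos (shift y) K)%N.
  by rewrite one_position_shift /return_time e0.
by rewrite addnC; apply: leq_add; [exact: ltnW|exact: leq_trans (ltnW kK) (leq_one_position _ _)].
Qed.

Lemma induced_sum_le y : `|induced_sum y| <= (return_time y)%:R.
Proof. exact: fsum_le. Qed.

Lemma exp_lam01 : 0 < expR (- lam) < 1.
Proof. by rewrite expR_gt0 expR_lt1 oppr_lt0. Qed.

(** The sum of [f] along a [block_seq] is the sum of the induced function over the
    completed blocks, up to the symbols outside of them and to end effects. *)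
Lemma block_seq_fsum a M (y : Y) N : (a + pos y M <= N)%N ->
  `|fsum f N (word_ext (word N (block_seq a M y))) -
    \sum_(i < M) induced_sum (iter i shift y)| <= (N - pos y M)%:R + 2 * K%:R.
Proof.
move=> LN; rewrite -fsum_code; set q := pos y M in LN *; set s := word_ext _.
have -> : N = (a + (q + (N - (a + q))))%N by lia.
rewrite !(fsumD f_det).
set b := (N - (a + q))%N; have -> : (a + (q + b) - q = a + b)%N by lia.
have h1 := fsum_le f_le1 a s.
have h3 := fsum_le f_le1 b (sft q (sft a s)).
have h2 : `|fsum f q (sft a s) - fsum f q (gc (code y))| <= 2 * K%:R.
  apply: fsum_close => // k kq; rewrite /sft /s word_extK; last by lia.
  by rewrite /block_seq leq_addl /= addnK addnC leq_add2l (ltnW kq).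
rewrite natrD; move: h1 h2 h3; rewrite !ler_norml; lra.
Qed.

Definition word_potential N t (w : {ffun 'I_N -> bool}) : R := t * fsum f N (word_ext w).

(** The weight of a word [w]: all ways of reading it as a [block_seq] are summed,
    each completed block costing its probability, each symbol outside the
    completed blocks costing a factor [expR (- lam)]. *)
Definition weight_integrand N t (w : {ffun 'I_N -> bool}) a M (y : Y) : R :=
  ((word N (block_seq a M y) == w) && (a + pos y M <= N)%N)%:R *
  (expR (- ((N - pos y M)%:R * lam)) * expR (word_potential t w)).

Definition ext_word_measure N t (w : {ffun 'I_N -> bool}) : \bar R :=
  (\sum_(a < N.+1) \sum_(M < N.+1) \int[nu]_y (weight_integrand t w a M y)%:E)%E.

Lemma weight_integrand_ge0 N t (w : {ffun 'I_N -> bool}) a M y :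
  0 <= weight_integrand t w a M y.
Proof. by rewrite /weight_integrand !mulr_ge0// expR_ge0. Qed.

Lemma weight_integrand_det N t (w : {ffun 'I_N -> bool}) a M :
  determined_by M (weight_integrand t w a M).
Proof.
move=> y z yz; rewrite /weight_integrand (one_position_agree yz (leqnn M)).
suff -> : word N (block_seq a M y) = word N (block_seq a M z) by [].
by apply/word_eqP => j _; exact: block_seq_agree.
Qed.

Lemma weight_integrand_measurable N t (w : {ffun 'I_N -> bool}) a M :
  measurable_fun setT (fun y : Y => (weight_integrand t w a M y)%:E).
Proof.
apply: (determined_fun_measurable (L := M)) => y z yz.
by rewrite (weight_integrand_det t w a yz).
Qed.

Lemma ext_word_measure_ge0 N t (w : {ffun 'I_N -> bool}) : (0 <= ext_word_measure t w)%E.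
Proof.
apply: sume_ge0 => a _; apply: sume_ge0 => M _; apply: integral_ge0 => y _.
by rewrite lee_fin weight_integrand_ge0.
Qed.

(** For a given [y] a single word contributes, and the factor [expR (- lam)] of each
    symbol outside the completed blocks pays for the perturbation there. *)
Lemma sum_weight_integrand N t a M y : `|t| <= lam ->
  \sum_(w : {ffun 'I_N -> bool}) weight_integrand t w a M y <=
  expR (2 * K%:R * `|t|) * expR (t * \sum_(i < M) induced_sum (iter i shift y)).
Proof.
move=> tl; rewrite (bigD1 (word N (block_seq a M y))) //= big1 ?addr0 => [|w wn]; last first.
  by rewrite /weight_integrand eq_sym (negbTE wn) mul0r.
rewrite /weight_integrand eqxx /=; have [LN|_] := boolP (a + _ <= N)%N; last first.
  by rewrite mul0r mulr_ge0 ?expR_ge0.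
rewrite mul1r -!expRD ler_expR /word_potential.
have := block_seq_fsum LN; set u := fsum _ _ _; set v := \sum_(i < M) _.
set r := (N - _)%:R => h; have r0 : 0 <= r by exact: ler0n.
have : t * (u - v) <= lam * r + 2 * K%:R * `|t|.
  apply: le_trans (ler_norm _) _; rewrite normrM.
  apply: le_trans (ler_wpM2l (normr_ge0 t) h) _; rewrite mulrDr.
  by rewrite [`|t| * (2 * _)]mulrC lerD2r ler_wpM2r.
by rewrite mulrBr [r * lam]mulrC; lra.
Qed.

(** The total mass is an integral of exponentials of Birkhoff sums over the base, to
    which [birkhoff_exp_moment] applies; a word is dominated by the integral over the
    cylinder of its own completed blocks. *)
Lemma word_weights : exists C t0 : R, [/\ 0 <= C, 0 < t0 &
  forall t, `|t| <= t0 -> word_weight_bound phi P f C t].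
Proof.
have [C [t1 [C_ge0 t1_gt0 hC]]] :=
  birkhoff_exp_moment (fun s => expR_gt0 (lw s)) nuP exp_lam01 p_le
    (ltn0Sn K) induced_sum_det induced_sum_le f_mean.
have c1_ge0 : 0 <= c1.
  have := @phi_decomposition (zero_seq S) 0 0 0 point; rewrite one_position0.
  move=> /(_ isT) h; apply: le_trans (normr_ge0 _) (h _).
  by move=> j; rewrite ltn0.
(* [`|t| <= lam] is what [sum_weight_integrand] asks for. *)
pose t0 := Num.min t1 lam; have t0_gt0 : 0 < t0 by rewrite lt_min t1_gt0.
pose C' := C + 2 * K%:R * t0 + c1.
have K2 : 0 <= 2 * K%:R * t0 by rewrite !mulr_ge0// ltW.
have C'_ge0 : 0 <= C' by rewrite !addr_ge0.
exists C', t0; split=> // t tt0 N.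
have tl : `|t| <= lam by rewrite (le_trans tt0)// ge_min lexx orbT.
have tt1 : `|t| <= t1 by rewrite (le_trans tt0)// ge_min lexx.
have K2t : 2 * K%:R * `|t| <= 2 * K%:R * t0 by rewrite ler_wpM2l// mulr_ge0.
have tot : (\sum_(w : {ffun 'I_N -> bool}) ext_word_measure t w <=
    (N.+1%:R ^+ 2 * expR (C' + N%:R * (C' * t ^+ 2)))%:E)%E.
  rewrite /ext_word_measure exchange_big /=.
  under eq_bigr do rewrite exchange_big /=.
  apply: (@le_trans _ _ (\sum_(a < N.+1) \sum_(M < N.+1)
      (expR (C' + N%:R * (C' * t ^+ 2)))%:E)%E); last first.
    rewrite [X in (X <= _)%E](_ : _ = (\sum_(a < N.+1) \sum_(M < N.+1)
      expR (C' + N%:R * (C' * t ^+ 2)))%:E).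
      by rewrite !sumr_const !card_ord lee_fin -mulrnA -[X in X <= _]mulr_natl natrM expr2.
    by rewrite -sumEFin; apply: eq_bigr => a _; rewrite -sumEFin.
  apply: lee_sum => a _; apply: lee_sum => M _.
  rewrite -ge0_integral_sum//; last 2 first.
  - by move=> w; exact: weight_integrand_measurable.
  - by move=> w y _; rewrite lee_fin weight_integrand_ge0.
  apply: (@le_trans _ _ (\int[nu]_y ((expR (2 * K%:R * `|t|))%:E *
      (expR (t * \sum_(i < M) induced_sum (iter i shift y)))%:E))%E).
    apply: ge0_le_integral => //.
    - by move=> y _; apply: sume_ge0 => w _; rewrite lee_fin weight_integrand_ge0.
    - by apply: emeasurable_sum => w; exact: weight_integrand_measurable.
    - apply: (determined_fun_measurable (L := M + K.+1)) => y z yz.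
      congr (_ * (expR (t * _))%:E)%E; apply: eq_bigr => i _.
      apply: (determined_by_shift (n := i) induced_sum_det); apply: agree_le yz.
      by rewrite leq_add2r ltnW.
    - by move=> y _; rewrite sumEFin -EFinM lee_fin sum_weight_integrand.
  rewrite ge0_integralZl//; last first.
    apply: (determined_fun_measurable (L := M + K.+1)) => y z yz.
    congr ((expR (t * _))%:E)%E; apply: eq_bigr => i _.
    apply: (determined_by_shift (n := i) induced_sum_det); apply: agree_le yz.
    by rewrite leq_add2r ltnW.
  apply: le_trans (lee_wpmul2l _ (hC t tt1 M)) _; first by rewrite lee_fin expR_ge0.
  rewrite -EFinM lee_fin -expRD ler_expR; apply: lerD; first by rewrite /C'; lra.
  have CC : C * t ^+ 2 <= C' * t ^+ 2 by rewrite ler_wpM2r ?sqr_ge0// /C'; lra.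
  apply: ler_pM => //; first by rewrite mulr_ge0 ?sqr_ge0.
  by rewrite ler_nat -ltnS.
have Vfin (w : {ffun 'I_N -> bool}) : ext_word_measure t w \is a fin_num.
  rewrite ge0_fin_numE ?ext_word_measure_ge0//; apply: le_lt_trans (ltry _).
  apply: le_trans tot; rewrite (bigD1 w)//= leeDl// sume_ge0// => w' _.
  exact: ext_word_measure_ge0.
exists (fun w => fine (ext_word_measure t w)); split.
- by move=> w; rewrite fine_ge0// ext_word_measure_ge0.
- by rewrite -lee_fin -sumEFin; under eq_bigr do rewrite fineK//.
move=> x; have [a [M [y [/block_length_le LN xz]]]] := @gap_shift_decomposition S hS x N.
set w := word N (gc x).
have aN : (a < N.+1)%N by rewrite ltnS (leq_trans _ LN)// leq_addr.
have MN : (M < N.+1)%N.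
  by rewrite ltnS (leq_trans (leq_one_position y M))// (leq_trans _ LN)// leq_addl.
have wE : word N (block_seq a M y) = w by apply/word_eqP => j jN; rewrite xz.
set c := expR (- ((N - pos y M)%:R * lam)) * expR (word_potential t w).
pose cy := cyl (@base_coord S hS) (mkseq y M).
have mcy : measurable cy by exact: measurable_cyl_base.
have low : ((c * expR (\sum_(i < M) lw (y i)))%:E <= ext_word_measure t w)%E.
  apply: (@le_trans _ _ (\int[nu]_y (weight_integrand t w a M y)%:E)%E); last first.
    rewrite /ext_word_measure (bigD1 (Ordinal aN))//= (bigD1 (Ordinal MN))//=.
    rewrite -addeA leeDl// adde_ge0//; first by apply: sume_ge0 => m _; apply: integral_ge0 => u _; rewrite lee_fin weight_integrand_ge0.
    apply: sume_ge0 => b _; apply: sume_ge0 => m _; apply: integral_ge0 => u _.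
    by rewrite lee_fin weight_integrand_ge0.
  apply: (@le_trans _ _ (\int[nu]_(u in cy) (weight_integrand t w a M u)%:E)%E); last first.
    apply: ge0_subset_integral => //; first exact: weight_integrand_measurable.
    by move=> u _; rewrite lee_fin weight_integrand_ge0.
  rewrite (eq_integral (cst c%:E)); last first.
    move=> u; rewrite inE => /cyl_mkseqP yu.
    by rewrite /= -(weight_integrand_det t w a yu) /weight_integrand wE eqxx LN mul1r.
  rewrite [leRHS](_ : _ = c%:E * nu cy)%E; last exact: integral_cst.
  rewrite (bernoulli_cyl nuP) /word_weight big_map expR_sum.
  rewrite -(big_mkord xpredT (fun i => expR (lw (y i)))) /index_iota subn0.
  by rewrite EFinM.
rewrite -ler_pdivrMl ?expR_gt0// -expRN -expRD -lee_fin fineK//.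
apply: le_trans low; rewrite lee_fin /c -!expRD ler_expR /word_potential.
have := phi_decomposition LN xz; rewrite ler_norml.
have : t * fsum f N (gc x) - t * fsum f N (word_ext w) <= 2 * K%:R * t0.
  rewrite -mulrBr; apply: le_trans (ler_norm _) _; rewrite normrM.
  apply: le_trans K2t; rewrite mulrC ler_wpM2r//; apply: fsum_close => //.
  by move=> j jN; rewrite word_extK.
by rewrite /C'; lra.
Qed.

End WeightedWords.

(** * Means of bounded functions and a variational inequality for entropy *)

Section BoundedMeasurable.
Context d (T : measurableType d) (R : realType).

(** Bounded measurable functions: the class on which the mean is real and linear. *)
Definition bmf (g : T -> R) : Prop :=
  measurable_fun setT g /\ exists M : R, forall x, `|g x| <= M.

Lemma bmf_cst (k : R) : bmf (fun=> k).
Proof. by split=> //; exists `|k|. Qed.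

Lemma bmfD (g h : T -> R) : bmf g -> bmf h -> bmf (fun x => g x + h x).
Proof.
move=> [mg [M gM]] [mh [N hN]]; split; first exact: measurable_funD.
exists (M + N) => x; apply: le_trans (ler_normD _ _) _; exact: lerD.
Qed.

Lemma bmfZ (k : R) (g : T -> R) : bmf g -> bmf (fun x => k * g x).
Proof.
move=> [mg [M gM]]; split; first exact: measurable_funM.
by exists (`|k| * M) => x; rewrite normrM ler_wpM2l.
Qed.

Lemma bmf_sum n (g : nat -> T -> R) : (forall i, bmf (g i)) ->
  bmf (fun x => \sum_(i < n) g i x).
Proof.
move=> hg; elim: n => [|n IH].
  by under eq_fun do rewrite big_ord0; exact: bmf_cst.
by under eq_fun do rewrite big_ord_recr; exact: bmfD.
Qed.

Lemma bmf_sum_fin (I : finType) (g : I -> T -> R) : (forall i, bmf (g i)) ->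
  bmf (fun x => \sum_i g i x).
Proof.
move=> hg; elim: (index_enum I) => [|i r IH].
  by under eq_fun do rewrite big_nil; exact: bmf_cst.
by under eq_fun do rewrite big_cons; exact: bmfD.
Qed.

Lemma bmf_indic (A : set T) : measurable A -> bmf \1_A.
Proof.
move=> mA; split; first exact: measurable_indic.
by exists 1 => x; rewrite indicE ger0_norm// lern1 leq_b1.
Qed.

Variable mu : probability T R.

Definition mean (g : T -> R) : R := fine (\int[mu]_x (g x)%:E).

Lemma bmf_integrable (g : T -> R) : bmf g -> mu.-integrable setT (EFin \o g).
Proof.
move=> [mg [M gM]]; apply: measurable_bounded_integrable => //.
  by apply: le_lt_trans (ltry 1); rewrite probability_le1.
exists M; split; first by rewrite num_real.
by move=> r Mr x _; apply: le_trans (gM x) (ltW Mr).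
Qed.

Lemma mean_integral (g : T -> R) : bmf g -> (\int[mu]_x (g x)%:E = (mean g)%:E)%E.
Proof. by move=> hg; rewrite /mean fineK//; exact: integrable_fin_num (bmf_integrable hg). Qed.

Lemma mean_cst (k : R) : mean (fun=> k) = k.
Proof. by rewrite /mean (probability_integral_cst mu k%:E). Qed.

Lemma meanD (g h : T -> R) : bmf g -> bmf h ->
  mean (fun x => g x + h x) = mean g + mean h.
Proof.
move=> hg hh; apply: EFin_inj; rewrite EFinD -!mean_integral//; last exact: bmfD.
by rewrite integral_EFinD//; exact: bmf_integrable.
Qed.

Lemma meanZ (k : R) (g : T -> R) : bmf g -> mean (fun x => k * g x) = k * mean g.
Proof.
move=> hg; apply: EFin_inj; rewrite EFinM -!mean_integral//; last exact: bmfZ.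
by rewrite integral_EFinZ//; exact: bmf_integrable.
Qed.

Lemma mean_sum n (g : nat -> T -> R) : (forall i, bmf (g i)) ->
  mean (fun x => \sum_(i < n) g i x) = \sum_(i < n) mean (g i).
Proof.
move=> hg; elim: n => [|n IH].
  by under eq_fun do rewrite big_ord0; rewrite big_ord0 mean_cst.
under eq_fun do rewrite big_ord_recr; rewrite big_ord_recr /= -IH meanD//.
exact: bmf_sum.
Qed.

Lemma mean_sum_fin (I : finType) (g : I -> T -> R) : (forall i, bmf (g i)) ->
  mean (fun x => \sum_i g i x) = \sum_i mean (g i).
Proof.
move=> hg.
suff : mean (fun x => \sum_(i <- index_enum I) g i x) = \sum_(i <- index_enum I) mean (g i) /\
   bmf (fun x => \sum_(i <- index_enum I) g i x) by case.
elim: (index_enum I) => [|i r [IH b]].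
  under eq_fun do rewrite big_nil.
  by rewrite mean_cst big_nil; split=> //; exact: bmf_cst.
under eq_fun do rewrite big_cons.
by split; [rewrite meanD// IH big_cons|exact: bmfD].
Qed.

Lemma le_mean (g h : T -> R) : bmf g -> bmf h -> (forall x, g x <= h x) -> mean g <= mean h.
Proof.
move=> hg hh gh; rewrite -lee_fin -!mean_integral//.
apply: le_integral => //; [exact: bmf_integrable|exact: bmf_integrable|].
by move=> x _; rewrite lee_fin.
Qed.

Lemma mean_indic (A : set T) : measurable A -> mean \1_A = fine (mu A).
Proof. by move=> mA; rewrite /mean integral_indic// setIT. Qed.

Lemma fine_probability_ge0 (A : set T) : 0 <= fine (mu A).
Proof. exact: fine_ge0. Qed.

Lemma fine_probability_le1 (A : set T) : measurable A -> fine (mu A) <= 1.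
Proof. by move=> mA; rewrite -[1]/(fine 1%E) fine_le// ?fin_num_measure// probability_le1. Qed.

Lemma le_fine_probability (A B : set T) : measurable A -> measurable B -> A `<=` B ->
  fine (mu A) <= fine (mu B).
Proof.
by move=> mA mB AB; rewrite fine_le ?fin_num_measure//; apply: le_measure; rewrite ?inE.
Qed.

Section FiniteValued.
Variables (I : finType) (c : T -> I).
Hypothesis mc : forall i, measurable (c @^-1` [set i]).

Lemma finite_valuedE (g : I -> R) x :
  g (c x) = \sum_i g i * \1_(c @^-1` [set i]) x.
Proof.
rewrite (bigD1 (c x))//= big1 ?addr0 => [|i ic]; last first.
  by rewrite indicE memNset ?mulr0//= => e; move: ic; rewrite e eqxx.
by rewrite indicE mem_set// mulr1.
Qed.

Lemma bmf_finite_valued (g : I -> R) : bmf (fun x => g (c x)).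
Proof.
under eq_fun do rewrite finite_valuedE.
by apply: (bmf_sum_fin (g := fun i x => g i * _)) => i; apply: bmfZ; exact: bmf_indic.
Qed.

Lemma mean_finite_valued (g : I -> R) :
  mean (fun x => g (c x)) = \sum_i g i * fine (mu (c @^-1` [set i])).
Proof.
under eq_fun do rewrite finite_valuedE.
rewrite (mean_sum_fin (g := fun i x => g i * _)) => [|i]; last first.
  by apply: bmfZ; exact: bmf_indic.
by apply: eq_bigr => i _; rewrite meanZ ?mean_indic//; exact: bmf_indic.
Qed.

Definition entropy_of : R :=
  - \sum_i fine (mu (c @^-1` [set i])) * ln (fine (mu (c @^-1` [set i]))).

Lemma entropy_ofE : entropy_of = mean (fun x => - ln (fine (mu (c @^-1` [set c x])))).
Proof.
rewrite (mean_finite_valued (fun i => - ln (fine (mu (c @^-1` [set i]))))).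
by rewrite /entropy_of -sumrN; apply: eq_bigr => i _; rewrite mulNr mulrC.
Qed.

Lemma entropy_of_ge0 : 0 <= entropy_of.
Proof.
rewrite /entropy_of -sumrN; apply: sumr_ge0 => i _; rewrite oppr_ge0.
by rewrite mulr_ge0_le0 ?fine_probability_ge0// ln_le0// fine_probability_le1.
Qed.

End FiniteValued.

(** Gibbs' inequality against a reference weight [q] of total mass at most [Z], for
    the pair of [c] and an auxiliary [e]: the entropy of [c] is at most that of the
    pair. *)
Lemma entropy_of_le (I D : finType) (c : T -> I) (e : T -> D) (q : I -> D -> R) (Z : R) (g : T -> R) :
  (forall i, measurable (c @^-1` [set i])) -> (forall j, measurable (e @^-1` [set j])) ->
  0 < Z -> (forall i j, 0 <= q i j) -> \sum_i \sum_j q i j <= Z ->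
  bmf g -> (forall x, expR (- g x) <= q (c x) (e x)) ->
  entropy_of c <= mean g + ln Z.
Proof.
move=> mc me Z0 q0 qZ hg gq.
pose p i := fine (mu (c @^-1` [set i])).
have p0 i : 0 <= p i by exact: fine_probability_ge0.
(* [p'] avoids dividing by zero and has the same logarithm, as [ln 0 = 0]. *)
pose p' i := if p i == 0 then 1 else p i.
have p'0 i : 0 < p' i by rewrite /p'; case: eqP => // /eqP pi; rewrite lt_def pi p0.
have lnp i : ln (p i) = ln (p' i).
  by rewrite /p'; case: eqP => // ->; rewrite ln1 ln0.
pose ce x := (c x, e x).
have mce k : measurable (ce @^-1` [set k]).
  case: k => i j; have -> : ce @^-1` [set (i, j)] = c @^-1` [set i] `&` e @^-1` [set j].
    by rewrite eqEsubset; split=> x /=; [case=> -> ->|case=> <- <-].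
  exact: measurableI.
pose r (k : I * D) := q k.1 k.2 / (p' k.1 * Z).
have pw x : - ln (p (c x)) <= (g x + ln Z - 1) + r (ce x).
  rewrite lnp; have := expR_ge1Dx (- g x - ln (p' (c x)) - ln Z).
  rewrite -addrA -opprD expRB expRD lnK ?posrE// lnK ?posrE//.
  have : expR (- g x) / (p' (c x) * Z) <= r (ce x).
    by rewrite /r /= ler_pM2r ?gq// invr_gt0 mulr_gt0.
  lra.
have br : bmf (fun x => r (ce x)) by exact: bmf_finite_valued.
have bg : bmf (fun x => g x + (ln Z - 1)) by apply: bmfD => //; exact: bmf_cst.
have mr : mean (fun x => r (ce x)) <= 1.
  rewrite mean_finite_valued//.
  rewrite (eq_bigr (fun k : I * D => (fun i j =>
    r (i, j) * fine (mu (ce @^-1` [set (i, j)]))) k.1 k.2)) => [|[i j] _ //].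
  rewrite -(pair_bigA _ (fun i j => r (i, j) * fine (mu (ce @^-1` [set (i, j)])))) /=.
  rewrite -(ler_pM2r Z0) mul1r; apply: le_trans qZ; rewrite mulr_suml; apply: ler_sum => i _.
  rewrite mulr_suml; apply: ler_sum => j _.
  have le_pi : fine (mu (ce @^-1` [set (i, j)])) <= p' i.
    apply: (@le_trans _ _ (p i)).
      by apply: le_fine_probability => // x /= [].
    by rewrite /p'; case: eqP => // ->.
  rewrite /r /= invfM mulrA mulrAC divfK ?gt_eqF// mulrAC ler_pdivrMr//.
  exact: ler_wpM2l.
rewrite entropy_ofE//.
apply: (@le_trans _ _ (mean (fun x => (g x + (ln Z - 1)) + r (ce x)))).
  apply: le_mean; [exact: (bmf_finite_valued mc (fun i => - ln (p i)))|exact: bmfD|].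
  by move=> x; have := pw x; rewrite -/(p (c x)); lra.
rewrite meanD// meanD//; last exact: bmf_cst.
by rewrite mean_cst; lra.
Qed.


End BoundedMeasurable.

Section Approximation.
Context {d : measure_display} {T : measurableType d} {A : countType} {R : realType}.
Variables (c : T -> nat -> A) (cT : cylindrical c).
Variable mu : probability T R.

Definition determined_set (N : nat) (D : set T) :=
  forall x z, agree N (c x) (c z) -> D x -> D z.

(** Approximation in measure by a set depending on finitely many coordinates. *)
Definition approximable (B : set T) := forall eps : R, 0 < eps ->
  exists N D, determined_set N D /\ fine (mu ((B `\` D) `|` (D `\` B))) <= eps.

Let determined_setU N M D E : determined_set N D -> determined_set M E ->
  determined_set (maxn N M) (D `|` E).
Proof.
move=> hD hE x z xz [Dx|Ex]; [left|right]; [apply: hD Dx|apply: hE Ex];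
  by apply: agree_le xz; rewrite leq_max leqnn ?orbT.
Qed.

Let determined_setm N D : determined_set N D -> measurable D.
Proof. exact: determined_measurable. Qed.

Let measurableSD (B D : set T) : measurable B -> measurable D -> measurable ((B `\` D) `|` (D `\` B)).
Proof. by move=> mB mD; apply: measurableU; exact: measurableD. Qed.

Let fine_probabilityU (B D : set T) : measurable B -> measurable D ->
  fine (mu (B `|` D)) <= fine (mu B) + fine (mu D).
Proof.
move=> mB mD; rewrite -fineD ?fin_num_measure//; apply: fine_le.
- by rewrite fin_num_measure//; exact: measurableU.
- by rewrite fin_numD !fin_num_measure.
- exact: measureU2.
Qed.

Let approximableU (B E : set T) : measurable B -> measurable E ->
  approximable B -> approximable E -> approximable (B `|` E).
Proof.
move=> mB mE aB aE eps eps0; have e2 : 0 < eps / 2 by lra.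
have [N [D [hD DB]]] := aB _ e2; have [M [F [hF FE]]] := aE _ e2.
have mD := determined_setm hD; have mF := determined_setm hF.
exists (maxn N M), (D `|` F); split; first exact: determined_setU.
have -> : eps = eps / 2 + eps / 2 by lra.
apply: le_trans (lerD DB FE); apply: le_trans (fine_probabilityU _ _); try exact: measurableSD.
apply: le_fine_probability; [|apply: measurableU; exact: measurableSD|].
  by apply: measurableSD; exact: measurableU.
by move=> x [[[Bx|Ex] /not_orP[nD nF]]|[[Dx|Fx] /not_orP[nB nE]]];
  [left; left|right; left|left; right|right; right].
Qed.

(** The approximable sets form a sigma-algebra: a countable union is approximated by
    a finite one. *)
Lemma measurable_approximable (B : set T) : measurable B -> approximable B.
Proof.
suff sub : <<s cylinders c >> `<=` [set B | measurable B /\ approximable B].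
  by move=> /cT.2/sub[].
move: B => _.
have det0 B N : determined_set N B -> approximable B.
  move=> hB eps eps0; exists N, B; split=> //.
  by rewrite setDv setU0 measure0 ltW.
apply: smallest_sub; last first.
  move=> _ [->|[s ->]].
    by split; [exact: measurable0|apply: (det0 _ 0%N)].
  split; first exact: cT.1.
  apply: (det0 _ (size s)) => x z xz xs.
  by rewrite (cyl_mem xs); exact/cyl_mkseqP.
split.
- by split; [exact: measurable0|apply: (det0 _ 0%N)].
- move=> B [mB aB]; rewrite setTD; split; first exact: measurableC.
  move=> eps /aB[N [D [hD DB]]]; exists N, (~` D); split.
    by move=> x z xz nD Dz; apply: nD; apply: hD Dz; exact: agree_sym.
  suff -> : ~` B `\` ~` D `|` ~` D `\` ~` B = B `\` D `|` D `\` B by [].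
  rewrite eqEsubset; split=> x /=; have [] := pselect (B x); have [] := pselect (D x); tauto.
move=> B hB; have mB n : measurable (B n) by case: (hB n).
have mUB : measurable (\bigcup_n B n) by exact: bigcupT_measurable.
split=> // eps eps0; have e2 : 0 < eps / 2 by lra.
pose U n := \big[setU/set0]_(i < n) B i.
have mU n : measurable (U n) by exact: bigsetU_measurable.
have aU n : approximable (U n).
  rewrite /U; elim: n => [|n IH]; first by rewrite big_ord0; apply: (det0 _ 0%N).
  rewrite big_ord_recr /=; apply: approximableU => //; [exact: mU|by case: (hB n)].
have cv : mu (U n) @[n --> \oo] --> mu (\bigcup_n U n).
  apply: nondecreasing_cvg_mu => //; first exact: bigcupT_measurable.
  by move=> m n mn; apply/subsetPset; exact: subset_bigsetU.
have UB : \bigcup_n U n = \bigcup_n B n.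
  rewrite eqEsubset; split=> x.
    by move=> [n _]; rewrite /U -bigcup_mkord => -[i _ Bi]; exists i.
  by move=> [n _ Bn]; exists n.+1 => //; rewrite /U -bigcup_mkord; exists n => /=.
rewrite UB in cv.
have : fine (mu (U n)) @[n --> \oo] --> fine (mu (\bigcup_n B n)).
  by apply: fine_cvg; rewrite fineK ?fin_num_measure.
move=> /cvgr_gt/(_ (fine (mu (\bigcup_n B n)) - eps / 2)).
rewrite ltrBlDr ltrDl => /(_ e2)[n _ /(_ n (leqnn _)) /= hn].
have [N [D [hD DU]]] := aU n _ e2; have mD := determined_setm hD.
exists N, D; split=> //.
have UnB : U n `<=` \bigcup_n B n by rewrite -UB => x Ux; exists n.
have dif : fine (mu ((\bigcup_n B n) `\` U n)) <= eps / 2.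
  rewrite measureD//; last by rewrite -ge0_fin_numE// fin_num_measure.
  rewrite setIidr// fineB ?fin_num_measure//; lra.
have -> : eps = eps / 2 + eps / 2 by lra.
apply: le_trans (lerD dif DU); apply: le_trans (fine_probabilityU _ _).
- apply: le_fine_probability; [exact: measurableSD| |].
    by apply: measurableU; [exact: measurableD|exact: measurableSD].
  move=> x [[Bx nD]|[Dx nB]]; last by right; right; split=> // /UnB.
  by have [Ux|nU] := pselect (U n x); [right; left|left].
- exact: measurableD.
- exact: measurableSD.
Qed.

End Approximation.

(** * Upper bound for the entropy of a partition *)

(** A divergent sequence has limit 0 by convention, and then [a] is nonnegative as the
    terms are. *)
Lemma limn_le_bound (R : realType) (u : nat -> R) (a b : R) :
  (forall n, 0 <= u n) -> (forall n, (0 < n)%N -> u n <= a + b / n%:R) -> limn u <= a.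
Proof.
move=> u0 ub.
have key e : 0 < e -> \forall n \near \oo, u n <= a + e.
  move=> e0; have [N _ hN] := nbhs_infty_gtr (`|b| / e).
  exists N.+1 => //= n Nn; have n0 : (0 < n)%N by exact: leq_ltn_trans Nn.
  apply: le_trans (ub n n0) _; rewrite lerD2l ler_pdivrMr ?ltr0n//.
  have := hN n (ltnW Nn); rewrite /= ltr_pdivrMr// mulrC => /ltW.
  exact: le_trans (ler_norm b).
have [cu|ncu] := pselect (cvgn u).
  apply/ler_addgt0Pr => e e0; apply: limr_le => //; exact: key.
rewrite dvgP//; apply/ler_addgt0Pr => e e0.
have [N _ /(_ N (leqnn _)) /=] := key e e0; exact: le_trans.
Qed.

Section InvariantMeans.
Context d (T : measurableType d) (R : realType).
Variables (f : T -> T) (mu : probability T R).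
Hypothesis mf : measurable_fun setT f.
Hypothesis muI : invariant_measure f mu.

Lemma bmf_comp (g : T -> R) (h : T -> T) : measurable_fun setT h -> bmf g -> bmf (fun x => g (h x)).
Proof.
move=> mh [mg [M gM]]; split; last by exists M.
by apply: (measurableT_comp mg mh).
Qed.

Lemma mean_invariant (g : T -> R) : bmf g -> mean mu (fun x => g (f x)) = mean mu g.
Proof.
move=> hg; have [_ [M gM]] := hg.
suff : mean mu (fun x => g (f x) + M) = mean mu (fun x => g x + M).
  rewrite !meanD//; [by move=> /addIr|exact: bmf_cst|exact: bmf_comp|exact: bmf_cst].
have hM : bmf (fun x => g x + M) by apply: bmfD => //; exact: bmf_cst.
rewrite /mean; congr fine; apply/esym.
apply: (ge0_integral_transfer (phi := f) (D := setT) (f := fun x => (g x + M)%:E)) => //.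
- by move=> A mA; rewrite setIT; apply/esym; exact: muI.
- by apply/measurable_EFinP; case: hM.
- by move=> x; rewrite lee_fin; have := gM x; rewrite ler_norml; lra.
Qed.

Lemma measurable_iter n : measurable_fun setT (iter n f).
Proof.
elim: n => [|n IH]; first exact: measurable_id.
by apply: (measurableT_comp mf IH).
Qed.

Lemma mean_iter n (g : T -> R) : bmf g -> mean mu (fun x => g (iter n f x)) = mean mu g.
Proof.
move=> hg; elim: n => [//|n IH]; rewrite -[RHS]IH.
under eq_fun do rewrite iterSr.
apply: (@mean_invariant (fun x => g (iter n f x))).
by apply: bmf_comp => //; exact: measurable_iter.
Qed.

Lemma bmf_birkhoff n (g : T -> R) : bmf g -> bmf (birkhoff_sum f g n).
Proof.
move=> hg; apply: (bmf_sum n (g := fun i x => g (iter i f x))) => i.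
by apply: bmf_comp => //; exact: measurable_iter.
Qed.

Lemma mean_birkhoff n (g : T -> R) : bmf g -> mean mu (birkhoff_sum f g n) = n%:R * mean mu g.
Proof.
move=> hg; rewrite /birkhoff_sum (mean_sum mu n (g := fun i x => g (iter i f x))) => [|i].
  by under eq_bigr do rewrite mean_iter//; rewrite sumr_const card_ord mulr_natl.
by apply: bmf_comp => //; exact: measurable_iter.
Qed.

End InvariantMeans.

Section PartitionCodes.
Context d (T : measurableType d) (R : realType) (f : T -> T).
Variables (k : nat) (xi : 'I_k -> set T).
Hypothesis xiP : finite_partition xi.

Lemma partition_index : exists idx : T -> 'I_k, forall i, idx @^-1` [set i] = xi i.
Proof.
case: xiP => mxi txi cxi.
have ex x : exists i, xi i x by have : setT x := I; rewrite -cxi => -[i _]; exists i.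
have [idx hidx] := choice ex; exists idx => i.
rewrite eqEsubset; split=> x /=; first by move=> <-.
move=> xix; apply/eqP; apply: contraT => ij.
by have /trivIsetP/(_ (idx x) i I I ij) := txi; rewrite -subset0 => /(_ x); case.
Qed.

Lemma join_cellE (idx : T -> 'I_k) n (w : {ffun 'I_n -> 'I_k}) :
  (forall i, idx @^-1` [set i] = xi i) ->
  join_cell f xi w = (fun x => [ffun i : 'I_n => idx (iter i f x)]) @^-1` [set w].
Proof.
move=> hidx; rewrite /join_cell eqEsubset; split=> x /=.
  by move=> h; apply/ffunP => i; rewrite ffunE; have := h i I; rewrite /= -hidx.
by move=> <- i _ /=; rewrite ffunE -hidx.
Qed.

Lemma itinerary_measurable (idx : T -> 'I_k) n (w : {ffun 'I_n -> 'I_k}) :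
  (forall i, idx @^-1` [set i] = xi i) -> measurable_fun setT f ->
  measurable ((fun x => [ffun i : 'I_n => idx (iter i f x)]) @^-1` [set w]).
Proof.
move=> hidx mf; rewrite -(join_cellE w hidx) /join_cell.
apply: fin_bigcap_measurable => [|i _].
  exact: (sub_finite_set _ (finite_finpred (predT : pred 'I_n))).
 case: xiP => mxi _ _; rewrite -[X in measurable X]setTI.
by apply: (measurable_iter mf i) => //.
Qed.

End PartitionCodes.

Section EntropyBound.
Context {R : realType} {S : set nat}.
Local Notation X := (gap_shift S).
Local Notation sigma := (@gap_shift_map S).
Local Notation gc := (@gap_coord S).
Local Notation Sn := (birkhoff_sum sigma).

Lemma gap_determined_measurable N (B : set X) :
  (forall x z : X, agree N (gc x) (gc z) -> B x -> B z) -> measurable B.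
Proof. exact: (determined_measurable (@gap_shift_cylindrical S)). Qed.

Lemma sigma_measurable : measurable_fun setT sigma.
Proof.
apply: (cylindrical_fun (@gap_shift_cylindrical S)) => s.
apply: (@gap_determined_measurable (1 + size s)%N) => x z xz /=.
rewrite /cyl /= => <-; rewrite size_mkseq; apply/mkseq_agree.
exact/agree_sym/(agree_iter_sigma (n := 1)).
Qed.

Lemma word_measurable N w : measurable ((fun x : X => word N (gc x)) @^-1` [set w]).
Proof.
apply: (@gap_determined_measurable N) => x z xz /= <-.
by apply/word_eqP; exact: agree_sym.
Qed.

Lemma bmf_determined (f : (nat -> bool) -> R) (K : nat) (M : R) :
  (forall s s', agree K s s' -> f s = f s') -> (forall s, `|f s| <= M) ->
  bmf (fun x : X => f (gc x)).
Proof.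
move=> fK fM; split; last by exists M.
move=> _ B mB; rewrite setTI; apply: (@gap_determined_measurable K) => x z xz.
by rewrite /= (fK _ _ xz).
Qed.

(** Each cell is close in measure to a set depending on finitely many coordinates;
    [kappa] sends a word to a cell whose approximation contains it. *)
Lemma partition_approximation (mu : probability X R) (k : nat) (xi : 'I_k -> set X)
    (idx : X -> 'I_k) (eps : R) :
  (forall i, measurable (xi i)) -> (forall i, idx @^-1` [set i] = xi i) -> 0 < eps ->
  exists N (kappa : {ffun 'I_N -> bool} -> 'I_k),
    measurable [set x | idx x <> kappa (word N (gc x))] /\
    fine (mu [set x | idx x <> kappa (word N (gc x))]) <= eps.
Proof.
move=> mxi hidx eps0.
have k0 : 0 < k%:R :> R.
  by rewrite ltr0n; case: (idx point) => i; exact: leq_ltn_trans.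
have epsk : 0 < eps / k%:R by rewrite divr_gt0.
have ex i : exists ND : nat * set X, determined_set gc ND.1 ND.2 /\
    fine (mu ((xi i `\` ND.2) `|` (ND.2 `\` xi i))) <= eps / k%:R.
  have [N [D [h1 h2]]] := measurable_approximable (@gap_shift_cylindrical S) mu (mxi i) epsk.
  by exists (N, D).
have [ND hND] := choice ex; pose D i := (ND i).2.
pose N := (\max_i (ND i).1)%N.
have hD i x z : agree N (gc x) (gc z) -> D i x -> D i z.
  by move=> xz; apply: (hND i).1; apply: agree_le xz; exact: leq_bigmax.
have mD i : measurable (D i) by exact: (gap_determined_measurable (@hD i)).
pose k' (x : X) : 'I_k := odflt (idx point) [pick i | `[< D i x >]].
have k'_agree x z : agree N (gc x) (gc z) -> k' x = k' z.
  move=> xz; rewrite /k'; congr odflt; apply: eq_pick => i.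
  by apply/asboolP/asboolP; apply: hD => //; exact: agree_sym.
pose kappa w : 'I_k :=
  if pselect (exists x : X, word N (gc x) = w) is left e then k' (projT1 (cid e))
  else idx point.
have kappaE x : kappa (word N (gc x)) = k' x.
  rewrite /kappa; case: pselect => [e|[]]; last by exists x.
  by case: (cid e) => z /= /word_eqP; exact: k'_agree.
pose E i := (xi i `\` D i) `|` (D i `\` xi i).
have mE i : measurable (E i) by apply: measurableU; exact: measurableD.
exists N, kappa.
have mMis : measurable [set x | idx x <> kappa (word N (gc x))].
  have -> : [set x | idx x <> kappa (word N (gc x))] =
      ~` \bigcup_(i in [set: 'I_k]) (xi i `&` [set x | k' x = i]).
    rewrite eqEsubset; split=> x /=; rewrite kappaE.
      by move=> ne [i _ []]; rewrite -hidx => /= <- /esym.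
    by move=> h e; apply: h; exists (idx x) => //; split; [rewrite -hidx|].
  apply: measurableC; apply: countable_bigcupT_measurable => [|i]; first exact: countableP.
  apply: measurableI => //.
  by apply: (@gap_determined_measurable N) => x z xz /= <-; rewrite (k'_agree _ _ xz).
split=> //.
pose E' j := oapp E set0 (insub j).
have E'E (i : 'I_k) : E' (val i) = E i by rewrite /E' valK.
have sub : [set x | idx x <> kappa (word N (gc x))] `<=` \big[setU/set0]_(j < k) E' j.
  move=> x /=; rewrite kappaE => ne; rewrite -bigcup_mkord.
  suff [i Ei] : exists i, E i x by exists (val i); [exact: (ltn_ord i)|rewrite E'E].
  have xix : xi (idx x) x by rewrite -hidx.
  have [Dx|nDx] := pselect (D (idx x) x); last by exists (idx x); left.
  move: ne; rewrite /k'; case: pickP => [i /asboolP Di|/(_ (idx x))/asboolP//] /= ne.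
  by exists i; right; split=> //; rewrite -hidx => /= e; apply: ne.
apply: (@le_trans _ _ (\sum_(i < k) fine (mu (E i)))).
  rewrite -lee_fin -sumEFin.
  rewrite (eq_bigr (fun i => mu (E i))); last by move=> i _; rewrite fineK// fin_num_measure.
  rewrite fineK ?fin_num_measure//.
  rewrite (eq_bigr (fun i : 'I_k => mu (E' (val i)))) => [|i _]; last by rewrite E'E.
  apply: content_subadditive => // j jk.
  by rewrite -[j]/(val (Ordinal jk)) E'E.
have -> : eps = \sum_(i < k) (eps / k%:R).
  by rewrite sumr_const card_ord -[RHS]mulr_natr divfK ?gt_eqF.
by apply: ler_sum => i _; exact: (hND i).2.
Qed.

Variables (phi : X -> R) (P : R).
Hypothesis phi_bmf : bmf phi.
Variables (f : (nat -> bool) -> R) (K : nat).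
Hypothesis f_le1 : forall s, `|f s| <= 1.
Hypothesis f_det : forall s s', agree K s s' -> f s = f s'.
Variables (C t : R).
Hypothesis weights : word_weight_bound phi P f C t.

Variable mu : probability X R.
Hypothesis muI : invariant_measure sigma mu.

(** Gibbs' inequality for the itinerary of length [n] along [xi], together with the
    word of length [n + N0] from which [kappa] guesses that itinerary. The reference
    weight is that of the word, times [delta] for each wrong guess; wrong guesses have
    small probability, hence a small mean cost. *)
Lemma join_entropy_le k (xi : 'I_k -> set X) (eta : R) : finite_partition xi -> 0 < eta ->
  exists b : R, forall n, join_entropy sigma mu xi n <=
  n%:R * (P - mean mu phi - t * mean mu (fun x => f (gc x)) + C * t ^+ 2 + eta) + b.
Proof.
move=> xiP eta0; set A := (X in X + eta).
have [idx hidx] := partition_index xiP; have [mxi _ _] := xiP.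
have f_bmf : bmf (fun x => f (gc x)) by exact: bmf_determined f_det f_le1.
(* The total error [eta] is shared by the mass of the wrong guesses, of which there are
   [k] for each symbol; by their mean cost [Lam] times [eps]; and by the polynomial
   factor of the weights. *)
pose e := eta / 3; have e0 : 0 < e by rewrite /e; lra.
pose delta := Num.min (1 / 2) (e / k.+1%:R).
have d0 : 0 < delta by rewrite lt_min; apply/andP; split; [lra|rewrite divr_gt0].
have dk : k%:R * delta <= e.
  apply: (@le_trans _ _ (k.+1%:R * (e / k.+1%:R))); last by rewrite mulrC divfK// pnatr_eq0.
  by apply: ler_pM; rewrite ?ler_nat ?(ltW d0)// ge_min lexx orbT.
pose Lam := - ln delta.
have Lam0 : 0 <= Lam.
  by rewrite /Lam oppr_ge0 ln_le0// (@le_trans _ _ (1 / 2))//; [rewrite ge_min lexx|lra].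
pose eps := e / (Lam + 1); have eps0 : 0 < eps by rewrite divr_gt0//; lra.
have Le : Lam * eps <= e.
  by rewrite /eps mulrC -mulrA ger_pMr// mulrC ler_pdivrMr; lra.
have [N0 [kappa [mMis Mis_le]]] := partition_approximation mu mxi hidx eps0.
set Mis := [set x | _] in mMis Mis_le.
pose K1 := 2 / e ^+ 2; have K10 : 0 < K1 by rewrite divr_gt0// exprn_gt0.
pose b := C + C + N0%:R * A + ln K1 + e * N0.+1%:R.
have itm n (w : {ffun 'I_n -> 'I_k}) := itinerary_measurable xiP w hidx sigma_measurable.
have HE n : join_entropy sigma mu xi n = entropy_of mu (fun x => [ffun i : 'I_n => idx (iter i sigma x)]).
  by rewrite /join_entropy /entropy_of; congr (- _); apply: eq_bigr => w _; rewrite (join_cellE _ _ hidx).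
exists b => n; rewrite HE.
pose N := (n + N0)%N; have [V [V0 VZ Vlow]] := weights N.
pose ch (a b : 'I_k) : R := if a == b then 1 else delta.
pose sub (w : {ffun 'I_N -> bool}) (i : 'I_n) := kappa (word N0 (sft i (word_ext w))).
pose q (u : {ffun 'I_n -> 'I_k}) w := V w * \prod_(i < n) ch (u i) (sub w i).
pose Z := K1 * expR (e * N.+1%:R) * expR (C + N%:R * (C * t ^+ 2)) * expR (n%:R * e).
pose g x := (C + N%:R * P) + ((-1) * Sn phi N x + ((- t) * Sn (fun x => f (gc x)) N x +
   Lam * \sum_(i < n) \1_Mis (iter i sigma x))).
have ch0 u v : 0 <= ch u v by rewrite /ch; case: ifP => // _; exact: ltW.
have mis_bmf i : bmf (fun x => \1_Mis (iter i sigma x) : R).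
    apply: (bmf_comp (g := \1_Mis)); last exact: bmf_indic.
    exact: (measurable_iter sigma_measurable i).
have mis_sum_bmf : bmf (fun x => \sum_(i < n) (\1_Mis (iter i sigma x) : R)).
  exact: (bmf_sum n (g := fun i x => \1_Mis (iter i sigma x))).
have bS h : bmf h -> bmf (Sn h N) by exact: bmf_birkhoff sigma_measurable N h.
have Z0 : 0 < Z by do 3 (apply: mulr_gt0; last exact: expR_gt0).
have qZ : \sum_u \sum_w q u w <= Z.
  rewrite exchange_big /=.
  apply: (@le_trans _ _ (\sum_w V w * expR (n%:R * e))).
    apply: ler_sum => w _; rewrite -mulr_sumr; apply: ler_wpM2l; first exact: V0.
    rewrite -(bigA_distr_bigA (fun i a => ch a (sub w i))) /= expRM_natl.
    rewrite -[X in expR e ^+ X]card_ord -prodr_const; apply: ler_prod => i _.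
    rewrite sumr_ge0//=; apply: le_trans (expR_ge1Dx e); apply: le_trans (lerD (lexx 1) dk).
    rewrite (bigD1 (sub w i))//= {1}/ch eqxx lerD2l.
    apply: (@le_trans _ _ (\sum_(a < k) delta)); last by rewrite sumr_const card_ord mulr_natl.
    rewrite [leLHS]big_mkcond; apply: ler_sum => a _; rewrite /ch.
    by case: (a == _) => //=; exact: ltW.
  rewrite -mulr_suml /Z ler_pM2r ?expR_gt0//; apply: le_trans VZ _.
  rewrite ler_pM2r ?expR_gt0// /K1 mulrAC ler_pdivlMr ?exprn_gt0//.
  have := @expR_ge1Dxn R (e * N.+1%:R) 1; rewrite mulr_ge0 ?(ltW e0)// => /(_ isT).
  have -> : (1.+1)`!%:R = 2 :> R by [].
  by rewrite exprMn; lra.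
have gbmf : bmf g.
  apply: bmfD; first exact: bmf_cst.
  apply: bmfD; first exact/bmfZ/bS.
  by apply: bmfD; [exact/bmfZ/bS|exact: bmfZ].
have gq x : expR (- g x) <= q [ffun i : 'I_n => idx (iter i sigma x)] (word N (gc x)).
  set a := Sn phi N x - N%:R * P + t * fsum f N (gc x).
  have -> : - g x = (- C + a) + \sum_(i < n) (- Lam * \1_Mis (iter i sigma x)).
    by rewrite /g /a -mulr_sumr fsum_birkhoff; lra.
  rewrite expRD [X in _ * X]expR_sum /q; apply: ler_pM; first exact: expR_ge0.
  - by apply: prodr_ge0 => i _; exact: expR_ge0.
  - by rewrite expRD expRN ler_pdivrMl ?expR_gt0//; exact: Vlow.
  apply: ler_prod => i _; rewrite expR_ge0 /= ffunE /sub.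
  have -> : word N0 (sft i (word_ext (word N (gc x)))) = word N0 (gc (iter i sigma x)).
    apply/word_eqP => j jN; rewrite /sft word_extK ?gap_coord_iter// /N.
    by rewrite [(j + i)%N]addnC -addnS leq_add// ltnW.
  rewrite /ch; case: eqP => [eq|neq].
    by rewrite indicE memNset ?mulr0 ?expR0// /Mis /=; apply.
  by rewrite indicE mem_set// mulr1 /Lam opprK lnK.
have q0 u w : 0 <= q u w by rewrite /q mulr_ge0// prodr_ge0.
have mw (w : {ffun 'I_N -> bool}) := @word_measurable N w.
have H := entropy_of_le mu (itm n) mw Z0 q0 qZ gbmf gq.
apply: le_trans H _.
have -> : mean mu g = C + N%:R * P - N%:R * mean mu phi - t * (N%:R * mean mu (fun x => f (gc x)))
    + Lam * (n%:R * fine (mu Mis)).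
  rewrite meanD ?mean_cst//; [|exact: bmf_cst|]; last first.
    apply: bmfD; first exact/bmfZ/bS.
    by apply: bmfD; [exact/bmfZ/bS|exact: bmfZ].
  rewrite meanD//; [|exact/bmfZ/bS|by apply: bmfD; [exact/bmfZ/bS|exact: bmfZ]].
  rewrite meanD//; [|exact/bmfZ/bS|exact: bmfZ].
  rewrite !meanZ//; [|exact: bS|exact: bS].
  rewrite !(mean_birkhoff sigma_measurable muI)//; last exact: bmf_indic.
  by rewrite mean_indic//; lra.
have -> : ln Z = ln K1 + e * N.+1%:R + (C + N%:R * (C * t ^+ 2)) + n%:R * e.
  rewrite -[RHS]expRK; congr ln.
  rewrite /Z (expRD (ln K1 + e * N.+1%:R + (C + N%:R * (C * t ^+ 2)))).
  by rewrite (expRD (ln K1 + e * N.+1%:R)) (expRD (ln K1)) lnK.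
have LM : Lam * (n%:R * fine (mu Mis)) <= n%:R * e.
  rewrite mulrCA; apply: ler_wpM2l => //; apply: le_trans Le; exact: ler_wpM2l.
have NE : N%:R = n%:R + N0%:R :> R by rewrite natrD.
have NE' : N.+1%:R = n%:R + N0.+1%:R :> R by rewrite -natrD addnS.
have etae : eta = 3 * e by rewrite /e; lra.
rewrite NE NE' etae /b /A; lra.
Qed.

Lemma partition_entropy_le k (xi : 'I_k -> set X) : finite_partition xi ->
  partition_entropy sigma mu xi <=
  P - mean mu phi - t * mean mu (fun x => f (gc x)) + C * t ^+ 2.
Proof.
move=> xiP; apply/ler_addgt0Pr => eta eta0.
have [b hb] := join_entropy_le xiP eta0.
apply: (@limn_le_bound _ _ _ b) => n; last first.
  by move=> n0; rewrite ler_pdivrMr ?ltr0n// mulrDl divfK ?pnatr_eq0 -?lt0n// mulrC.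
have [idx hidx] := partition_index xiP.
rewrite divr_ge0//; have -> : join_entropy sigma mu xi n =
    entropy_of mu (fun x => [ffun i : 'I_n => idx (iter i sigma x)]).
  by rewrite /join_entropy /entropy_of; congr (- _); apply: eq_bigr => w _; rewrite (join_cellE _ _ hidx).
by apply: entropy_of_ge0 => w; exact: (itinerary_measurable xiP w hidx sigma_measurable).
Qed.

End EntropyBound.

(** * The lift of the Bernoulli measure *)

(** Sums along an orbit up to the return time are of this kind. *)
Lemma measurable_random_sum d (T : measurableType d) (R : realType)
    (tau : T -> nat) (u : nat -> T -> R) :
  (forall n, measurable (tau @^-1` [set n])) -> (forall j, measurable_fun setT (u j)) ->
  measurable_fun setT (fun x => \sum_(j < tau x) u j x).
Proof.
move=> mtau mu _ B mB; rewrite setTI.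
have -> : (fun x => \sum_(j < tau x) u j x) @^-1` B =
    \bigcup_n ((tau @^-1` [set n]) `&` (fun x => \sum_(j < n) u j x) @^-1` B).
  rewrite eqEsubset; split=> x /=; first by exists (tau x).
  by case=> n _ [/= <-].
apply: bigcupT_measurable => n; apply: measurableI => //.
have : measurable_fun setT (fun x => \sum_(j < n) u j x).
  elim: n => [|n IH]; first by under eq_fun do rewrite big_ord0; exact: measurable_cst.
  by under eq_fun do rewrite big_ord_recr; exact: measurable_funD.
by move=> /(_ measurableT B mB); rewrite setTI.
Qed.

Lemma eseries_finite_support (R : realType) (u : nat -> \bar R) (n : nat) :
  (forall j, (n <= j)%N -> u j = 0)%E -> (\sum_(j <oo) u j = \sum_(j < n) u j)%E.
Proof.
move=> un; apply: lim_near_cst => //; exists n => //= m nm.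
rewrite (big_cat_nat _ (n := n))//= big_mkord [X in (_ + X)%E]big1_seq ?adde0//.
by move=> j; rewrite mem_index_iota => /and3P[_ nj _]; exact: un.
Qed.

Section Lift.
Context {R : realType} {S : set nat} {hS : S !=set0}.
Local Notation X := (gap_shift S).
Local Notation Y := (renewal_base hS).
Local Notation sigma := (@gap_shift_map S).
Local Notation shift := (@base_shift_map S hS).
Local Notation code := (@renewal_code S hS).
Local Notation tau := (@return_time S hS).

Lemma code_measurable : measurable_fun setT code.
Proof.
apply: (cylindrical_fun (@gap_shift_cylindrical S)) => s.
apply: (@determined_set_measurable _ _ (size s)) => y z yz /=.
rewrite /cyl /= => <-; rewrite size_mkseq; apply/mkseq_agree/agree_sym.
by apply: agree_le (code_agree yz); exact: leqW (leq_one_position _ _).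
Qed.

Lemma orbit_measurable j : measurable_fun setT (fun y => iter j sigma (code y)).
Proof.
exact: (measurableT_comp (measurable_iter sigma_measurable j) code_measurable).
Qed.

Lemma return_time_measurable n : measurable (tau @^-1` [set n]).
Proof.
apply: (@determined_set_measurable _ _ 1) => y z yz /= <-.
by rewrite /return_time yz.
Qed.

Lemma return_time_gt_measurable j : measurable [set y | (j < tau y)%N].
Proof.
apply: (@determined_set_measurable _ _ 1) => y z yz /=.
by rewrite /return_time yz.
Qed.

Definition orbit_sum (f : X -> R) (y : Y) : R := \sum_(j < tau y) f (iter j sigma (code y)).

Lemma orbit_sum_measurable f : measurable_fun setT f -> measurable_fun setT (orbit_sum f).
Proof.
move=> mf; apply: (measurable_random_sum (u := fun j y => f (iter j sigma (code y)))).
  exact: return_time_measurable.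
by move=> j; apply: (measurableT_comp mf (orbit_measurable j)).
Qed.

(** The unnormalised lift: the base measure is carried along the orbit up to the
    return time, the [j]-th level of the tower lying over [j < tau]. *)
Lemma tower_measure (nu : probability Y R) : exists m : {measure set X -> \bar R},
  forall f : X -> R, measurable_fun setT f -> (forall x, 0 <= f x) ->
    (\int[m]_x (f x)%:E = \int[nu]_y (orbit_sum f y)%:E)%E.
Proof.
have ex j : exists m' : {measure set X -> \bar R}, forall A,
    m' A = nu ((fun y => iter j sigma (code y)) @^-1` A `&` [set y | (j < tau y)%N]).
  exact: transfer_measure (return_time_gt_measurable j) (orbit_measurable j).
have [m_ mE] := choice ex.
(* The [j]-th measure is the image of the base measure restricted to [j < tau]. *)
exists (mseries m_ 0) => f mf f0.
have mfe : measurable_fun setT (fun x => (f x)%:E) by exact/measurable_EFinP.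
rewrite ge0_integral_measure_series//; last by move=> x _; rewrite lee_fin.
pose u j (y : Y) : \bar R := ((fun y => (f (iter j sigma (code y)))%:E) \_ [set y | (j < tau y)%N]) y.
transitivity (\sum_(j <oo) \int[nu]_y u j y)%E.
  apply: eq_eseriesr => j _; rewrite -integral_mkcond.
  apply: (ge0_integral_transfer (return_time_gt_measurable j) (orbit_measurable j)) => //.
rewrite -integral_nneseries//.
- apply: eq_integral => y _; rewrite (@eseries_finite_support _ _ (tau y)).
    rewrite -sumEFin; apply: eq_bigr => j _; rewrite /u patchE mem_set//.
    exact: ltn_ord.
  by move=> j tj; rewrite /u patchE memNset//= ltnNge tj.
- move=> j; apply/(measurable_restrictT _ (return_time_gt_measurable j)).
  apply: measurable_funTS; apply/measurable_EFinP.
  exact: (measurableT_comp mf (orbit_measurable j)).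
- by move=> j y _; rewrite /u patchE; case: ifP => // _; rewrite lee_fin.
Qed.

Variables (p : S -> R).
Hypothesis p_gt0 : forall s, 0 < p s.
Variable nu : probability Y R.
Hypothesis nuP : bernoulli_measure p nu.
Variables (C0 rho : R).
Hypothesis rho01 : 0 < rho < 1.
Hypothesis p_le : forall s : S, p s <= C0 * rho ^+ val s.

Lemma return_time_measurable_fun : measurable_fun setT (fun y : Y => ((tau y)%:R : R)%:E).
Proof. exact: (measurable_first (fun n => n.+1%:R)). Qed.

Lemma mean_return_time_fin : (mean_return_time nu < +oo)%E.
Proof.
have [s1 [M [s10 M0 EM]]] := return_time_exp_moment p_gt0 nuP rho01 p_le.
have mE : measurable_fun setT (fun y : Y => (expR (s1 * (tau y)%:R))%:E).
  exact: (measurable_first (fun n => expR (s1 * n.+1%:R))).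
apply: (@le_lt_trans _ _ (s1^-1%:E * M%:E)%E); last by rewrite -EFinM ltry.
apply: le_trans (lee_wpmul2l _ EM); last by rewrite lee_fin invr_ge0 ltW.
rewrite -ge0_integralZl//; last by rewrite lee_fin invr_ge0 ltW.
apply: ge0_le_integral => //.
- exact: return_time_measurable_fun.
- by apply: emeasurable_funM; first exact: measurable_cst.
- move=> y _; rewrite -EFinM lee_fin ler_pdivlMl//.
  by apply: le_trans (expR_ge1Dx _); rewrite lerDr.
Qed.

Lemma mean_return_time_ge1 : (1 <= mean_return_time nu)%E.
Proof.
rewrite -[X in (X <= _)%E](probability_integral_cst nu 1%E).
apply: ge0_le_integral => //; first exact: return_time_measurable_fun.
by move=> y _; rewrite lee_fin ler1n.
Qed.

Lemma ge0_integral_base_shift (h : Y -> \bar R) : measurable_fun setT h ->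
  (forall y, 0 <= h y)%E -> (\int[nu]_y h (shift y) = \int[nu]_y h y)%E.
Proof.
move=> mh h0; apply/esym.
apply: (ge0_integral_transfer (phi := shift) (D := setT)) => //.
  exact: (iter_base_shift_measurable 1).
by move=> A mA; rewrite setIT; apply/esym; exact: bernoulli_invariant.
Qed.

(** Moving one step up the tower only exchanges the base with the level on which
    the orbit returns, and these have the same measure. *)
Lemma orbit_sum_sigma (f : X -> R) : measurable_fun setT f -> (forall x, 0 <= f x) ->
  (exists M, forall x, f x <= M) ->
  (\int[nu]_y (orbit_sum (fun x => f (sigma x)) y)%:E = \int[nu]_y (orbit_sum f y)%:E)%E.
Proof.
move=> mf f0 [M fM].
have ms : measurable_fun setT (fun x => f (sigma x)).
  exact: (measurableT_comp mf sigma_measurable).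
have mc : measurable_fun setT (fun y => (f (code y))%:E).
  by apply/measurable_EFinP; exact: (measurableT_comp mf code_measurable).
have os0 (g : X -> R) y : (forall x, 0 <= g x) -> (0 <= (orbit_sum g y)%:E)%E.
  by move=> g0; rewrite lee_fin; apply: sumr_ge0.
have mos (g : X -> R) : measurable_fun setT g -> measurable_fun setT (fun y => (orbit_sum g y)%:E).
  by move=> mg; apply/measurable_EFinP; exact: orbit_sum_measurable.
have e : (\int[nu]_y ((orbit_sum (fun x => f (sigma x)) y)%:E + (f (code y))%:E) =
    \int[nu]_y ((orbit_sum f y)%:E + (f (code (shift y)))%:E))%E.
  apply: eq_integral => y _; rewrite -!EFinD; congr EFin.
  have E n : \sum_(j < n) f (sigma (iter j sigma (code y))) + f (code y) =
      \sum_(j < n) f (iter j sigma (code y)) + f (iter n sigma (code y)).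
    elim: n => [|n IH]; first by rewrite !big_ord0.
    by rewrite !big_ord_recr /= addrAC IH.
  by rewrite -sigma_code; exact: E.
have fin : (\int[nu]_y (f (code y))%:E \is a fin_num)%E.
  rewrite ge0_fin_numE; last by apply: integral_ge0 => y _; rewrite lee_fin.
  apply: (@le_lt_trans _ _ M%:E); last exact: ltry.
  rewrite -[X in (_ <= X)%E](probability_integral_cst nu M%:E).
  by apply: ge0_le_integral => //; move=> y _; rewrite lee_fin.
have mcs : measurable_fun setT (fun y => (f (code (shift y)))%:E).
  exact: (measurableT_comp mc (iter_base_shift_measurable 1)).
move: e; rewrite !ge0_integralD//.
  rewrite (ge0_integral_base_shift (h := fun y => (f (code y))%:E))//.
    by move=> /(congr1 (fun z => z - \int[nu]_y (f (code y))%:E)%E); rewrite !addeK.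
  by move=> y; rewrite lee_fin.
all: try exact: mos.
all: try by move=> y _; rewrite lee_fin.
all: by move=> y _; apply: os0.
Qed.

(** The normalised tower measure. For a bounded function of arbitrary sign the formula
    follows from the nonnegative case by adding a constant. *)
Lemma lift_exists : exists mu : probability X R, is_lift nu mu.
Proof.
have [m mE] := tower_measure nu.
set T := mean_return_time nu; have Tfin := mean_return_time_fin; have T1 := mean_return_time_ge1.
have Tn : T \is a fin_num by rewrite ge0_fin_numE// (le_trans _ T1).
have T0 : 0 < fine T by rewrite -lte_fin fineK// (lt_le_trans _ T1).
have mT : (m setT = T)%E.
  rewrite -[m setT]mul1e -integral_cst// -[LHS]/(\int[m]_x (1%R%:E))%E.
  rewrite (mE (fun=> 1))//; apply: eq_integral => y _; congr EFin.
  by rewrite /orbit_sum sumr_const card_ord.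
pose mu : probability X R := mnormalize m (dirac point).
have muE A : (mu A = m A * (fine T)^-1%:E)%E.
  rewrite /mu /= /mnormalize mT; case: ifPn => // /orP[] /eqP T'.
    by move: T0; rewrite T' ltxx.
  by move: Tfin; rewrite -/T T'.
have V0 : 0 <= (fine T)^-1 by rewrite invr_ge0 ltW.
have muI (f : X -> R) : measurable_fun setT f -> (forall x, 0 <= f x) ->
    (\int[mu]_x (f x)%:E = (fine T)^-1%:E * \int[nu]_y (orbit_sum f y)%:E)%E.
  move=> mf f0; rewrite -mE//.
  rewrite (eq_measure_integral (mscale (NngNum V0) m)) => [|A mA _].
    apply: (etrans (ge0_integral_mscale m measurableT (NngNum V0) _ _)) => //.
      exact/measurable_EFinP.
    by move=> x _; rewrite lee_fin.
  by apply: (etrans (muE A)); exact: muleC.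
exists mu; split.
- exact: bernoulli_invariant p_gt0 nu nuP.
- exact: Tfin.
- move=> A mA.
  have mA' : measurable (sigma @^-1` A).
    by rewrite -[X in measurable X]setTI; exact: sigma_measurable.
  have ind (B : set X) : measurable B ->
      (mu B = (fine T)^-1%:E * \int[nu]_y (orbit_sum \1_B y)%:E)%E.
    move=> mB; have [mi _] := bmf_indic R mB.
    by rewrite -(muI _ mi)// integral_indic// setIT.
  rewrite !ind//; congr (_ * _)%E.
  have [mi _] := bmf_indic R mA.
  apply: (orbit_sum_sigma mi) => //.
  by exists 1 => x; rewrite indicE lern1 leq_b1.
move=> f mf [M fM]; rewrite -/T.
have os_le y : `|orbit_sum f y| <= M * (tau y)%:R.
  apply: le_trans (ler_norm_sum _ _ _) _.
  by apply: le_trans (ler_sum _ (fun i _ => fM _)) _; rewrite sumr_const card_ord mulr_natr.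
have itau : nu.-integrable setT (EFin \o (fun y : Y => (tau y)%:R)).
  apply/integrableP; split; first exact: return_time_measurable_fun.
  by under eq_integral do rewrite /= ger0_norm//.
have ios : nu.-integrable setT (EFin \o orbit_sum f).
  apply: (le_integrable _ _ _ (integrable_EFinZ M itau)) => //.
    by apply/measurable_EFinP; exact: orbit_sum_measurable.
  by move=> y _ /=; rewrite lee_fin; apply: le_trans (os_le y) (ler_norm _).
have fM0 x : 0 <= f x + M by have := fM x; rewrite ler_norml; lra.
have fbmf : bmf f by split=> //; exists M.
have cbmf := @bmf_cst _ X R M.
have := muI _ (measurable_funD mf (measurable_cst M)) fM0.
rewrite (_ : (\int[mu]_x (f x + M)%:E = \int[mu]_x (f x)%:E + M%:E)%E); last first.
  rewrite (integral_EFinD (g := fun=> M)) ?(probability_integral_cst mu M%:E)//.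
    exact: bmf_integrable.
  exact: bmf_integrable.
rewrite (_ : (\int[nu]_y (orbit_sum (fun x => f x + M) y)%:E =
    \int[nu]_y (orbit_sum f y)%:E + M%:E * T)%E); last first.
  rewrite -integral_EFinZ// -integral_EFinD//; last exact: integrable_EFinZ.
  apply: eq_integral => y _; congr EFin.
  by rewrite /orbit_sum big_split /= sumr_const card_ord mulr_natr.
have osn : (\int[nu]_y (orbit_sum f y)%:E \is a fin_num)%E by exact: integrable_fin_num.
have fn : (\int[mu]_x (f x)%:E \is a fin_num)%E by exact: integrable_fin_num (bmf_integrable mu fbmf).
rewrite -/(orbit_sum f _).
rewrite -(fineK osn) -(fineK fn) -(fineK Tn) -EFinM -!EFinD -!EFinM => -[] e.
congr EFin; rewrite fineK//.
have : (fine T)^-1 * (fine (\int[nu]_y (orbit_sum f y)%:E)%E + M * fine T) =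
   (fine T)^-1 * fine (\int[nu]_y (orbit_sum f y)%:E)%E + M.
  by rewrite mulrDr [M * _]mulrC mulKf// gt_eqF.
by rewrite -e => /addIr.
Qed.

End Lift.

(** * Gibbs bound for the lift *)

Section LiftGibbs.
Context {R : realType} {S : set nat} {hS : S !=set0}.
Local Notation X := (gap_shift S).
Local Notation Y := (renewal_base hS).
Local Notation sigma := (@gap_shift_map S).
Local Notation shift := (@base_shift_map S hS).
Local Notation gc := (@gap_coord S).
Local Notation code := (@renewal_code S hS).
Local Notation pos := (@one_position S hS).
Local Notation tau := (@return_time S hS).
Variables (phi : X -> R) (P lam c1 C0 : R) (lw : S -> R).
Local Notation p := (fun s : S => expR (lw s)).
Local Notation Sn := (birkhoff_sum sigma phi).
Hypothesis lam_gt0 : 0 < lam.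
Hypothesis phi_decomposition : forall (x : X) N a M (y : Y),
  (a + pos y M <= N)%N -> agree N (gc x) (block_seq a M y) ->
  `|Sn N x - N%:R * P - (\sum_(i < M) lw (y i) - (N - pos y M)%:R * lam)| <= c1.
Local Notation rho := (expR (- lam)).
Hypothesis p_le : forall s : S, p s <= C0 * rho ^+ val s.
Variable nu : probability Y R.
Hypothesis nuP : bernoulli_measure p nu.
Variable mu : probability X R.
Hypothesis muL : is_lift nu mu.

Let p_gt0 (s : S) : 0 < p s. Proof. exact: expR_gt0. Qed.

Definition word_cell N (x : X) : set X := [set z | agree N (gc x) (gc z)].

Lemma word_cell_measurable N x : measurable (word_cell N x).
Proof. by apply: (@gap_determined_measurable _ N) => z z' zz xz i iN; rewrite xz// zz. Qed.

(** Invariance allows to evaluate the lift on [sigma @^-1` A] instead of [A]. The orbit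
    points that count are then those strictly inside a block or at its end, which show
    a run of zeros before the next block starts afresh [code_shifted]. *)
Lemma lift_le_tower (A : set X) : measurable A ->
  (mu A <= \int[nu]_y (\sum_(j < tau y) \1_A (iter j.+1 sigma (code y)))%:E)%E.
Proof.
move=> mA; have [_ Tfin muI muF] := muL.
have T1 := mean_return_time_ge1 nu.
have mA' : measurable (sigma @^-1` A).
  by rewrite -[X in measurable X]setTI; exact: sigma_measurable.
have [mi bi] := bmf_indic R mA'.
have := muF _ mi bi; rewrite integral_indic// setIT => e2.
rewrite -(muI _ mA : mu (sigma @^-1` A) = mu A) (e2 : mu (sigma @^-1` A) = _).
set I := (\int[nu]_y _)%E; have I0 : (0 <= I)%E.
  by apply: integral_ge0 => y _; rewrite lee_fin; apply: sumr_ge0.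
rewrite gee_pMl//.
rewrite lee_fin invf_le1; first by rewrite -lee_fin fineK// ge0_fin_numE// (le_trans _ T1).
by rewrite -lte_fin fineK ?(lt_le_trans _ T1)// ge0_fin_numE// (le_trans _ T1).
Qed.

(** The constant of the geometric tail of the return time. *)
Definition tail_const : R := C0 / (1 - rho).

Local Notation D := tail_const.

Let rho01 : 0 < rho < 1. Proof. exact: exp_lam01. Qed.

Lemma tail_const_ge0 : 0 <= D.
Proof.
have /andP[_ r1] := rho01.
rewrite /tail_const; apply: divr_ge0; last by rewrite subr_ge0 ltW.
exact: (@decay_const_ge0 _ _ hS _ p_gt0 _ _ rho01 p_le).
Qed.
Local Notation D_ge0 := tail_const_ge0.

Let tail a : (nu [set y : Y | (a <= val (y 0%N))%N] <= (D * rho ^+ a)%:E)%E.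
Proof.
have := return_time_tail p_gt0 nuP rho01 p_le a.
by rewrite /tail_const mulrA mulrAC.
Qed.

(** Otherwise the symbol 1 starting the second block would fall among the [N] zeros. *)
Lemma visit_cell_zero N (x : X) (y : Y) j : agree N (gc x) (gc (zero_seq S)) ->
  (j < tau y)%N -> word_cell N x (iter j.+1 sigma (code y)) -> (N + j <= val (y 0%N))%N.
Proof.
move=> x0 jt xz; rewrite leqNgt; apply/negP => lt.
have jy : (j <= val (y 0%N))%N by [].
have rN : (tau y - j.+1 < N)%N by rewrite /return_time subSS ltn_subLR// addnC.
have := xz _ rN; rewrite code_shifted// leqnn subnn /= -{1}(one_position0 (shift y)) code_one.
by rewrite x0.
Qed.

(** The first symbol 1 of the cylinder, at position [a], is the start of the second
    block, which fixes the time of the visit. Matching the symbols 1 gives the next [M]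
    blocks, and the zeros at the end of the cylinder make the one after them long. *)
Lemma visit_cell (x : X) N a M (u y : Y) j :
  (a + pos u M < N)%N -> agree N (gc x) (block_seq a M u) -> (j < tau y)%N ->
  word_cell N x (iter j.+1 sigma (code y)) ->
  [/\ (j + a = val (y 0%N))%N, agree M u (shift y) &
      ((N - (a + pos u M)).-1 <= val (iter M shift (shift y) 0%N))%N].
Proof.
move=> LN xu jt xz; set q := pos u M in LN *.
pose r := (tau y - j.+1)%N.
have jy : (j <= val (y 0%N))%N by [].
have rE : r = (val (y 0%N) - j)%N by rewrite /r /return_time subSS.
have zE k : (k < N)%N -> block_seq a M u k = (r <= k)%N && gc (code (shift y)) (k - r).
  by move=> kN; rewrite -xu// xz// code_shifted.
have one0 (v : Y) : gc (code v) 0 by rewrite -(one_position0 v) code_one.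
have ra : r = a.
  apply/eqP; rewrite eqn_leq; apply/andP; split; rewrite leqNgt; apply/negP => lt.
    have aN : (a < N)%N by apply: leq_ltn_trans LN; exact: leq_addr.
    by have := zE a aN; rewrite /block_seq leqnn leq_addr subnn one0 [(r <= a)%N]leqNgt lt.
  have rN : (r < N)%N by apply: (ltn_trans lt); apply: leq_ltn_trans LN; exact: leq_addr.
  by have := zE r rN; rewrite /block_seq leqnn subnn one0 [(a <= r)%N]leqNgt lt.
have uy : agree M u (shift y).
  apply: code_agree_inv => i; rewrite ltnS -/q => iq.
  have aiN : (a + i < N)%N by apply: leq_ltn_trans LN; rewrite leq_add2l.
  by have := zE _ aiN; rewrite /block_seq ra leq_addr leq_add2l -/q iq addKn.
split=> //; first by rewrite -ra rE subnKC.
rewrite iter_base_shift add0n leqNgt; apply/negP => lt.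
have posM : pos (shift y) M = q by rewrite -(one_position_agree uy).
have kN : (a + pos (shift y) M.+1 < N)%N by rewrite one_positionS posM; lia.
have := zE _ kN; rewrite /block_seq ra leq_addr addKn code_one /= -/q.
rewrite leq_add2l one_positionS posM.
by have -> : ((q + val (shift y M)).+1 <= q)%N = false by lia.
Qed.

Lemma lift_cell_zero_le N (x : X) : agree N (gc x) (gc (zero_seq S)) ->
  (mu (word_cell N x) <= (D / (1 - rho) * rho ^+ N)%:E)%E.
Proof.
move=> x0; apply: le_trans (lift_le_tower (word_cell_measurable N x)) _.
pose h j (y : Y) : \bar R := ((N + j <= val (y 0%N))%N%:R : R)%:E.
have mh j : measurable_fun setT (h j).
  exact: (measurable_first (fun n => (N + j <= n)%N%:R)).
have mcell := word_cell_measurable N x.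
have [mi _] := bmf_indic R mcell.
apply: (@le_trans _ _ (\int[nu]_y \sum_(j <oo) h j y)%E).
  apply: ge0_le_integral => //.
  - by move=> y _; rewrite lee_fin; apply: sumr_ge0.
  - apply/measurable_EFinP.
    apply: (measurable_random_sum (u := fun j y => \1_(word_cell N x) (iter j.+1 sigma (code y)))).
      exact: return_time_measurable.
    by move=> j; exact: (measurableT_comp mi (orbit_measurable j.+1)).
  - by apply: ge0_emeasurable_sum => // j y _ _; rewrite lee_fin.
  move=> y _; rewrite (@eseries_finite_support _ _ (tau y)); last first.
    move=> j tj; rewrite /h; have -> : (N + j <= val (y 0%N))%N = false; last by [].
    by move: tj; rewrite /return_time; lia.
  rewrite /h sumEFin lee_fin; apply: ler_sum => j _; rewrite indicE ler_nat.
  case: (boolP (_ \in word_cell _ _)) => // /set_mem /(visit_cell_zero x0).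
  by move=> -> //; exact: ltn_ord.
rewrite integral_nneseries//; last by move=> j y _; rewrite lee_fin.
have r01 : 0 <= rho < 1 by rewrite expR_ge0; case/andP: rho01.
apply: (@le_trans _ _ (\sum_(j <oo) (D * rho ^+ N * rho ^+ j)%:E)%E).
  apply: lee_nneseries => j _; first by move=> _; apply: integral_ge0 => y _; rewrite lee_fin.
  rewrite -mulrA -exprD; apply: le_trans (tail (N + j)).
  have mB : measurable [set y : Y | (N + j <= val (y 0%N))%N].
    by apply: (@determined_set_measurable _ _ 1) => y z yz; rewrite /= yz.
  rewrite -[X in (_ <= nu X)%E]setIT -integral_indic//.
  apply: ge0_le_integral => //; first by move=> y _; rewrite lee_fin.
    exact/measurable_EFinP/measurable_indic.
  by move=> y _; rewrite lee_fin indicE mem_setE.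
apply: le_trans (geometric_series_le (a := 0) (C := D * rho ^+ N) (r := rho) _ r01 _ _ _) _ => //.
- by apply: mulr_ge0; [exact: D_ge0|apply: exprn_ge0; exact: expR_ge0].
- move=> n; apply: mulr_ge0; last by apply: exprn_ge0; exact: expR_ge0.
  by apply: mulr_ge0; [exact: D_ge0|apply: exprn_ge0; exact: expR_ge0].
- by rewrite lee_fin expr0 mul1r mulrAC.
Qed.

(** The three conditions found in [visit_cell] bear on distinct coordinates of the
    base, and are therefore independent. *)
Lemma lift_cell_le (x : X) N a M (u : Y) :
  (a + pos u M < N)%N -> agree N (gc x) (block_seq a M u) ->
  (mu (word_cell N x) <= (D * rho ^+ a * (expR (\sum_(i < M) lw (u i)) *
    (D * rho ^+ (N - (a + pos u M)).-1)))%:E)%E.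
Proof.
move=> LN xu; apply: le_trans (lift_le_tower (word_cell_measurable N x)) _.
set b := (N - _).-1.
have mcell := word_cell_measurable N x.
have [mi _] := bmf_indic R mcell.
pose w := mkseq (@base_coord S hS u) M.
pose B : set Y := [set y | (b <= val (y 0%N))%N].
have mB : measurable B.
  by apply: (@determined_set_measurable _ _ 1) => y z yz; rewrite /B /= yz.
pose E := iter (size w) shift @^-1` B `&` cyl (@base_coord S hS) w.
have mE : measurable E.
  apply: measurableI; last exact: measurable_cyl_base.
  exact: base_shift_iter_set_measurable.
pose g (y : Y) : \bar R := ((a <= val (y 0%N))%N%:R : R)%:E.
pose h (y : Y) : \bar R := (\1_E y : R)%:E.
have mh : measurable_fun setT h by exact/measurable_EFinP/measurable_indic.
have gdet : determined_by 1 g by move=> y z yz; rewrite /g yz.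
have mg := determined_fun_measurable gdet.
have g0 y : (0 <= g y)%E by rewrite lee_fin.
have h0 y : (0 <= h y)%E by rewrite lee_fin.
apply: (@le_trans _ _ (\int[nu]_y (g y * h (iter 1 shift y)))%E).
  apply: ge0_le_integral => //.
  - by move=> y _; rewrite lee_fin; apply: sumr_ge0.
  - apply/measurable_EFinP.
    apply: (measurable_random_sum (u := fun j y => \1_(word_cell N x) (iter j.+1 sigma (code y)))).
      exact: return_time_measurable.
    by move=> j; exact: (measurableT_comp mi (orbit_measurable j.+1)).
  - apply: emeasurable_funM => //.
    exact: (measurableT_comp mh (iter_base_shift_measurable 1)).
  move=> y _; rewrite /g /h -EFinM lee_fin /=.
  apply: (@le_trans _ _ (\sum_(j < tau y) ((j + a == val (y 0%N))%N%:R * \1_E (shift y)))).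
    apply: ler_sum => j _; rewrite indicE.
    case: (boolP (_ \in word_cell _ _)) => [/set_mem|_]; last by rewrite mulr_ge0.
    move=> /(visit_cell LN xu (ltn_ord j))[-> uy hb]; rewrite eqxx mul1r indicE mem_set//.
    split; first by rewrite /B /= size_mkseq.
    exact/cyl_mkseqP.
  rewrite -mulr_suml ler_wpM2r//.
  have [ay|ya] := leqP a (val (y 0%N)); last first.
    rewrite big1// => j _; suff -> : (j + a == val (y 0%N))%N = false by [].
    by apply/negbTE; rewrite neq_ltn orbC (leq_trans ya)// leq_addl.
  have jt : (val (y 0%N) - a < tau y)%N by rewrite /return_time ltnS leq_subr.
  rewrite (bigD1 (Ordinal jt))//= subnK// eqxx big1 ?addr0// => j.
  rewrite -val_eqE /= => jn; case: eqP => // e; exfalso.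
  by move/eqP: jn; apply; rewrite -e addnK.
rewrite (ge0_integral_independent p_gt0 nuP gdet)//.
have ig : (\int[nu]_y g y <= (D * rho ^+ a)%:E)%E.
  apply: le_trans (tail a).
  have mC : measurable [set y : Y | (a <= val (y 0%N))%N].
    by apply: (@determined_set_measurable _ _ 1) => y z yz; rewrite /= yz.
  rewrite -[X in (_ <= nu X)%E]setIT -integral_indic//.
  apply: ge0_le_integral => //.
    exact/measurable_EFinP/measurable_indic.
  by move=> y _; rewrite lee_fin indicE mem_setE.
have ih : (\int[nu]_y h y <= (expR (\sum_(i < M) lw (u i)) * (D * rho ^+ b))%:E)%E.
  have -> : (\int[nu]_y h y = (word_weight p w)%:E * nu B)%E.
    transitivity (nu E); first by rewrite integral_indic// setIT.
    have e := @bernoulli_restart R S hS p p_gt0 nu nuP w B mB.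
    exact: e.
  have -> : word_weight p w = expR (\sum_(i < M) lw (u i)).
    rewrite /word_weight big_map expR_sum.
    by rewrite -(big_mkord xpredT (fun i => expR (lw (u i)))) /index_iota subn0.
  rewrite [leRHS]EFinM; apply: lee_wpmul2l; first by rewrite lee_fin expR_ge0.
  exact: tail.
by rewrite EFinM; apply: lee_pmul => //; exact: integral_ge0.
Qed.

(** The upper half of the Gibbs property: the bounds for the two kinds of cylinders
    have the form of [phi_decomposition]. *)
Lemma lift_gibbs_upper : exists C : R, forall (x : X) N,
  (mu (word_cell N x) <= (expR (C + (Sn N x - N%:R * P)))%:E)%E.
Proof.
have /andP[r0 r1] := rho01.
pose K := D * D + D / (1 - rho) + 1.
have DD : 0 <= D * D := mulr_ge0 D_ge0 D_ge0.
have Dr : 0 <= D / (1 - rho) by apply: divr_ge0; [exact: D_ge0|rewrite subr_ge0 ltW].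
have K0 : 0 < K by rewrite /K; lra.
exists (ln K + lam + c1) => x N.
have rhoE n : rho ^+ n = expR (- (n%:R * lam)) by rewrite -expRM_natl mulrN.
have [a [M [u [h xu]]]] := @gap_shift_decomposition S hS x N.
have := phi_decomposition (block_length_le h) xu; rewrite ler_norml => /andP[dec _].
have bound (Q : R) : Q <= K * expR (lam + (\sum_(i < M) lw (u i) - (N - pos u M)%:R * lam)) ->
    Q <= expR (ln K + lam + c1 + (Sn N x - N%:R * P)).
  move=> /le_trans; apply.
  have -> : ln K + lam + c1 + (Sn N x - N%:R * P) = ln K + (lam + c1 + (Sn N x - N%:R * P)) by ring.
  rewrite (expRD (ln K)) lnK ?posrE// ler_pM2l// ler_expR.
  by move: dec; lra.
case: h => [[M0 aN]|LN].
  have x0 : agree N (gc x) (gc (zero_seq S)).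
    by move=> i iN; rewrite xu// /block_seq aN leqNgt iN.
  apply: le_trans (lift_cell_zero_le x0) _; rewrite lee_fin; apply: bound.
  rewrite M0 big_ord0 one_position0 subn0 sub0r rhoE; apply: ler_pM => //.
  - by rewrite /K; lra.
  - by rewrite ler_expR lerDr ltW.
apply: le_trans (lift_cell_le LN xu) _; rewrite lee_fin; apply: bound.
set b := (N - (a + pos u M)).-1.
have Nq : (N - pos u M)%N = (a + b.+1)%N by rewrite /b; lia.
rewrite Nq !rhoE natrD -natr1.
rewrite [leLHS](_ : _ = D * D * expR (lam + (\sum_(i < M) lw (u i) - (a%:R + (b%:R + 1)) * lam))).
  by rewrite ler_pM2r ?expR_gt0// /K; lra.
have -> : lam + (\sum_(i < M) lw (u i) - (a%:R + (b%:R + 1)) * lam) =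
   - (a%:R * lam) + (\sum_(i < M) lw (u i) + (- (b%:R * lam))) by ring.
by rewrite !expRD; ring.
Qed.

End LiftGibbs.

(** * Free energy and equilibrium states *)

(** The entropies of the joins and the logarithms of the separated sums are both
    estimated in this form. *)
Lemma cvg_growth_rate (R : realType) (v : nat -> R) (a c : R) :
  (forall n, n%:R * a - c <= v n) ->
  (forall eta, 0 < eta -> exists b, forall n, v n <= n%:R * (a + eta) + b) ->
  v n / n%:R @[n --> \oo] --> a.
Proof.
move=> lo up; apply/cvgrPdist_le => e e0.
have e20 : 0 < e / 2 by rewrite divr_gt0.
have [b hb] := up _ e20.
have [N1 _ hN1] := nbhs_infty_gtr (`|c| / e).
have [N2 _ hN2] := nbhs_infty_gtr (`|b| / (e / 2)).
exists (maxn 1 (maxn N1 N2)) => // n; rewrite /= !geq_max => /and3P[n1 nN1 nN2].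
have n0 : 0 < n%:R :> R by rewrite ltr0n.
have hc := hN1 n nN1; have hb2 := hN2 n nN2; have ln := lo n; have un := hb n.
rewrite /= ltr_pdivrMr// in hc; rewrite /= ltr_pdivrMr// in hb2.
have c1 := ler_norm c; have b1 := ler_norm b.
rewrite ler_norml; apply/andP; split.
  suff : v n / n%:R <= a + e by move=> h; rewrite lerNl opprB lerBlDl.
  rewrite ler_pdivrMr//; apply: le_trans un _.
  have -> : n%:R * (a + e / 2) + b = n%:R * a + (n%:R * (e / 2) + b) by ring.
  have -> : (a + e) * n%:R = n%:R * a + (n%:R * (e / 2) + n%:R * (e / 2)) by lra.
  by rewrite !lerD2l (le_trans b1)// ltW.
rewrite lerBlDr -lerBlDl ler_pdivlMr//; apply: le_trans ln.
have -> : (a - e) * n%:R = n%:R * a - n%:R * e by ring.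
by rewrite lerD2l lerN2 (le_trans c1)// ltW.
Qed.

(** Divide by [t], for both signs of [t]. *)
Lemma quadratic_bound_eq0 (R : realType) (m C t0 : R) : 0 <= C -> 0 < t0 ->
  (forall t, `|t| <= t0 -> t * m <= C * t ^+ 2) -> m = 0.
Proof.
move=> C0 t00 h; apply/eqP; apply: contraT => m0.
have nm : 0 < `|m| by rewrite normr_gt0.
have C1 : 0 < 2 * (C + 1) by rewrite mulr_gt0//; lra.
pose t1 := Num.min t0 (`|m| / (2 * (C + 1))).
have t10 : 0 < t1 by rewrite lt_min t00 divr_gt0.
have t1le : t1 <= `|m| / (2 * (C + 1)) by rewrite ge_min lexx orbT.
have t1t0 : t1 <= t0 by rewrite ge_min lexx.
have : t1 * `|m| <= C * t1 ^+ 2.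
  have [ms|ms] := leP 0 m.
    by rewrite (ger0_norm ms); apply: (h t1); rewrite ger0_norm// ltW.
  have := h (- t1); rewrite normrN gtr0_norm// sqrrN mulNr => /(_ t1t0).
  by rewrite (ltr0_norm ms) mulrN.
rewrite expr2 mulrCA ler_pM2l// => mC.
have : C * t1 <= C * (`|m| / (2 * (C + 1))) by exact: ler_wpM2l.
have : C * (`|m| / (2 * (C + 1))) < `|m|.
  by rewrite mulrA ltr_pdivrMr//; nra.
by lra.
Qed.

Section Equilibrium.
Context {R : realType} {S : set nat}.
Local Notation X := (gap_shift S).
Local Notation sigma := (@gap_shift_map S).
Local Notation gc := (@gap_coord S).
Local Notation Sn := (birkhoff_sum sigma).
Variables (phi : X -> R) (P C : R).
Hypothesis phi_bmf : bmf phi.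
Hypothesis weights : word_weight_bound phi P (fun=> 0) C 0.

(** The case [t = 0] of [partition_entropy_le]. *)
Lemma entropy_mean_le (mu : probability X R) k (xi : 'I_k -> set X) :
  invariant_measure sigma mu -> finite_partition xi ->
  partition_entropy sigma mu xi <= P - mean mu phi.
Proof.
move=> muI xiP.
have := @partition_entropy_le R S phi P phi_bmf (fun=> 0) 0 _ _ C 0 weights mu muI k xi xiP.
by rewrite !mul0r expr0n mulr0 addr0 subr0; apply => // s; rewrite normr0.
Qed.

Lemma free_energy_le (mu : probability X R) : invariant_measure sigma mu ->
  (free_energy sigma phi mu <= P%:E)%E.
Proof.
move=> muI; rewrite /free_energy mean_integral//.
rewrite -leeBrDr// -EFinB; apply: ge_ereal_sup => _ [k [xi [xiP ->]]].
by rewrite lee_fin entropy_mean_le.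
Qed.

Definition coord_index (x : X) : 'I_2 := inord (gc x 0%N).
(** Its iterated joins are the partitions into words. *)
Definition coord_partition (i : 'I_2) : set X := coord_index @^-1` [set i].

Lemma coord_partition_finite : finite_partition coord_partition.
Proof.
split.
- move=> i; apply: (@gap_determined_measurable _ 1) => x z xz /= <-.
  by rewrite /coord_partition /coord_index /= xz.
- apply/trivIsetP => i j _ _ /eqP ij; rewrite -subset0 => x [xi xj].
  by apply: ij; rewrite -xi -xj.
- by rewrite eqEsubset; split=> // x _; exists (coord_index x).
Qed.

Lemma coord_itinerary n (x z : X) :
  ([ffun i : 'I_n => coord_index (iter i sigma x)] =
   [ffun i : 'I_n => coord_index (iter i sigma z)]) <-> agree n (gc x) (gc z).
Proof.
split=> [/ffunP e i iN|xz].
  have := e (Ordinal iN); rewrite !ffunE /coord_index /= !gap_coord_iter add0n.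
  by move=> /(congr1 val); rewrite /= !inordK//; [do 2 case: (gc _ i)|case: (gc z i)|case: (gc x i)].
by apply/ffunP => i; rewrite !ffunE /coord_index !gap_coord_iter add0n xz.
Qed.

Variable mu : probability X R.
Hypothesis muI : invariant_measure sigma mu.
Variable C' : R.
Hypothesis gibbs : forall (x : X) N,
  (mu (word_cell N x) <= (expR (C' + (Sn phi N x - N%:R * P)))%:E)%E.

(** The Gibbs bound makes every word of positive measure carry at least the
    information [N%:R * P - Sn N x], up to a constant. *)
Lemma gibbs_join_entropy_ge n :
  n%:R * (P - mean mu phi) - C' <= join_entropy sigma mu coord_partition n.
Proof.
pose c (x : X) := [ffun i : 'I_n => coord_index (iter i sigma x)].
have hidx (i : 'I_2) : coord_index @^-1` [set i] = coord_partition i by [].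
have HE : join_entropy sigma mu coord_partition n = entropy_of mu c.
  rewrite /join_entropy /entropy_of; congr (- _); apply: eq_bigr => w _.
  by rewrite (join_cellE _ _ hidx).
have mc w : measurable (c @^-1` [set w]).
  exact: (itinerary_measurable coord_partition_finite w hidx sigma_measurable).
pose pw w := fine (mu (c @^-1` [set w])).
have [_ [B phiB]] := phi_bmf.
(* A word of measure zero may contain points; the value of [F] there only has to bound
   the Birkhoff sum from below, as it is multiplied by that measure. *)
pose F w := if pw w == 0 then - (n%:R * B) else ln (pw w) + (n%:R * P - C').
have cellE x : c @^-1` [set c x] = word_cell n x.
  rewrite eqEsubset; split=> z h.
    by have /coord_itinerary/agree_sym := (h : c z = c x).
  by apply: (coord_itinerary n z x).2; exact: agree_sym.
have Fle x : F (c x) <= Sn phi n x.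
  rewrite /F; case: ifPn => [_|p0].
    by have := birkhoff_sum_le sigma n x phiB; rewrite ler_norml => /andP[].
  have pc0 : 0 < pw (c x) by rewrite lt_neqAle eq_sym p0 fine_probability_ge0.
  have : pw (c x) <= expR (C' + (Sn phi n x - n%:R * P)).
    rewrite -lee_fin /pw fineK ?fin_num_measure// cellE; exact: gibbs.
  by rewrite -ler_ln ?posrE ?expR_gt0// expRK; lra.
have bS : bmf (Sn phi n) by exact: (bmf_birkhoff sigma_measurable n phi_bmf).
have := le_mean mu (bmf_finite_valued mc F) bS Fle.
rewrite (mean_birkhoff sigma_measurable muI)// (mean_finite_valued mu mc F).
have one : \sum_w pw w = 1.
  have := mean_finite_valued mu mc (fun=> 1); rewrite mean_cst => ->.
  by apply: eq_bigr => w _; rewrite mul1r.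
have -> : \sum_w F w * fine (mu (c @^-1` [set w])) =
    \sum_w (pw w * ln (pw w) + (n%:R * P - C') * pw w).
  apply: eq_bigr => w _; rewrite -/(pw w) /F; case: eqP => [->|_]; first by rewrite !mulr0 mul0r addr0.
  by rewrite mulrDl [ln _ * _]mulrC.
rewrite big_split /= -mulr_sumr one mulr1 HE /entropy_of -/pw; lra.
Qed.

Lemma gibbs_free_energy : free_energy sigma phi mu = P%:E.
Proof.
apply/eqP; rewrite eq_le free_energy_le//=.
have pe : partition_entropy sigma mu coord_partition = P - mean mu phi.
  apply: cvg_lim => //; apply: (cvg_growth_rate gibbs_join_entropy_ge) => eta eta0.
  have [|//|b hb] := @join_entropy_le R S phi P phi_bmf (fun=> 0) 0 _ _ C 0 weights mu muI
    2 coord_partition eta coord_partition_finite eta0.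
    by move=> s; rewrite normr0.
  by exists b => n; apply: le_trans (hb n) _; rewrite !mul0r expr0n mulr0 addr0 subr0.
rewrite /free_energy mean_integral// -leeBlDr// -EFinB -pe.
by apply: ereal_sup_ubound; exists 2%N, coord_partition; split=> //; exact: coord_partition_finite.
Qed.

Lemma free_energy_sup : ereal_sup [set free_energy sigma phi nu | nu in
  [set nu : probability X R | invariant_measure sigma nu]] = P%:E.
Proof.
apply/eqP; rewrite eq_le; apply/andP; split.
  by apply: ge_ereal_sup => _ [nu nuI <-]; exact: free_energy_le.
by apply: ereal_sup_ubound; exists mu => //; exact: gibbs_free_energy.
Qed.

Lemma gibbs_equilibrium_state : equilibrium_state sigma phi mu.
Proof. by split=> //; rewrite gibbs_free_energy free_energy_sup. Qed.

(** Perturbing the potential by [t] times [f] changes the entropy bound by a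
    quantity of second order in [t] only, since [f] has mean zero for the lift;
    an equilibrium state attains the bound at [t = 0], and so the linear term
    [t * mean mu' f] has to vanish. *)
Lemma equilibrium_mean_eq0 (mu' : probability X R) (f : (nat -> bool) -> R) (K : nat) (C1 t0 : R) :
  (forall s, `|f s| <= 1) -> (forall s s', agree K s s' -> f s = f s') ->
  0 <= C1 -> 0 < t0 -> (forall t, `|t| <= t0 -> word_weight_bound phi P f C1 t) ->
  equilibrium_state sigma phi mu' -> mean mu' (fun x => f (gc x)) = 0.
Proof.
move=> f1 fdet C10 t00 hw [mu'I]; rewrite free_energy_sup => eq.
apply: (quadratic_bound_eq0 C10 t00) => t tt0.
set m := mean mu' _.
have : (P%:E <= (P - t * m + C1 * t ^+ 2)%:E)%E.
  rewrite -eq /free_energy mean_integral// -leeBrDr// -EFinB.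
  apply: ge_ereal_sup => _ [k [xi [xiP ->]]]; rewrite lee_fin.
  apply: le_trans (partition_entropy_le phi_bmf f1 fdet (hw t tt0) mu'I xiP) _.
  by rewrite -/m; lra.
by rewrite lee_fin; lra.
Qed.

End Equilibrium.

(** * Topological pressure *)

Section Pressure.
Context {R : realType} {S : set nat}.
Local Notation X := (gap_shift S).
Local Notation sigma := (@gap_shift_map S).
Local Notation gc := (@gap_coord S).
Local Notation Sn := (birkhoff_sum sigma).
Variables (theta : R) (phi : X -> R) (P C : R).
Hypothesis theta01 : 0 < theta < 1.
Hypothesis phi_bmf : bmf phi.
Hypothesis weights : word_weight_bound phi P (fun=> 0) C 0.
Local Notation sep_sum := (separated_sum (dtheta theta S) sigma phi).

(** Points of a separated set carry distinct words of a slightly greater length. *)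
Lemma separated_word_inj n m (eps : R) (E : set X) : theta ^+ m <= eps -> 0 < eps ->
  Defs.separated (dtheta theta S) sigma n eps E ->
  forall x z, E x -> E z -> word (n + m) (gc x) = word (n + m) (gc z) -> x = z.
Proof.
move=> tm e0 sE x z Ex Ez /word_eqP xz; apply: contrapT => nxz.
have := sE x z Ex Ez nxz; rewrite ltNge => /negP; apply.
apply: bigmax_le => [|j _]; first exact: ltW.
apply: le_trans tm; apply: (dtheta_agree_le theta01); apply: agree_iter_sigma.
by apply: agree_le xz; rewrite leq_add2r ltnW.
Qed.

(** The terms of a separated sum belong to distinct words and are dominated by the
    weights of these. *)
Lemma separated_sum_le (eps eta : R) : 0 < eps -> 0 < eta ->
  exists b : R, forall n, (sep_sum n eps <= (expR (n%:R * (P + eta) + b))%:E)%E.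
Proof.
have /andP[th0 th1] := theta01; move=> e0 eta0.
have [m tm] : exists m, theta ^+ m <= eps.
  have : (fun n => theta ^+ n) @ \oo --> (0 : R).
    by apply: cvg_expr; rewrite gtr0_norm.
  move/cvgrPdist_le => /(_ eps e0) [m _ /(_ m (leqnn _))]; rewrite /= sub0r normrN => h.
  by exists m; exact: le_trans (ler_norm _) h.
have [_ [B phiB]] := phi_bmf.
(* [K1] makes [N.+1%:R ^+ 2 <= K1 * expR (eta * N.+1%:R)]. *)
pose K1 := 2 / eta ^+ 2; have K10 : 0 < K1 by rewrite divr_gt0// exprn_gt0.
pose b := m%:R * B + m%:R * P + C + ln K1 + eta * m.+1%:R + C.
exists b => n; apply: ge_ereal_sup => _ [E [finE sE] <-]; rewrite lee_fin.
set N := (n + m)%N; have [V [V0 VZ Vlow]] := weights N.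
rewrite fsbig_finite//=.
pose s := [seq word N (gc x) | x <- finmap.enum_fset (fset_set E)].
have us : uniq s.
  rewrite map_inj_in_uniq ?finmap.fset_uniq// => x z.
  by rewrite !in_fset_set// => /set_mem Ex /set_mem Ez; exact: (separated_word_inj tm e0 sE).
have VS : \sum_(w <- s) V w <= \sum_w V w.
  rewrite big_uniq//= [leRHS](bigID (mem s))/= lerDl; apply: sumr_ge0 => w _; exact: V0.
have le1 x : expR (Sn phi n x) <=
    expR (m%:R * B + N%:R * P + C) * V (word N (gc x)).
  have := Vlow x; rewrite mul0r addr0 => h.
  rewrite expRD -mulrA; apply: le_trans (ler_wpM2l (expR_ge0 _) h).
  rewrite -expRD ler_expR /N birkhoff_sumD.
  by have := birkhoff_sum_le sigma m (iter n sigma x) phiB; rewrite ler_norml; lra.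
apply: le_trans (ler_sum _ (fun x _ => le1 x)) _; rewrite -mulr_sumr.
rewrite -(big_map (fun x => word N (gc x)) xpredT V) -/s.
apply: le_trans (ler_wpM2l (expR_ge0 _) (le_trans VS VZ)) _.
have h2 : N.+1%:R ^+ 2 <= K1 * expR (eta * N.+1%:R).
  rewrite /K1 mulrAC ler_pdivlMr ?exprn_gt0//.
  have := @expR_ge1Dxn R (eta * N.+1%:R) 1; rewrite mulr_ge0 ?(ltW eta0)// => /(_ isT).
  have -> : (1.+1)`!%:R = 2 :> R by [].
  by rewrite exprMn; lra.
apply: le_trans (ler_wpM2l (expR_ge0 _) (ler_wpM2r (expR_ge0 _) h2)) _.
rewrite -{1}(lnK K10) -!expRD ler_expR expr0n mulr0 mulr0 addr0 /b.
have -> : N.+1%:R = n%:R + m.+1%:R :> R by rewrite -natrD addnS.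
by rewrite /N natrD; lra.
Qed.

Variable mu : probability X R.
Variable C' : R.
Hypothesis gibbs : forall (x : X) N,
  (mu (word_cell N x) <= (expR (C' + (Sn phi N x - N%:R * P)))%:E)%E.

(** One point for each word of length [n] makes a separated set, and by the Gibbs
    bound the masses of these words, which add up to [1], are controlled by the
    terms of its separated sum. *)
Lemma separated_sum_ge n (eps : R) : 0 < eps < 1 ->
  ((expR (n%:R * P - C'))%:E <= sep_sum n eps)%E.
Proof.
move=> /andP[e0 e1]; pose W := {ffun 'I_n -> bool}.
pose rep (w : W) : X :=
  if pselect (exists x, word n (gc x) = w) is left h then projT1 (cid h) else zero_seq S.
pose realized (w : W) := `[< exists x, word n (gc x) = w >].
have repK w : realized w -> word n (gc (rep w)) = w.
  by move=> /asboolP h; rewrite /rep; case: pselect => [h'|//]; case: (cid h').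
pose s := [seq rep w | w <- enum realized].
have us : uniq s.
  rewrite map_inj_in_uniq ?enum_uniq// => w w'; rewrite !mem_enum => rw rw' e.
  by rewrite -(repK w)// -(repK w')// e.
have sepS : Defs.separated (dtheta theta S) sigma n eps [set` s].
  move=> x z /= /mapP[w + ->] /mapP[w' + ->]; rewrite !mem_enum => rw rw' ne.
  have : ~ agree n (gc (rep w)) (gc (rep w')).
    by move/word_eqP; rewrite !repK// => e; apply: ne; rewrite e.
  move=> /existsNP[i /not_implyP[iN ni]].
  (* Moved to time [i], the two points differ at once and have distance 1. *)
  apply: lt_le_trans (le_bigmax _ _ (Ordinal iN)) => /=; rewrite /dtheta.
  case: pselect => [h|[]]; last first.
    by exists 0%N; apply/eqP; rewrite -!/(gc _ _) !gap_coord_iter !add0n.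
  case: ex_minnP => k _ /(_ 0%N); rewrite leqn0 => h0.
  suff /eqP -> : k == 0%N by rewrite expr0.
  by apply: h0; apply/eqP; rewrite -!/(gc _ _) !gap_coord_iter !add0n.
apply: (@le_trans _ _ (\sum_(x \in [set` s]) expR (Sn phi n x))%:E); last first.
  by apply: ereal_sup_ubound; exists [set` s] => //; split=> //; exact: finite_seq.
rewrite -fsbig_seq// big_map big_enum /= lee_fin.
have mc (w : W) := @word_measurable S n w.
have one : \sum_(w : W) fine (mu ((fun x : X => word n (gc x)) @^-1` [set w])) = 1.
  have := mean_finite_valued mu mc (fun=> 1); rewrite mean_cst => ->.
  by apply: eq_bigr => w _; rewrite mul1r.
rewrite -[leLHS]mulr1 -[X in _ * X <= _]one (bigID realized)/= [X in _ * (_ + X)]big1 ?addr0 => [|w nw]; last first.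
  rewrite (_ : _ @^-1` _ = set0) ?measure0// -subset0 => x /= xw.
  by move/negP: nw; apply; apply/asboolP; exists x.
rewrite mulr_sumr; apply: ler_sum => w rw.
rewrite -ler_pdivlMl ?expR_gt0// -expRN -expRD -lee_fin fineK ?fin_num_measure//.
have -> : (fun x : X => word n (gc x)) @^-1` [set w] = word_cell n (rep w).
  rewrite eqEsubset; split=> x /=.
    by move=> xw; apply/word_eqP; rewrite repK.
  by move/word_eqP; rewrite repK.
apply: le_trans (gibbs _ _) _; rewrite lee_fin ler_expR; lra.
Qed.

(** For every [eps] below 1 the growth rate of the separated sums is already [P]. *)
Lemma topological_pressureE : topological_pressure (dtheta theta S) sigma phi = P%:E.
Proof.
rewrite /topological_pressure; apply: lim_near_cst => //.
near=> eps.
have e0 : 0 < eps by near: eps; exact: nbhs_right_gt.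
have e1 : eps < 1 by near: eps; apply: nbhs_right_lt.
have e01 : 0 < eps < 1 by rewrite e0.
have fin n : sep_sum n eps \is a fin_num.
  have [b hb] := separated_sum_le e0 ltr01.
  rewrite fin_numElt (lt_le_trans _ (separated_sum_ge n e01)) ?ltNyr//=.
  by rewrite (le_lt_trans (hb n)) ?ltry.
pose v n := fine (sep_sum n eps).
have vE n : sep_sum n eps = (v n)%:E by rewrite /v fineK.
have lo n : expR (n%:R * P - C') <= v n by rewrite -lee_fin -vE separated_sum_ge.
have v0 n : 0 < v n by exact: lt_le_trans (expR_gt0 _) (lo n).
have cv : ln (v n) / n%:R @[n --> \oo] --> P.
  apply: (@cvg_growth_rate _ _ _ C') => [n|eta eta0].
    by rewrite -ler_expR lnK ?posrE.
  have [b hb] := separated_sum_le e0 eta0; exists b => n.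
  by rewrite -ler_expR lnK ?posrE// -lee_fin -vE.
have -> : (fun n : nat => ((n%:R^-1)%:E * lne (sep_sum n eps))%E) = EFin \o (fun n => ln (v n) / n%:R).
  by apply/funext => n /=; rewrite vE lne_EFin// -EFinM mulrC.
have cE : (EFin \o (fun n => ln (v n) / n%:R)) @ \oo --> P%:E by apply: cvg_EFin => //; near=> n.
rewrite is_cvg_limn_esupE; last by apply/cvg_ex; exists P%:E.
exact: cvg_lim cE.
Unshelve. all: by end_near. Qed.

End Pressure.

(** * The lift as the unique equilibrium state *)

Section LiftEquilibrium.
Context {R : realType} {S : set nat} {hS : S !=set0}.
Local Notation X := (gap_shift S).
Local Notation Y := (renewal_base hS).
Local Notation sigma := (@gap_shift_map S).
Local Notation gc := (@gap_coord S).
Local Notation pos := (@one_position S hS).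
Variables (phi : X -> R) (P lam c1 C0 : R) (lw : S -> R).
Local Notation p := (fun s : S => expR (lw s)).
Local Notation Sn := (birkhoff_sum sigma phi).
Hypothesis phi_bmf : bmf phi.
Hypothesis lam_gt0 : 0 < lam.
Hypothesis phi_decomposition : forall (x : X) N a M (y : Y),
  (a + pos y M <= N)%N -> agree N (gc x) (block_seq a M y) ->
  `|Sn N x - N%:R * P - (\sum_(i < M) lw (y i) - (N - pos y M)%:R * lam)| <= c1.
Hypothesis p_le : forall s : S, p s <= C0 * expR (- lam) ^+ val s.
Variable nu : probability Y R.
Hypothesis nuP : bernoulli_measure p nu.
Variable mu : probability X R.
Hypothesis muL : is_lift nu mu.

Lemma unperturbed_weights : exists C, word_weight_bound phi P (fun=> 0) C 0.
Proof.
have f1 (s : nat -> bool) : `|0 : R| <= 1 by rewrite normr0.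
have fdet s s' : agree 0 s s' -> (fun _ : nat -> bool => 0 : R) s = (fun=> 0) s' by [].
have fm : (\int[nu]_y (@induced_sum R S hS (fun=> 0) y)%:E = 0)%E.
  by apply: integral0_eq => y _; rewrite /induced_sum /fsum big1.
have [C [t0 [_ t00 hC]]] := word_weights lam_gt0 phi_decomposition p_le nuP f1 fdet fm.
by exists C; apply: hC; rewrite normr0 ltW.
Qed.

(** The formula for the lift, read backwards. *)
Lemma induced_sum_mean (f : (nat -> bool) -> R) (K : nat) :
  (forall s, `|f s| <= 1) -> (forall s s', agree K s s' -> f s = f s') ->
  mean mu (fun x => f (gc x)) = 0 -> (\int[nu]_y (@induced_sum R S hS f y)%:E = 0)%E.
Proof.
move=> f1 fdet fm; have [_ Tfin _ muF] := muL.
have T1 := mean_return_time_ge1 nu.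
have fb : bmf (fun x : X => f (gc x)) := bmf_determined fdet f1.
have [mf bf] := fb; have := muF _ mf bf; rewrite (mean_integral mu fb) fm => /esym/eqP.
rewrite mule_eq0 => /orP[|/eqP h].
  have Tn : mean_return_time nu \is a fin_num by rewrite ge0_fin_numE// (le_trans _ T1).
  rewrite eqe invr_eq0 => /eqP e; exfalso; move: T1.
  by rewrite -(fineK Tn) e lee_fin ler10.
by rewrite -[RHS]h; apply: eq_integral => y _; rewrite /induced_sum fsum_birkhoff.
Qed.

Lemma lift_equilibrium_state : equilibrium_state sigma phi mu.
Proof.
have [C hC] := unperturbed_weights; have [_ _ muI _] := muL.
have [C' gibbs] := lift_gibbs_upper lam_gt0 phi_decomposition p_le nuP muL.
exact: (gibbs_equilibrium_state phi_bmf hC muI gibbs).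
Qed.

Lemma lift_pressure (theta : R) : 0 < theta < 1 ->
  topological_pressure (dtheta theta S) sigma phi = P%:E.
Proof.
move=> theta01; have [C hC] := unperturbed_weights.
have [C' gibbs] := lift_gibbs_upper lam_gt0 phi_decomposition p_le nuP muL.
exact: (topological_pressureE theta01 phi_bmf hC gibbs).
Qed.

(** Centred indicators of cylinders have mean zero for every equilibrium state. *)
Lemma equilibrium_state_unique (mu' : probability X R) :
  equilibrium_state sigma phi mu' -> forall A, measurable A -> mu' A = mu A.
Proof.
move=> eq'; have [C hC] := unperturbed_weights; have [_ _ muI _] := muL.
have [C' gibbs] := lift_gibbs_upper lam_gt0 phi_decomposition p_le nuP muL.
apply: (cylindrical_unique (@gap_shift_cylindrical S)) => [|s].
  by apply: le_lt_trans (ltry 1); rewrite probability_le1.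
have mcyl : measurable (cyl gc s) := (gap_shift_cylindrical S).1 s.
set q := fine (mu (cyl gc s)).
have q0 : 0 <= q by exact: fine_probability_ge0.
have q1 : q <= 1 by exact: fine_probability_le1.
pose f (u : nat -> bool) : R := (mkseq u (size s) == s)%:R + - q.
have f1 u : `|f u| <= 1 by rewrite /f ler_norml; case: (_ == _) => /=; lra.
have fdet u u' : agree (size s) u u' -> f u = f u'.
  by move=> /mkseq_agree e; rewrite /f e.
have fE : (fun x : X => f (gc x)) = (fun x => \1_(cyl gc s) x + - q).
  apply/funext => x; rewrite /f indicE; congr ((nat_of_bool _)%:R + _).
  by apply/idP/idP => [/eqP e|/set_mem e]; [exact: mem_set|exact/eqP].
have meanE (m : probability X R) : mean m (fun x => f (gc x)) = fine (m (cyl gc s)) - q.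
  rewrite fE meanD ?mean_cst ?mean_indic//; [exact: bmf_indic|exact: bmf_cst].
have fmu : mean mu (fun x => f (gc x)) = 0 by rewrite meanE subrr.
have [C1 [t0 [C10 t00 hw]]] := word_weights lam_gt0 phi_decomposition p_le nuP
  f1 fdet (induced_sum_mean f1 fdet fmu).
have := equilibrium_mean_eq0 phi_bmf hC muI gibbs f1 fdet C10 t00 hw eq'.
rewrite meanE => /eqP; rewrite subr_eq0 => /eqP e.
by rewrite -[LHS]fineK ?fin_num_measure// -[RHS]fineK ?fin_num_measure// e.
Qed.

End LiftEquilibrium.

Theorem proposition4p2 (R : realType) (S : set nat) (hS : S !=set0)
    (theta : R) (htheta : 0 < theta < 1)
    (phi : gap_shift S -> R)
    (hphi : holder_space (dtheta theta S) phi)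
    (psi : S -> R) (hrenewal : renewal_type hS phi psi)
    (P : R)
    (hP : (\esum_(n in [set: S])
             (expR (psi n - P * (val n).+1%:R))%:E = 1)%E)
    (hPzero : phi (zero_seq S) < P) :
  exists (nu : probability (renewal_base hS) R)
         (mu : probability (gap_shift S) R),
    [/\ bernoulli_measure (fun n : S => expR (psi n - P * (val n).+1%:R)) nu,
        is_lift nu mu,
        equilibrium_state (@gap_shift_map S) phi mu,
        (forall mu' : probability (gap_shift S) R,
           equilibrium_state (@gap_shift_map S) phi mu' ->
           forall A : set (gap_shift S), measurable A -> mu' A = mu A) &
        topological_pressure (dtheta theta S) (@gap_shift_map S) phi
        = P%:E].
Proof.
have [B [H [B0 H0 phiB phiH]]] := holder_space_bounds htheta hS hphi.
pose lam := P - phi (zero_seq S).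
have lam0 : 0 < lam by rewrite subr_gt0.
have mphi := phi_measurable htheta phiH.
have phib : bmf phi by split=> //; exists B.
pose lw := log_weight psi P.
have dec (x : gap_shift S) N a M (y : renewal_base hS) :
    (a + one_position y M <= N)%N -> agree N (gap_coord x) (block_seq a M y) ->
    `|birkhoff_sum (@gap_shift_map S) phi N x - N%:R * P -
      (\sum_(i < M) lw (y i) - (N - one_position y M)%:R * lam)| <= gibbs_const theta B H.
  move=> LN xz; have := birkhoff_decomposition htheta B0 H0 phiB phiH P hrenewal LN xz.
  by rewrite -[phi _ - P]opprB mulrN.
have p_le (s : S) : expR (lw s) <= expR (B + distortion theta H - P) * expR (- lam) ^+ val s.
  rewrite -expRM_natl -expRD ler_expR.
  by have := log_weight_le htheta B0 H0 phiB phiH P hrenewal s; rewrite -[phi _ - P]opprB.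
have [nu nuP] := bernoulli_measure_exists hS (fun s => expR_gt0 (lw s)) hP.
have rho01 := exp_lam01 lam0.
have [mu muL] := lift_exists (fun s => expR_gt0 (lw s)) nuP rho01 p_le.
exists nu, mu; split=> //.
- exact: (lift_equilibrium_state phib lam0 dec p_le nuP muL).
- move=> mu'; exact: (equilibrium_state_unique phib lam0 dec p_le nuP muL).
- exact: (lift_pressure phib lam0 dec p_le nuP muL htheta).
Qed.
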